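(* Let $\alpha$ be a quadratic irrational real algebraic number. Then there is a constant $K$ depending only on $\alpha$ such that deciding $\exists^{6}\forall^{4}\exists^{11}$ $\alpha$-PA sentences with at most $K$ inequalities is $\mathsf{PSPACE}$-hard. Furthermore, for $\alpha = \sqrt{2}$ one can take $K = 10^6$.
   Context: For a real number $\alpha$, an $\alpha$-PA sentence ($\alpha$-Presburger sentence) is a statement $Q_1 \mathbf{x}_1 \in \mathbb{Z}^{n_1} \dots Q_r \mathbf{x}_r \in \mathbb{Z}^{n_r}\ \Phi(\mathbf{x}_1,\dots,\mathbf{x}_r)$, where $Q_1,\dots,Q_r \in \{\forall,\exists\}$ are $r$ alternating quantifiers, $\mathbf{x}_1,\dots,\mathbf{x}_r$ are blocks of integer variables, and $\Phi$ is a Boolean combination of linear inequalities in $\mathbf{x}_1,\dots,\mathbf{x}_r$ with coefficients and constant terms in $\mathbb{Z}[\alpha]$. Deciding a sentence means determining whether it is true. An $\exists^{6}\forall^{4}\exists^{11}$ sentence is one with three quantifier blocks $\exists,\forall,\exists$ having $6$, $4$ and $11$ integer variables respectively. The number of inequalities is the number of linear inequalities (atoms) in $\Phi$. A real algebraic number $\alpha$ is quadratic if it has degree $2$. For quadratic $\alpha$, elements of $\mathbb{Z}[\alpha]$ are represented as $c_0 + c_1\alpha$ with $c_0,c_1 \in \mathbb{Z}$, and the input size of a sentence is the total bit length of all its symbols, with integer coefficients and constants written in binary. *)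

(* Defs.v *)
From HB Require Import structures.
From mathcomp Require Import all_boot all_order all_algebra.
From mathcomp Require Import reals.

Set Implicit Arguments.
Unset Strict Implicit.
Unset Printing Implicit Defensive.

Import Order.TTheory GRing.Theory Num.Theory.
Local Open Scope ring_scope.

(* Deterministic multitape Turing machines.  A two-way infinite tape is stored
   as (reversed left part, scanned symbol, right part); these lists are never
   trimmed, so their total length is the number of cells of the tape that held
   input or have been scanned so far. *)

Inductive move := MoveLeft | Stay | MoveRight.

Definition tape (A : Type) : Type := (seq A * A * seq A)%type.

Definition write_move (A : Type) (blank : A) (am : A * move) (t : tape A) :
    tape A :=
  let: (l, _, r) := t in let: (a, m) := am in
  match m with
  | MoveLeft => (behead l, head blank l, a :: r)
  | Stay => (l, a, r)
  | MoveRight => (a :: l, head blank r, behead r)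
  end.

Definition tape_of_seq (A : Type) (blank : A) (s : seq A) : tape A :=
  ([::], head blank s, behead s).

Definition cells (A : Type) (t : tape A) : seq A :=
  let: (l, a, r) := t in rev l ++ a :: r.

(* [None] is the blank, [Some (inl b)] is the input/output bit [b], and
   [Some (inr a)] is an auxiliary symbol. *)
Definition symbol (A : finType) : finType := option (bool + A)%type.

(* A machine has [extra_tapes.+1] tapes.  [verdict q] is [None] when [q] is not
   a halting state, and otherwise tells whether [q] is accepting. *)
Record machine := Machine {
  extra_tapes : nat;
  state : finType;
  aux : finType;
  start : state;
  verdict : state -> option bool;
  delta : state -> {ffun 'I_extra_tapes.+1 -> symbol aux} ->
          state * {ffun 'I_extra_tapes.+1 -> symbol aux * move}
}.

Section Runs.
Variable M : machine.

Definition tapes : Type :=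
  {ffun 'I_(extra_tapes M).+1 -> tape (symbol (aux M))}.

Definition config : Type := (state M * tapes)%type.

Definition bits_to_symbols (x : seq bool) : seq (symbol (aux M)) :=
  [seq Some (inl b) | b <- x].

Definition init (x : seq bool) : config :=
  (start M, [ffun i => tape_of_seq None
                         (if i == ord0 then bits_to_symbols x else [::])]).

Definition step (c : config) : config :=
  if verdict c.1 is Some _ then c else
  let: (q, act) := delta c.1 [ffun i => (c.2 i).1.2] in
  (q, [ffun i => write_move None (act i) (c.2 i)]).

Definition run (n : nat) (x : seq bool) : config := iter n step (init x).

Definition space (c : config) : nat := (\sum_i size (cells (c.2 i)))%N.

(* The last tape holds [y], surrounded by blanks only. *)
Definition has_output (c : config) (y : seq bool) : Prop :=
  exists i j : nat,
    cells (c.2 ord_max) = nseq i None ++ bits_to_symbols y ++ nseq j None.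

End Runs.

Definition language : Type := seq bool -> Prop.

Definition in_PSPACE (A : language) : Prop :=
  exists (M : machine) (p : {poly nat}), forall x : seq bool,
    (exists (n : nat) (b : bool),
        verdict (run M n x).1 = Some b /\ (A x <-> b)) /\
    (forall n : nat, (space (run M n x) <= p.[size x])%N).

Definition polytime (f : seq bool -> seq bool) : Prop :=
  exists (M : machine) (p : {poly nat}), forall x : seq bool,
    exists n : nat,
      [/\ (n <= p.[size x])%N, verdict (run M n x).1 <> None
        & has_output (run M n x) (f x)].

Definition poly_reducible (A B : language) : Prop :=
  exists f : seq bool -> seq bool,
    polytime f /\ forall x : seq bool, A x <-> B (f x).

Definition PSPACE_hard (B : language) : Prop :=
  forall A : language, in_PSPACE A -> poly_reducible A B.

Definition quadratic (R : realType) (alpha : R) : Prop :=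
  exists p : {poly rat},
    [/\ irreducible_poly p, size p = 3 & root (map_poly ratr p) alpha].

(* The pair (c0, c1) represents c0 + c1 * alpha. *)
Definition coef : Type := (int * int)%type.

Definition coef_val (R : realType) (alpha : R) (c : coef) : R :=
  c.1%:~R + c.2%:~R * alpha.

(* [Ineq a b] is the inequality a_0 x_0 + ... + a_(n-1) x_(n-1) <= b; strict
   inequalities are negations of such atoms. *)
Inductive formula (n : nat) :=
  | Ineq of n.-tuple coef & coef
  | Not of formula n
  | And of formula n & formula n
  | Or of formula n & formula n.

Fixpoint sat (R : realType) (alpha : R) (n : nat) (F : formula n)
    (x : seq int) : bool :=
  match F with
  | Ineq a b =>
      \sum_(i < n) coef_val alpha (tnth a i) * (x`_i)%:~R <= coef_val alpha b
  | Not G => ~~ sat alpha G x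
  | And G H => sat alpha G x && sat alpha H x
  | Or G H => sat alpha G x || sat alpha H x
  end.

Fixpoint num_ineqs (n : nat) (F : formula n) : nat :=
  match F with
  | Ineq _ _ => 1
  | Not G => num_ineqs G
  | And G H | Or G H => num_ineqs G + num_ineqs H
  end.

Inductive quantifier := Ex | All.

(* One entry per quantifier block, with its number of variables. *)
Definition prefix : Type := seq (quantifier * nat).

Definition num_vars (qs : prefix) : nat := sumn [seq q.2 | q <- qs].

Record sentence := Sentence {
  quantifiers : prefix;
  body : formula (num_vars quantifiers)
}.

(* [x] lists the values of the variables already quantified. *)
Fixpoint quantify (qs : prefix) (P : seq int -> bool) (x : seq int) : Prop :=
  match qs with
  | [::] => P x
  | (Ex, n) :: qs' => exists y : n.-tuple int, quantify qs' P (x ++ y)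
  | (All, n) :: qs' => forall y : n.-tuple int, quantify qs' P (x ++ y)
  end.

Definition holds (R : realType) (alpha : R) (s : sentence) : Prop :=
  quantify (quantifiers s) (sat alpha (body s)) [::].

(* Sentences are written as bit strings in a prefix code, with connectives in
   Polish notation.  Integers are in binary, least significant digit first; a
   bit [true] announces a digit (or, in [encode_prefix], a block), and [false]
   ends the list. *)

Definition bits (n : nat) : seq bool :=
  mkseq (fun i => odd (n %/ 2 ^ i)) (up_log 2 n.+1).

Definition encode_nat (n : nat) : seq bool :=
  flatten [seq [:: true; b] | b <- bits n] ++ [:: false].

Definition encode_int (z : int) : seq bool := (z < 0) :: encode_nat `|z|%N.

Definition encode_coef (c : coef) : seq bool :=
  encode_int c.1 ++ encode_int c.2.

Fixpoint encode_formula (n : nat) (F : formula n) : seq bool :=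
  match F with
  | Ineq a b =>
      [:: false; false] ++ flatten [seq encode_coef c | c <- a] ++ encode_coef b
  | Not G => [:: false; true] ++ encode_formula G
  | And G H => [:: true; false] ++ encode_formula G ++ encode_formula H
  | Or G H => [:: true; true] ++ encode_formula G ++ encode_formula H
  end.

Definition encode_block (q : quantifier * nat) : seq bool :=
  (if q.1 is Ex then true else false) :: encode_nat q.2.

Definition encode_prefix (qs : prefix) : seq bool :=
  flatten [seq true :: encode_block q | q <- qs] ++ [:: false].

Definition encode (s : sentence) : seq bool :=
  encode_prefix (quantifiers s) ++ encode_formula (body s).

Definition true_sentences (R : realType) (alpha : R) (qs : prefix) (K : nat) :
    language :=
  fun w => exists s : sentence,
    [/\ quantifiers s = qs, (num_ineqs (body s) <= K)%N,
        holds alpha s & encode s = w].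

Definition prefix_code (T : Type) (e : T -> seq bool) : Prop :=
  forall (x y : T) (s t : seq bool), e x ++ s = e y ++ t -> x = y /\ s = t.

Lemma bits_inj : injective bits.
Proof.
have val e : forall n, (n < 2 ^ e)%N ->
    n = (\sum_(i < e) odd (n %/ 2 ^ i) * 2 ^ i)%N.
  elim: e => [|e IH] n lt_n; first by rewrite big_ord0; case: n lt_n.
  rewrite big_ord_recl /= expn0 divn1 muln1 -[LHS]odd_double_half.
  congr (_ + _)%N; rewrite [in LHS](IH n./2).
    rewrite -muln2 big_distrl /=; apply: eq_bigr => i _.
    by rewrite /bump /= add1n expnS divnMA divn2 -mulnA [(2 ^ i * 2)%N]mulnC.
  by rewrite ltn_half_double -mul2n -expnS.
move=> m n eq_mn.
have eq_e : up_log 2 m.+1 = up_log 2 n.+1.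
  by have := congr1 size eq_mn; rewrite !size_mkseq.
rewrite [LHS](val (up_log 2 m.+1)) ?up_logP //.
rewrite [RHS](val (up_log 2 m.+1)) ?eq_e ?up_logP //.
apply: eq_bigr => i _; congr (nat_of_bool _ * _)%N.
have := congr1 (nth false ^~ i) eq_mn.
by rewrite !nth_mkseq // eq_e.
Qed.

Lemma encode_nat_code : prefix_code encode_nat.
Proof.
move=> m n s t; rewrite /encode_nat -!catA.
suff E : forall u v : seq bool,
    flatten [seq [:: true; b] | b <- u] ++ [:: false] ++ s =
    flatten [seq [:: true; b] | b <- v] ++ [:: false] ++ t -> u = v /\ s = t.
  by move=> /E[/bits_inj].
elim=> [|a u IH] [|b v] //=; first by case.
by case=> -> /IH[-> ->].
Qed.

Lemma encode_int_code : prefix_code encode_int.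
Proof.
move=> x y s t [sg /encode_nat_code[ab ->]]; split=> //.
by rewrite [x]intEsign [y]intEsign sg ab.
Qed.

Lemma encode_coef_code : prefix_code encode_coef.
Proof.
move=> [x1 x2] [y1 y2] s t; rewrite /encode_coef -!catA.
by move=> /encode_int_code[/= -> /encode_int_code[/= -> ->]].
Qed.

Lemma encode_formula_code (n : nat) : prefix_code (@encode_formula n).
Proof.
elim=> [a b|G IG|G IG H IH|G IG H IH] [a' b'|G'|G' H'|G' H'] s t //=; case.
- rewrite -!(catA (flatten _)) => E.
  suff H : forall u v s t, size u = size v ->
      flatten [seq encode_coef c | c <- u] ++ s =
      flatten [seq encode_coef c | c <- v] ++ t -> u = v /\ s = t.
    have sz : size a = size a' by rewrite !size_tuple.
    by have [/val_inj-> /encode_coef_code[-> ->]] := H _ _ _ _ sz E.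
  elim=> [|c u IHu] [|c' v] w w' // [sz] Ew.
  have /encode_coef_code[<- /(IHu _ _ _ sz)[<- <-] //] :
      encode_coef c ++ flatten [seq encode_coef d | d <- u] ++ w =
      encode_coef c' ++ flatten [seq encode_coef d | d <- v] ++ w'.
    by rewrite !catA.
- by move=> /IG[-> ->].
- by rewrite -!(catA (encode_formula _)) => /IG[-> /IH[-> ->]].
- by rewrite -!(catA (encode_formula _)) => /IG[-> /IH[-> ->]].
Qed.

Lemma encode_prefix_code : prefix_code encode_prefix.
Proof.
elim=> [|[q m] u IH] [|[q' n] v] s t // E; first by case: E => ->.
case: (E) => eq_q _.
have /encode_nat_code[<- /IH[<- <-]] :
    encode_nat m ++ encode_prefix u ++ s = encode_nat n ++ encode_prefix v ++ t.
  have := congr1 (behead \o behead) E.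
  by rewrite /encode_prefix /= -!catA.
by case: q q' eq_q {E} => [] [].
Qed.

Lemma encode_inj : injective encode.
Proof.
move=> [p F] [q G]; rewrite /encode /= => /encode_prefix_code[eq_pq].
case: q / eq_pq G => G; rewrite -[encode_formula F]cats0 -[encode_formula G]cats0.
by move=> /encode_formula_code[->].
Qed.

(* Main.v *)
(* Let [B] be a unit of Z[alpha] with [B > 1] and [B + 1/B] an integer [t + 2 >= 4], as given by a
   solution of a Pell equation. An element of Z[B] is determined by its value and by its conjugate,
   obtained by replacing [B] by [C = 1/B], and a nonzero element [z] satisfies |val z * cval z| >= 1.
   Hence the powers of [B] are the totally positive elements that are minimal for both valuations,
   and a sum [u] of distinct powers of [B] has only one decomposition [u = v + w] with [val v] small
   and [cval w] small compared with a given power [e]: the truth of "[e] occurs in [u]" is therefore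
   expressible by linear inequalities, and integer variables encode finite sets of exponents.

   An accepting computation in polynomial space is a sequence of letters [g 0, g 1, ...], listing the
   configurations row by row, whose constraints relate letters at a distance at most one more than the
   row length. Writing the [j]-th letter [a] as the exponent [S j + a] in a first set and as
   [S j + s (a + 1)] in a second one, the difference of two exponents determines both letters and
   their distance, so that all constraints together say that no difference lies in one finite set.
   This set enters the sentence as a single coefficient pair, the sum of the corresponding powers of
   [B]; it is computed from the input by Horner's rule, and the number of inequalities is constant. *)

(* The only products available in a sentence are those of a variable with a coefficient. Multiplying
   a power [e] by a fixed set of powers shifts that set to the exponent of [e], so two quantified
   exponents are compared through their difference; this is why all constraints are turned into one
   set of forbidden differences. The exponents of that set are polynomially bounded, so its
   coefficient is short, whereas the quantified sets can be as large as the running time requires.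

   Nothing forces a quantified element to be a sum of distinct powers. An exponent counts as present
   when no single element is the lower part of [u] both at it and at the next exponent, which makes
   sense for every [u], and soundness only uses this. An element of nonnegative value has finitely
   many exponents, so a chain of blocks that may stop only at the accepting letter does reach it:
   this replaces a bound on the length.

   The prefix counts three sets (6 integers), two powers (4), and then two lower parts, two
   products, two auxiliary integers and a placeholder (11). *)
Require Import Defs.
From mathcomp Require Import all_boot all_order all_algebra.
From mathcomp Require Import reals.
From mathcomp Require Import boolp zify ring lra.

Set Implicit Arguments.
Unset Strict Implicit.
Unset Printing Implicit Defensive.

Import Order.TTheory GRing.Theory Num.Theory.
Local Open Scope ring_scope.

(** * The lattice generated by a unit and its digit expansions *)

Section Lattice.
Variables (R : realType) (B C : R) (t : nat).
Hypotheses (BC : B * C = 1) (BDC : B + C = (t + 2)%:R) (B1 : 1 < B).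
Hypothesis (t2 : (2 <= t)%N).

(** In the basis 1, [B - 1] the structure constants of [pair_mul] are nonnegative, because
    [(B - 1)^2 = t + t (B - 1)]. Multiplication by [B], which is the pair [(1, 1)], therefore stays
    within natural numbers, and the Turing machine never handles signs. *)
Definition pair_val (X : R) (z : int * int) : R := z.1%:~R + z.2%:~R * (X - 1).

Definition pair_mul (z w : int * int) : int * int :=
  (z.1 * w.1 + t%:Z * (z.2 * w.2),
   z.1 * w.2 + z.2 * w.1 + t%:Z * (z.2 * w.2)).

Definition pair_pow (i : nat) : int * int := iter i (pair_mul (1, 1)) (1, 0).

Notation val := (pair_val B).
Notation cval := (pair_val C).

Lemma t2R : 2 <= t%:R :> R.
Proof. by rewrite (ler_nat R 2). Qed.

Lemma C_gt0 : 0 < C.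
Proof.
have B0 : 0 < B by apply: lt_trans B1.
by rewrite -(pmulr_rgt0 _ B0) BC.
Qed.

Lemma C_lt1 : C < 1.
Proof. by rewrite -BC ltr_pMl ?C_gt0. Qed.

Lemma B_gt3 : 3 < B.
Proof.
by have := C_lt1; have := t2R; have := BDC; rewrite natrD => *; lra.
Qed.

Lemma C_lt3 : 3 * C < 1.
Proof. by rewrite -{2}BC ltr_pM2r ?C_gt0 ?B_gt3. Qed.

Lemma BBE : B * B = (t + 2)%:R * B - 1.
Proof. by rewrite -BDC -BC; ring. Qed.

Lemma CCE : C * C = (t + 2)%:R * C - 1.
Proof. by rewrite -BDC -BC; ring. Qed.

Lemma pair_valB (X : R) (z w : int * int) : pair_val X (z - w) = pair_val X z - pair_val X w.
Proof. by rewrite /pair_val /= !rmorphB /=; ring. Qed.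

Lemma pair_valD (X : R) (z w : int * int) : pair_val X (z + w) = pair_val X z + pair_val X w.
Proof. by rewrite /pair_val /= !rmorphD /=; ring. Qed.

Lemma pair_val0 (X : R) : pair_val X 0 = 0.
Proof. by rewrite /pair_val /= mul0r addr0. Qed.

Lemma pair_valM (X : R) (z w : int * int) : X * X = (t + 2)%:R * X - 1 ->
  pair_val X (pair_mul z w) = pair_val X z * pair_val X w.
Proof.
rewrite /pair_val /= !rmorphD !rmorphM /= => XX.
transitivity (z.1%:~R * w.1%:~R + (z.1%:~R * w.2%:~R + z.2%:~R * w.1%:~R) * (X - 1) +
   z.2%:~R * w.2%:~R * (X * X - 2 * X + 1)); last by ring.
rewrite XX -[t%:Z%:~R]/(t%:R); ring.
Qed.

Lemma valM z w : val (pair_mul z w) = val z * val w.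
Proof. exact/pair_valM/BBE. Qed.

Lemma cvalM z w : cval (pair_mul z w) = cval z * cval w.
Proof. exact/pair_valM/CCE. Qed.

Lemma pair_val_pow (X : R) (i : nat) : X * X = (t + 2)%:R * X - 1 ->
  pair_val X (pair_pow i) = X ^+ i.
Proof.
move=> XX; elim: i => [|i IH]; first by rewrite /pair_val /= mul0r addr0.
by rewrite /= pair_valM // IH exprS /pair_val /= mul1r addrC subrK.
Qed.

Lemma val_pow i : val (pair_pow i) = B ^+ i.
Proof. exact/pair_val_pow/BBE. Qed.

Lemma cval_pow i : cval (pair_pow i) = C ^+ i.
Proof. exact/pair_val_pow/CCE. Qed.

Lemma square_dvd (X Y m : int) : X ^+ 2 = m * Y ^+ 2 -> Y != 0 -> exists k, m = k ^+ 2.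
Proof.
move=> E Y0.
have : (`|Y| ^ 2 %| `|X| ^ 2)%N.
  by apply/dvdnP; exists `|m|%N; rewrite -!abszX E abszM.
rewrite dvdn_pexp2r // => /dvdnP[k Xk]; exists k%:Z.
have : X ^+ 2 = k%:Z ^+ 2 * Y ^+ 2.
  rewrite -(real_normK (num_real X)) -(real_normK (num_real Y)) -exprMn.
  by congr (_ ^+ 2); rewrite -!abszE Xk PoszM.
by rewrite E => /(mulIf (expf_neq0 2 Y0)).
Qed.

(** [t^2 + 4 t] lies strictly between the consecutive squares of [t + 1] and [t + 2], since
    [t >= 2]. *)
Lemma disc_not_square (k : int) : t%:Z ^+ 2 + 4 * t%:Z != k ^+ 2.
Proof.
apply/eqP=> E.
have [n kn] : exists n : nat, k ^+ 2 = n%:Z ^+ 2.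
  by exists `|k|%N; rewrite abszE real_normK // num_real.
rewrite kn in E.
have : (n < t + 2)%N.
  by rewrite ltnNge; apply/negP => ?; have : (t + 2)%:Z <= n%:Z by []; nia.
have : (t + 1 < n)%N.
  by rewrite ltnNge; apply/negP => ?; have : n%:Z <= (t + 1)%:Z by []; nia.
lia.
Qed.

Lemma norm_eq (z : int * int) :
  val z * cval z = (z.1 ^+ 2 + t%:Z * z.1 * z.2 - t%:Z * z.2 ^+ 2)%:~R.
Proof.
rewrite !expr2 rmorphB rmorphD /= !rmorphM /= -[t%:Z%:~R]/(t%:R).
rewrite /pair_val; set x := z.1%:~R; set y := z.2%:~R.
transitivity (x ^+ 2 + x * y * (B + C - 2) + y ^+ 2 * (B * C - (B + C) + 1)); first by ring.
rewrite BC BDC natrD; ring.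
Qed.

(** The product is the norm of [z], an integer. Completing the square turns a vanishing norm into a
    square root of the discriminant [t^2 + 4 t], which is not a square. *)
Lemma norm_ge1 (z : int * int) : z != 0 -> 1 <= `|val z * cval z|.
Proof.
move=> z0; rewrite norm_eq -intr_norm (ler_int R 1) -gtz0_ge1 normr_gt0.
apply/eqP; set x := z.1; set y := z.2 => N0.
have E : (2 * x + t%:Z * y) ^+ 2 = (t%:Z ^+ 2 + 4 * t%:Z) * y ^+ 2.
  by apply/eqP; rewrite -subr_eq0; apply/eqP; transitivity (4 * (x ^+ 2 + t%:Z * x * y - t%:Z * y ^+ 2)); [ring | rewrite N0 mulr0].
have [y0|y0] := eqVneq y 0.
  move: N0 z0; rewrite y0 !expr2 !mulr0 -expr2 subr0 addr0 => /eqP.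
  rewrite sqrf_eq0 => /eqP x0.
  by case: z @x @y x0 y0 {E} => /= x y -> ->; rewrite eqxx.
by have [k] := square_dvd E y0; apply/eqP/disc_not_square.
Qed.

Lemma small_eq0 (z : int * int) (X Y : R) : `|val z| < X -> `|cval z| < Y ->
  X * Y <= 1 -> z = 0.
Proof.
move=> hX hY XY; apply/eqP/negPn/negP => /norm_ge1; rewrite normrM.
apply/negP; rewrite -ltNge; apply: lt_le_trans XY.
by apply: ltr_pM.
Qed.

(** The value of the difference is zero, hence below any positive bound, in particular below the
    inverse of a bound on its conjugate. *)
Lemma pair_val_inj : injective val.
Proof.
move=> z w E; apply/eqP; rewrite -subr_eq0; apply/eqP.
apply: (@small_eq0 _ (1 / (`|cval (z - w)| + 1)) (`|cval (z - w)| + 1)).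
- by rewrite (pair_valB B) E subrr normr0 divr_gt0 // ltr_wpDl.
- by rewrite ltrDl.
- by rewrite mul1r mulVf // gt_eqF // ltr_wpDl.
Qed.

Lemma BCX i : B ^+ i * C ^+ i = 1.
Proof. by rewrite -exprMn BC expr1n. Qed.

Lemma BX_gt0 i : 0 < B ^+ i.
Proof. by rewrite exprn_gt0 // (lt_trans _ B1). Qed.

Lemma CX_gt0 i : 0 < C ^+ i.
Proof. exact/exprn_gt0/C_gt0. Qed.

Lemma pair_inv i z : exists w, val w = val z * C ^+ i /\ cval w = cval z * B ^+ i.
Proof.
(* The pair [(t + 1, -1)] is [C = t + 2 - B], the inverse of [B]. *)
exists (iter i (pair_mul (t.+1%:Z, -1)) z); elim: i => [|i [IH1 IH2]]; first by rewrite /= !mulr1.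
rewrite /= valM cvalM IH1 IH2 !exprS.
have -> : val (t.+1%:Z, -1) = C.
  rewrite /pair_val /= (_ : (t.+1%:~R : R) = t%:R + 1); last by rewrite -[t.+1%:~R]/(t.+1%:R) -natr1.
  by have := BDC; rewrite natrD => *; lra.
have -> : cval (t.+1%:Z, -1) = B.
  rewrite /pair_val /= (_ : (t.+1%:~R : R) = t%:R + 1); last by rewrite -[t.+1%:~R]/(t.+1%:R) -natr1.
  by have := BDC; rewrite natrD => *; lra.
by split; ring.
Qed.

Lemma exp_bracket (x : R) : 1 <= x -> exists i, B ^+ i <= x < B ^+ i.+1.
Proof.
move=> x1.
have exn : exists n, x < B ^+ n.
  exists (Num.bound x); apply: lt_le_trans (archi_boundP _) _; first by lra.
  have Bn n : n%:R <= B ^+ n.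
    elim: n => [|n IH]; first by rewrite expr0; lra.
    rewrite exprS -natr1; have : 1 <= B ^+ n by rewrite exprn_ege1 // ltW.
    by have := B_gt3 => *; nra.
  exact: Bn.
case: (ex_minnP exn) => -[|n] hn hmin; first by move: hn; rewrite expr0; lra.
by exists n; rewrite hn andbT leNgt; apply/negP => /hmin; rewrite ltnn.
Qed.

(* Consecutive totally positive minimal points of the lattice differ by the factor [B]. *)
Lemma power_char (e : int * int) : 1 <= val e -> 0 < cval e ->
  (forall z, ~ (0 < val z < val e /\ 0 < cval z < cval e)) ->
  exists i, e = pair_pow i.
Proof.
move=> e1 ce0 min_e; have [i /andP[Bi Bi1]] := exp_bracket e1; exists i.
apply: pair_val_inj; rewrite val_pow; apply/eqP; rewrite eq_le Bi andbT leNgt.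
apply/negP => lt_Bi.
have ce : cval e <= C ^+ i.
  rewrite leNgt; apply/negP => lt_C; apply: (min_e (pair_pow i)).
  by rewrite val_pow cval_pow BX_gt0 CX_gt0 lt_Bi lt_C.
(* Division by [B^i] moves [e] to some [w] with [1 < val w < B] and [0 < cval w <= 1]. As
   [val w - cval w = y (B - C)], these bounds leave only [y = 1], and then no integer [x] fits. *)
have [w [vw cw]] := pair_inv i e.
have w1 : 1 < val w.
  by rewrite vw -(BCX i) ltr_pM2r ?CX_gt0.
have wB : val w < B.
  by rewrite vw -[ltRHS]mulr1 -(BCX i) mulrA -exprS ltr_pM2r ?CX_gt0.
have cw0 : 0 < cval w by rewrite cw mulr_gt0 ?BX_gt0.
have cw1 : cval w <= 1.
  by rewrite cw -[leRHS](BCX i) mulrC ler_pM2l ?BX_gt0.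
move: w1 wB cw0 cw1; rewrite /pair_val.
have := B_gt3; have := C_lt3; have := C_gt0.
case: w {vw cw} => x y /= C0 C3 B3 w1 wB cw0 cw1.
have y1 : y = 1.
  have [le_y0|] := lerP y 0.
    have : y%:~R * (B - C) <= 0 by rewrite mulr_le0_ge0 ?lerz0 //; lra.
    by move=> ?; exfalso; lra.
  rewrite gtz0_ge1 le_eqVlt => /orP[/eqP//|]; rewrite -lezD1 => y2.
  have : 2 * (B - C) <= y%:~R * (B - C).
    by rewrite ler_wpM2r ?(ler_int R 2) //; lra.
  by move=> ?; exfalso; lra.
rewrite {y}y1 !mul1r in w1 wB cw0 cw1.
have : 0 < x by rewrite -(ltr_int R) /=; lra.
have : x < 2 by rewrite -(ltr_int R) /=; lra.
move=> x2 x0; have x1 : x = 1 by apply/eqP; rewrite eq_le -ltzD1 -gtz0_ge1 x2 x0.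
by rewrite x1 in wB; lra.
Qed.

Lemma pair_pow_min i (z : int * int) :
  ~ (0 < val z < val (pair_pow i) /\ 0 < cval z < cval (pair_pow i)).
Proof.
move=> [/andP[z0 zi] /andP[cz0 czi]].
have z_eq0 : z = 0.
  apply: (@small_eq0 _ (B ^+ i) (C ^+ i)); last by rewrite BCX.
    by rewrite gtr0_norm // -val_pow.
  by rewrite gtr0_norm // -cval_pow.
by rewrite z_eq0 pair_val0 ltxx in z0.
Qed.

(** [v] stands for the part of [u] below an exponent [i] and [u - v] for the rest, with [E = B^i]
    and [E' = C^i]. As [B > 3], distinct powers below [B^i] add up to less than [B^i / 2], and the
    conjugates of those from [B^i] on to less than [2 C^i]. The factors 1/2 and 2 cancel in the
    norm, which is why a cut is unique. *)
Definition cut (E E' : R) (u v : int * int) : Prop :=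
  [/\ 0 <= val v, 2 * val v < E, 0 <= cval (u - v) & cval (u - v) < 2 * E'].

Lemma cut_uniq i u v w :
  cut (B ^+ i) (C ^+ i) u v -> cut (B ^+ i) (C ^+ i) u w -> v = w.
Proof.
move=> [v1 v2 v3 v4] [w1 w2 w3 w4]; apply/eqP; rewrite -subr_eq0; apply/eqP.
rewrite !pair_valB in v3 v4 w3 w4.
apply: (@small_eq0 _ (B ^+ i / 2) (2 * C ^+ i)).
- by rewrite pair_valB ltr_norml; apply/andP; split; lra.
- by rewrite pair_valB ltr_norml; apply/andP; split; lra.
- by rewrite (_ : _ * _ = B ^+ i * C ^+ i); [rewrite BCX | field].
Qed.

(** One element cuts [u] both at [i] and at [i + 1], so nothing sits at the exponent [i]. An
    exponent is taken to be present in a lattice element when this fails. *)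
Definition no_digit (E E' : R) (u : int * int) : Prop :=
  exists v, cut E E' u v /\ cut (B * E) (C * E') u v.

(** If every exponent of the window were absent, the cut [v] at [i] would also be the cut at
    [i + 1], and so on up to [i + n], where uniqueness gives [v = w]. No assumption on the shape of
    [u] enters. *)
Lemma window_digit i n u v w :
  cut (B ^+ i) (C ^+ i) u v -> cut (B ^+ (i + n)) (C ^+ (i + n)) u w ->
  v <> w -> exists k, (i <= k < i + n)%N /\ ~ no_digit (B ^+ k) (C ^+ k) u.
Proof.
elim: n i v => [|n IH] i v.
  by rewrite addn0 => /cut_uniq H /H ->.
move=> sv sw vw; have [nd|] := pselect (no_digit (B ^+ i) (C ^+ i) u); last first.
  by exists i; rewrite leqnn addnS ltnS leq_addr.
case: nd => v' [sv' ]; rewrite -!exprS => sv1.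
have ev := cut_uniq sv' sv; rewrite ev in sv1.
have [] := IH i.+1 v sv1 _ vw; first by rewrite addSnnS.
move=> k [/andP[ik kn] nd]; exists k; split => //.
by rewrite ltnW //= -addSnnS.
Qed.

Fixpoint digit_sum (X : pred nat) (n : nat) : int * int :=
  if n is n'.+1 then
    (if X n' then pair_pow n' else 0) + digit_sum X n'
  else 0.

Lemma digit_sum_val X n : 0 <= val (digit_sum X n) /\ 2 * val (digit_sum X n) < B ^+ n.
Proof.
elim: n => [|n [IH1 IH2]]; first by rewrite /= pair_val0 expr0; split; lra.
rewrite /= pair_valD exprS; have := BX_gt0 n; have := B_gt3 => *.
by case: (X n); rewrite ?val_pow ?pair_val0; split; nra.
Qed.

(** The term [2 * C ^+ n] carries the induction: a further summand [C^n] is paid for by the drop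
    from [2 C^n] to [2 C^(n+1)]. *)
Lemma digit_sum_cval X i n : (i <= n)%N ->
  0 <= cval (digit_sum X n - digit_sum X i) /\
  cval (digit_sum X n - digit_sum X i) + 2 * C ^+ n <= 2 * C ^+ i.
Proof.
elim: n => [|n IH]; first by rewrite leqn0 => /eqP->; rewrite subrr pair_val0; split; lra.
rewrite leq_eqVlt => /orP[/eqP->|].
  by rewrite subrr pair_val0; split; lra.
rewrite ltnS => /IH{IH}; rewrite /= !pair_valB pair_valD exprS => -[IH1 IH2].
have := CX_gt0 n; have := C_lt3; have := C_gt0 => *.
by case: (X n); rewrite ?cval_pow ?pair_val0; split; nra.
Qed.

Lemma digit_sum_cut X i n : (i <= n)%N ->
  cut (B ^+ i) (C ^+ i) (digit_sum X n) (digit_sum X i).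
Proof.
move=> le_in; have [? ?] := digit_sum_val X i.
have [? ?] := digit_sum_cval X le_in.
by split => //; have := CX_gt0 n; lra.
Qed.

Lemma digit_sum_ext X Y n : (forall i, (i < n)%N -> X i = Y i) -> digit_sum X n = digit_sum Y n.
Proof.
elim: n => //= n IH XY; rewrite XY // IH // => i lt_in; exact/XY/ltnW.
Qed.

Lemma digit_sum_bound (X : pred nat) n m : (n <= m)%N -> (forall i, X i -> (i < n)%N) ->
  digit_sum X m = digit_sum X n.
Proof.
move=> le_nm Xn; elim: m le_nm => [|m IH]; first by rewrite leqn0 => /eqP->.
rewrite leq_eqVlt => /orP[/eqP->//|]; rewrite ltnS => le_nm /=.
by case: ifP => [/Xn|_]; [rewrite ltnNge le_nm | rewrite add0r IH].
Qed.

Lemma no_digitP (X : pred nat) n i : (forall i, X i -> (i < n)%N) ->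
  no_digit (B ^+ i) (C ^+ i) (digit_sum X n) <-> ~~ X i.
Proof.
(* Summing up to [m] leaves the sum unchanged and brings [i] into its range. A present [B^i] would
   belong to the unique cut at [i + 1], which is then too large to be a cut at [i]. *)
move=> Xn; set m := maxn n i.+1.
have im : (i < m)%N by rewrite leq_max leqnn orbT.
rewrite -(@digit_sum_bound X n m) ?leq_maxl //; split=> [[v [s1 s2]]|nX].
  apply/negP => Xi; rewrite -!exprS in s2.
  have Ev := cut_uniq s2 (digit_sum_cut X im).
  case: s1 => _ + _ _; rewrite Ev /= Xi pair_valD val_pow.
  by have [] := digit_sum_val X i; have := BX_gt0 i; lra.
exists (digit_sum X i); rewrite -!exprS; split; first exact/digit_sum_cut/ltnW.
by have := digit_sum_cut X im; rewrite /= (negbTE nX) add0r.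
Qed.

Lemma digit_sum_pow_mul X n i :
  pair_mul (digit_sum X n) (pair_pow i) =
  digit_sum (fun k => (i <= k)%N && X (k - i)%N) (n + i).
Proof.
apply: pair_val_inj; rewrite valM val_pow; elim: n => [|n IH].
  rewrite pair_val0 mul0r add0n.
  suff E j : (j <= i)%N -> digit_sum (fun k => (i <= k)%N && X (k - i)%N) j = 0.
    by rewrite E // pair_val0.
  by elim: j => //= j IH lt_ji; rewrite leqNgt lt_ji /= add0r IH // ltnW.
rewrite addSn /= leq_addl addnK !pair_valD mulrDl IH; congr (_ + _).
by case: (X n); rewrite ?pair_val0 ?mul0r // !val_pow exprD.
Qed.

(** For large [i] the element [u] is itself a cut at [i] and at [i + 1]. Later this bounds the
    exponents of the set of block starts and forces the chain of blocks to end. *)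
Lemma no_digit_large u : exists n, forall i, (n <= i)%N ->
  0 <= val u -> no_digit (B ^+ i) (C ^+ i) u.
Proof.
have [n /andP[_ hn]] := @exp_bracket (1 + `|2 * val u|) ltac:(by rewrite lerDl).
exists n.+1 => i le_ni u0; exists u.
have le_B : B ^+ n.+1 <= B ^+ i by rewrite ler_eXn2l.
have := ler_norm (2 * val u); have := B_gt3; have := BX_gt0 i.
rewrite /cut subrr pair_val0; have := CX_gt0 i; have := C_gt0 => *.
by split; split => //; nra.
Qed.

End Lattice.

(** * Pell equations and units *)

Section Pell.
Variables (R : realType) (D : int).
Hypotheses (D_gt0 : 0 < D) (D_nonsquare : forall k : int, D != k ^+ 2).

Lemma pigeonhole (T : finType) (g : nat -> T) : exists i j, (i < j)%N /\ g i = g j.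
Proof.
have : ~~ injectiveb (fun i : 'I_(#|T|.+1) => g i).
  by apply/negP => /injectiveP /leq_card; rewrite card_ord ltnn.
case/injectivePn => i [j ne_ij eq_ij].
case: (ltngtP i j) => [lt|lt|/val_inj E]; first by exists i, j.
  by exists j, i.
by rewrite E eqxx in ne_ij.
Qed.

(** Among the [N + 1] fractional parts of [0 x, ..., N x], two lie in the same one of [N] intervals
    of length [1/N]. *)
Lemma dirichlet (x : R) (N : nat) : (0 < N)%N ->
  exists (p : int) (q : nat), (0 < q <= N)%N /\ `|q%:R * x - p%:~R| < N%:R^-1.
Proof.
move=> N0; have N0R : 0 < N%:R :> R by rewrite ltr0n.
pose fr (i : nat) : R := i%:R * x - (Num.floor (i%:R * x))%:~R.
have fr0 i : 0 <= fr i < 1.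
  have := floor_le (i%:R * x); have := lt_succ_floor (i%:R * x).
  by rewrite /fr rmorphD /= => h1 h2; apply/andP; split; lra.
pose cl (i : 'I_N.+1) : 'I_N := insubd (Ordinal N0) `|Num.floor (N%:R * fr i)|%N.
have clE i : (cl i)%:~R <= N%:R * fr i < (cl i)%:~R + 1.
  have /andP[f0 f1] := fr0 i.
  have z0 : 0 <= Num.floor (N%:R * fr i) by rewrite floor_ge0 mulr_ge0.
  have lt_N : (`|Num.floor (N%:R * fr i)| < N)%N.
    rewrite -ltz_nat gez0_abs // floor_lt_int // -[X in _ < X]mulr1 ltr_pM2l //.
  rewrite /cl val_insubd lt_N gez0_abs // floor_le.
  by have := lt_succ_floor (N%:R * fr i); rewrite rmorphD.
have : ~~ injectiveb cl.
  by apply/negP => /injectiveP /leq_card; rewrite !card_ord ltnn.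
case/injectivePn => i0 [j0 ne eq_cl].
have [i [j [lt_ij Ecl]]] : exists i j : 'I_N.+1, (i < j)%N /\ cl i = cl j.
  case: (ltngtP i0 j0) => [lt|lt|/val_inj E]; first by exists i0, j0.
    by exists j0, i0.
  by rewrite E eqxx in ne.
exists (Num.floor (j%:R * x) - Num.floor (i%:R * x)), (j - i)%N; split.
  by rewrite subn_gt0 lt_ij (leq_trans (leq_subr _ _)) // -ltnS.
have -> : (j - i)%:R * x - (Num.floor (j%:R * x) - Num.floor (i%:R * x))%:~R = fr j - fr i.
  rewrite /fr natrB; last exact: ltnW.
  rewrite (rmorphB (intmul 1)); move: (Num.floor _) (Num.floor _) => u w.
  by move: (nat_of_ord i)%:R (nat_of_ord j)%:R => r s; ring.
have /andP[a1 a2] := clE i; have /andP[b1 b2] := clE j; rewrite -Ecl in b1 b2.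
rewrite -(ltr_pM2l N0R) mulfV ?gt_eqF // -{1}(gtr0_norm N0R) -normrM mulrBr ltr_norml.
by apply/andP; split; lra.
Qed.

Let d : R := Num.sqrt D%:~R.

Lemma d_sqr : d ^+ 2 = D%:~R.
Proof. by rewrite /d sqr_sqrtr // ler0z ltW. Qed.

Lemma d_ge0 : 0 <= d. Proof. exact: sqrtr_ge0. Qed.

Lemma d_irrational (p q : int) : q != 0 -> q%:~R * d != p%:~R :> R.
Proof.
move=> q0; apply/eqP => E.
have E2 : p ^+ 2 = D * q ^+ 2.
  apply: (@intr_inj R); rewrite rmorphXn rmorphM rmorphXn /= -E exprMn d_sqr mulrC //.
have [k Dk] := square_dvd E2 q0.
by have := D_nonsquare k; rewrite Dk eqxx.
Qed.

Definition pell_norm (z : int * int) : int := z.1 ^+ 2 - D * z.2 ^+ 2.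

Definition pell_dist (z : int * int) : R := `|z.2%:~R * d - z.1%:~R|.

Lemma pell_normE z : (pell_norm z)%:~R = - (z.2%:~R * d - z.1%:~R) * (z.2%:~R * d + z.1%:~R) :> R.
Proof.
rewrite /pell_norm !expr2 rmorphB !rmorphM /= -d_sqr; ring.
Qed.

Definition approximant (M : nat) (z : int * int) : Prop := 0 < z.2 /\ (`|pell_norm z| <= M)%N.

(** A Dirichlet approximation with denominator at most [N] has norm at most
    [(1/N) (2 d N + 1/N) <= 2 d + 1], a bound that does not depend on the required precision. *)
Lemma approximants : exists M, forall e : R, 0 < e ->
  exists z, approximant M z /\ pell_dist z < e.
Proof.
have d0 := d_ge0.
exists (Num.bound (2 * d + 1)) => e e0.
pose N := (Num.bound e^-1).+1.
have Ne : N%:R^-1 < e.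
  rewrite invf_plt ?posrE ?ltr0n //; apply: lt_le_trans (archi_boundP _) _; first by rewrite invr_ge0 ltW.
  by rewrite ler_nat.
have [p [q [/andP[q0 qN] hd]]] := @dirichlet d N isT.
have N1 : 1 <= N%:R :> R by rewrite (ler_nat R 1).
have qNR : q%:R <= N%:R :> R by rewrite ler_nat.
have q0R : 0 <= q%:R :> R by [].
exists (p, q%:Z); split; last exact: lt_trans hd Ne.
split => //.
suff le_norm : `|(pell_norm (p, q%:Z))%:~R| <= 2 * d + 1 :> R.
  rewrite -ltnS -ltz_nat -(ltr_int R) abszE intr_norm.
  apply: le_lt_trans le_norm _; apply: lt_trans (archi_boundP _) _; first lra.
  by rewrite -pmulrn ltr_nat.
rewrite pell_normE normrM normrN /=; set u := q%:R * d - p%:~R in hd *.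
have Np : N%:R^-1 * N%:R = 1 :> R by rewrite mulVf // gt_eqF // ltr0n.
have Ninv : 0 < N%:R^-1 :> R by rewrite invr_gt0 ltr0n.
have Ninv1 : N%:R^-1 <= 1 :> R by rewrite invf_le1 // ltr0n.
apply: (@le_trans _ _ (N%:R^-1 * (2 * d * N%:R + N%:R^-1))).
  apply: ler_pM => //; first exact: ltW.
  have -> : q%:R * d + p%:~R = 2 * d * q%:R - u by rewrite /u; ring.
  apply: le_trans (ler_normB _ _) _; apply: lerD; last exact: ltW.
  by rewrite ger0_norm ?mulr_ge0 // ler_wpM2l // mulr_ge0.
rewrite mulrDr mulrCA Np mulr1 lerD2l.
by rewrite mulr_ile1 // ltW.
Qed.

Lemma pell_solution : exists x y : int, y != 0 /\ x ^+ 2 - D * y ^+ 2 = 1.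
Proof.
have [M hM] := approximants.
have dist0 z : approximant M z -> 0 < pell_dist z.
  move=> [z2 _]; rewrite /pell_dist normr_gt0 subr_eq0; apply: d_irrational.
  by rewrite gt_eqF.
have hnext z : exists w, approximant M z -> approximant M w /\ pell_dist w < pell_dist z.
  have [hz|] := pselect (approximant M z); last by exists z.
  by have [w hw] := hM _ (dist0 z hz); exists w.
have [f hf] := boolp.choice hnext.
have [z0 [hz0 _]] := hM 1 ltr01.
pose g i := iter i f z0.
have hg i : approximant M (g i) by elim: i => //= i IH; apply: (hf _ IH).1.
have dec i j : (i < j)%N -> pell_dist (g j) < pell_dist (g i).
  elim: j => // j IH; rewrite ltnS leq_eqVlt => /orP[/eqP->|/IH]; first exact: (hf _ (hg j)).2.
  by apply: lt_trans; exact: (hf _ (hg j)).2.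
(* The factorial of [M] is a multiple of every nonzero norm of absolute value at most [M], so
   residues can be compared before the common norm is known. *)
pose L := M`!.
pose res (z : int) : 'I_L := insubd (Ordinal (fact_gt0 M)) `|(z %% L%:Z)%Z|%N.
have L0 : L%:Z != 0 by rewrite gt_eqF // ltz_nat fact_gt0.
have resP a b : res a = res b -> (L%:Z %| a - b)%Z.
  have lt_L c : (`|(c %% L%:Z)%Z| < L)%N.
    by rewrite -ltz_nat gez0_abs ?modz_ge0 // -{2}[L%:Z]gez0_abs // ltz_mod.
  move=> /(congr1 val); rewrite !val_insubd !lt_L => E.
  by rewrite -eqz_mod_dvd; apply/eqP; rewrite -[LHS]gez0_abs ?modz_ge0 // E gez0_abs ?modz_ge0.
pose cl i : 'I_(2 * M).+1 * 'I_L * 'I_L :=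
  (inord `|(pell_norm (g i) + M%:Z)%R|%N, res (g i).1, res (g i).2).
have [i [j [lt_ij [En /resP E1 /resP E2]]]] := pigeonhole cl.
have [q1 n1] := hg i; have [q2 n2] := hg j; have := dec i j lt_ij.
have {}En : pell_norm (g i) = pell_norm (g j).
  have := congr1 val En; rewrite /= !inordK; lia.
case: (g i) (g j) E1 E2 q1 n1 q2 n2 En => [p1 q1] [p2 q2] /= E1 E2 q1_gt0 n1 q2_gt0 n2 En lt_dist.
set n := pell_norm (p1, q1) in n1 En.
have n0 : n != 0.
  apply/eqP => n_eq0; have /= := @d_irrational p1 q1 _; rewrite gt_eqF // => /(_ isT).
  have [k Dk] : exists k, D = k ^+ 2.
    apply: (@square_dvd p1 q1 D); last by rewrite gt_eqF.
    by apply/eqP; rewrite -subr_eq0 -/(pell_norm (p1, q1)) -/n n_eq0.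
  by have := D_nonsquare k; rewrite Dk eqxx.
have nL : (n %| L%:Z)%Z.
  by rewrite dvdzE /=; apply: dvdn_fact; rewrite n1 andbT absz_gt0.
have [a Ea] := dvdzP (dvdz_trans nL E1); have [b Eb] := dvdzP (dvdz_trans nL E2).
have En1 : p1 ^+ 2 - D * q1 ^+ 2 = n by [].
have En2 : p2 ^+ 2 - D * q2 ^+ 2 = n by rewrite En.
have Ep : p1 = p2 + a * n by rewrite -Ea; ring.
have Eq : q1 = q2 + b * n by rewrite -Eb; ring.
(* The two approximants [p + q d] have the same norm [n] and are congruent modulo [n]; their
   quotient is [1 + (a + b d) (p2 - q2 d)], an element of norm 1 with these coordinates. *)
exists (p2 * a - D * q2 * b + 1), (p2 * b - q2 * a); split.
  (* If the second coordinate vanished, the approximants would be proportional, hence equal, against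
     the strict decrease of the distances. *)
  apply/eqP => Y0.
  have Ec : p1 * q2 = p2 * q1.
    by rewrite Ep Eq; apply/eqP; rewrite -subr_eq0; apply/eqP; transitivity (- (p2 * b - q2 * a) * n); [ring | rewrite Y0 oppr0 mul0r].
  have Eqq : q1 ^+ 2 = q2 ^+ 2.
    apply: (mulIf n0); rewrite -{1}En2 -{1}En1.
    transitivity ((p2 * q1) ^+ 2 - D * q1 ^+ 2 * q2 ^+ 2); first by ring.
    by rewrite -Ec; ring.
  have Eq12 : q1 = q2.
    by apply/eqP; rewrite -(eqrXn2 (n := 2)) ?Eqq // ltW.
  have Ep12 : p1 = p2.
    by apply: (mulIf (_ : q2 != 0)); [rewrite gt_eqF | rewrite Ec Eq12].
  by move: lt_dist; rewrite Ep12 Eq12 ltxx.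
have H0 : 2 * (p2 * a - D * q2 * b) + n * (a ^+ 2 - D * b ^+ 2) = 0.
  apply: (mulIf n0); rewrite mul0r.
  transitivity ((p1 ^+ 2 - D * q1 ^+ 2) - (p2 ^+ 2 - D * q2 ^+ 2)); last by rewrite En1 En2 subrr.
  by rewrite Ep Eq; ring.
transitivity (1 + (2 * (p2 * a - D * q2 * b) + (p2 ^+ 2 - D * q2 ^+ 2) * (a ^+ 2 - D * b ^+ 2))); first by ring.
by rewrite En2 H0 addr0.
Qed.

End Pell.

Section QuadraticUnit.
Variable R : realType.

Definition unit_data (alpha B C : R) (t : nat) (c d : int) : Prop :=
  [/\ B = c%:~R + d%:~R * alpha, B * C = 1, B + C = (t + 2)%:R, 1 < B & (2 <= t)%N].

Lemma quadratic_irrational (alpha : R) : quadratic alpha -> forall r : rat, alpha != ratr r.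
Proof.
move=> [p [[_ irr_p] size_p root_p]] r; apply/eqP => Er.
move: root_p; rewrite Er fmorph_root -dvdp_XsubCl => /(irr_p _ _).
rewrite size_XsubC => /(_ isT) /eqp_size.
by rewrite size_XsubC size_p.
Qed.

Lemma ratr_clear (q : rat) (n : int) : (denq q %| n)%Z ->
  exists m : int, n%:~R * ratr q = m%:~R :> R.
Proof.
case/dvdzP => k ->; exists (k * numq q).
have q0 : (denq q)%:~R != 0 :> R by rewrite intr_eq0 denq_neq0.
by rewrite /ratr !rmorphM /=; field.
Qed.

Lemma quadratic_int (alpha : R) : quadratic alpha -> exists a b e : int,
  a != 0 /\ a%:~R * alpha ^+ 2 + b%:~R * alpha + e%:~R = 0.
Proof.
move=> [p [_ size_p root_p]].
pose n := denq p`_0 * denq p`_1 * denq p`_2.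
have n0 : n != 0 by rewrite !mulf_neq0 ?denq_neq0.
have [e He] := @ratr_clear p`_0 n (dvdz_mulr _ (dvdz_mulr _ (dvdzz _))).
have [b Hb] := @ratr_clear p`_1 n (dvdz_mulr _ (dvdz_mull _ (dvdzz _))).
have [a Ha] := @ratr_clear p`_2 n (dvdz_mull _ (dvdzz _)).
exists a, b, e; split.
  have p2 : p`_2 != 0.
    by have := lead_coef_eq0 p; rewrite lead_coefE size_p /= => ->; rewrite -size_poly_eq0 size_p.
  by rewrite -(intr_eq0 R) -Ha mulf_neq0 ?intr_eq0 // fmorph_eq0.
rewrite -He -Hb -Ha; move: root_p; rewrite /root horner_coef size_map_poly size_p.
rewrite !big_ord_recl big_ord0 /= !coef_map /= /bump /= expr0 expr1 => /eqP E.
rewrite -[RHS](mulr0 (n%:~R : R)) -E; ring.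
Qed.

(** For a root of [a X^2 + b X + e], the number [dl = 2 a alpha + b] lies in Z[alpha] and its square
    is the discriminant, so a solution of the Pell equation gives the unit [x + y dl] with inverse
    [x - y dl]. *)
Lemma quadratic_unit (alpha : R) : quadratic alpha ->
  exists B C t c d, unit_data alpha B C t c d.
Proof.
move=> quad; have irr := quadratic_irrational quad.
have [a [b [e [a0 Ea]]]] := quadratic_int quad.
pose dl : R := (2 * a)%:~R * alpha + b%:~R.
pose D : int := b ^+ 2 - 4 * a * e.
have dlD : dl ^+ 2 = D%:~R.
  rewrite /D /dl !expr2 rmorphB !rmorphM /=.
  transitivity (b%:~R * b%:~R + 4 * a%:~R * (a%:~R * alpha ^+ 2 + b%:~R * alpha) : R); first by ring.
  have -> : a%:~R * alpha ^+ 2 + b%:~R * alpha = - e%:~R by apply/eqP; rewrite -addr_eq0 Ea.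
  by ring.
have dl_irr (k : int) : dl != k%:~R.
  apply/eqP => Ek; have := irr ((k - b)%:~R / (2 * a)%:~R).
  have a2 : (2 * a)%:~R != 0 :> R by rewrite intr_eq0 mulf_neq0.
  rewrite rmorph_div ?ratr_int /=; last by rewrite unitfE intr_eq0 mulf_neq0.
  rewrite !ratr_int => /eqP; apply; apply: (mulIf a2).
  by rewrite divfK // (rmorphB (intmul 1)) /= -Ek /dl; ring.
have Dns (k : int) : D != k ^+ 2.
  apply/eqP => Dk; move: dlD; rewrite Dk rmorphXn /= => /eqP; rewrite eqf_sqr.
  by rewrite (negbTE (dl_irr k)) -rmorphN (negbTE (dl_irr (- k))).
have D0 : 0 < D.
  rewrite lt_neqAle eq_sym (_ : D != 0) /=; last by have := Dns 0; rewrite expr0n.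
  by rewrite -(ler0z R) -dlD sqr_ge0.
have [x [y [y0 Exy]]] := pell_solution R D0 Dns.
have dl0 : dl != 0 by have := dl_irr 0.
(* The sign of [y'] makes [B] the larger of the two conjugates; below, [x' >= 2] makes
   [t = 2 x' - 2] at least 2. *)
have [y' [ydl Ey']] : exists y' : int, 0 < y'%:~R * dl /\ y' ^+ 2 = y ^+ 2.
  have : y%:~R * dl != 0 by rewrite mulf_neq0 // intr_eq0.
  rewrite neq_lt => /orP[lt0|gt0]; last by exists y.
  by exists (- y); rewrite rmorphN mulNr oppr_gt0 sqrrN.
have [x' [x'0 Ex']] : exists x' : nat, (2 <= x')%N /\ x'%:Z ^+ 2 = x ^+ 2.
  exists `|x|%N; have E : `|x|%:Z ^+ 2 = x ^+ 2 by rewrite abszE real_normK // num_real.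
  split => //; rewrite ltnNge; apply/negP => le1.
  have : 0 < y ^+ 2 by rewrite exprn_even_gt0.
  by have : `|x|%:Z <= 1 by []; nia.
have x'R : 2 <= x'%:R :> R by rewrite (ler_nat R 2).
exists (x'%:R + y'%:~R * dl), (x'%:R - y'%:~R * dl), (2 * x' - 2)%N, (x'%:Z + y' * b), (y' * (2 * a)); split.
- by rewrite rmorphD !rmorphM /= /dl rmorphM -[x'%:~R]/(x'%:R) /=; ring.
- transitivity ((x'%:Z ^+ 2 - D * y' ^+ 2)%:~R : R); last by rewrite Ex' Ey' Exy.
  by rewrite !expr2 rmorphB !rmorphM /= -dlD -[x'%:~R]/(x'%:R); ring.
- by rewrite subnK ?natrM; [ring | lia].
- by lra.
- by lia.
Qed.

(** [3 + 2 sqrt 2] is the square of [1 + sqrt 2], whose own norm is -1. *)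
Lemma sqrt2_unit : unit_data (Num.sqrt 2) (3 + 2 * Num.sqrt 2 : R) (3 - 2 * Num.sqrt 2) 4 3 2.
Proof.
have s2 : Num.sqrt 2 ^+ 2 = 2 :> R by rewrite sqr_sqrtr.
have s0 : 0 <= Num.sqrt 2 :> R by exact: sqrtr_ge0.
split => //.
- transitivity (9 - 4 * Num.sqrt 2 ^+ 2 : R); first by ring.
  by rewrite s2; ring.
- by ring.
- by lra.
Qed.

End QuadraticUnit.

(** * While programs on Turing machines *)

Section WhilePrograms.
Local Open Scope nat_scope.
Variable A : finType.
Notation sym := (symbol A).

(* A tape up to trailing blanks: the cells left of the head, read outwards, and the cells from the
   head on. *)
Definition stream_tape : Type := ((nat -> sym) * (nat -> sym))%type.

Definition stack_tape (l s : seq sym) : stream_tape := (nth None l, nth None s).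

Definition view (t : tape sym) : stream_tape :=
  let: (l, a, r) := t in stack_tape l (a :: r).

Definition stream_write (am : sym * move) (v : stream_tape) : stream_tape :=
  let: (a, m) := am in
  match m with
  | MoveLeft => (fun i => v.1 i.+1,
                 fun i => match i with 0 => v.1 0 | 1 => a | i.+2 => v.2 i.+1 end)
  | Stay => (v.1, fun i => if i is j.+1 then v.2 j.+1 else a)
  | MoveRight => (fun i => if i is j.+1 then v.1 j else a, fun i => v.2 i.+1)
  end.

Arguments stream_write : simpl never.
Arguments stack_tape : simpl never.

Lemma view_write am t : view (write_move None am t) = stream_write am (view t).
Proof.
by case: t am => [[l b] r] [a []]; rewrite /view /write_move /stack_tape /=; rewrite /stream_write /=; congr pair; apply/funext => i /=;
  case: l r i => [|? ?] [|? ?] [|[|[|i]]].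
Qed.

Lemma move_right a l x s :
  stream_write (a, MoveRight) (stack_tape l (x :: s)) = stack_tape (a :: l) s.
Proof. by congr pair; apply/funext => -[]. Qed.

Lemma move_right_nil a l :
  stream_write (a, MoveRight) (stack_tape l [::]) = stack_tape (a :: l) [::].
Proof. by congr pair; apply/funext => -[]. Qed.

Lemma move_left a c l x s :
  stream_write (a, MoveLeft) (stack_tape (c :: l) (x :: s)) = stack_tape l (c :: a :: s).
Proof. by congr pair; apply/funext => -[|[|i]] //=; case: l. Qed.

Lemma move_left_scanned c l s :
  stream_write (nth None s 0, MoveLeft) (stack_tape (c :: l) s) = stack_tape l (c :: s).
Proof. by congr pair; apply/funext => -[|[|i]] //=; case: s. Qed.

Lemma move_left_empty s :
  stream_write (nth None s 0, MoveLeft) (stack_tape [::] s) = stack_tape [::] (None :: s).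
Proof. by congr pair; apply/funext => -[|[|i]] //=; rewrite ?nth_nil //; case: s. Qed.

Lemma stay_cons a l x s :
  stream_write (a, Stay) (stack_tape l (x :: s)) = stack_tape l (a :: s).
Proof. by congr pair; apply/funext => -[]. Qed.

Lemma stay_scanned v : stream_write (v.2 0, Stay) v = v.
Proof. by case: v => l s; congr pair; apply/funext => -[]. Qed.

Lemma stack_tape_catl l i s : stack_tape (l ++ nseq i None) s = stack_tape l s.
Proof.
congr pair; apply/funext => j; rewrite nth_cat nth_nseq.
by case: ltnP => // le_j; rewrite nth_default // if_same.
Qed.

Lemma stack_tape_catr l i s : stack_tape l (s ++ nseq i None) = stack_tape l s.
Proof.
congr pair; apply/funext => j; rewrite nth_cat nth_nseq.
by case: ltnP => // le_j; rewrite nth_default // if_same.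
Qed.

Lemma stack_tape_blank l : stack_tape l [:: None] = stack_tape l [::].
Proof. exact: (stack_tape_catr l 1 [::]). Qed.

Lemma stack_tape_blankl s : stack_tape [:: None] s = stack_tape [::] s.
Proof. exact: (stack_tape_catl [::] 1 s). Qed.

Lemma nth_None_eq (l l' : seq sym) : nth None l = nth None l' -> None \notin l' ->
  exists i, l = l' ++ nseq i None.
Proof.
elim: l' l => [|b l' IH] l E; last first.
  rewrite inE negb_or => /andP[b0 /IH{}IH].
  case: l E => [|a l] E.
    by have := congr1 (fun f => f 0) E => /= Eb; rewrite -Eb eqxx in b0.
  have [|i ->] := IH l; last first.
    by exists i; have := congr1 (fun f => f 0) E => /= ->.
  by apply/funext => i; have := congr1 (fun f => f i.+1) E.
move=> _; exists (size l); rewrite cat0s; apply: (@eq_from_nth _ None); rewrite ?size_nseq // => i lt_i.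
by rewrite E nth_nil nth_nseq if_same.
Qed.

(** A nested tuple lets updates of a tape reduce by computation. The main program keeps the input on
    tape 0, a unary counter on 1, scratch on 2, the pair of numbers on 3, the carries on 4 and the
    output on 5. *)
Definition six (T : Type) : Type := (T * T * T * T * T * T)%type.

Definition map6 (T U : Type) (f : T -> U) (s : six T) : six U :=
  let: (a, b, c, d, e, g) := s in (f a, f b, f c, f d, f e, f g).

Definition zip6 (T U W : Type) (h : T -> U -> W) (s : six T) (r : six U) : six W :=
  let: (a, b, c, d, e, g) := s in
  let: (a', b', c', d', e', g') := r in
  (h a a', h b b', h c c', h d d', h e e', h g g').

Definition tup6 (T : Type) (f : 'I_6 -> T) : six T :=
  (f (inord 0), f (inord 1), f (inord 2), f (inord 3), f (inord 4), f (inord 5)).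

Definition untup6 (T : Type) (s : six T) (i : 'I_6) : T :=
  let: (a, b, c, d, e, g) := s in
  match val i with 0 => a | 1 => b | 2 => c | 3 => d | 4 => e | _ => g end.

Lemma untup6K T (s : six T) : tup6 (untup6 s) = s.
Proof. by case: s => [[[[[a b] c] d] e] g]; rewrite /tup6 /untup6 /= !inordK. Qed.

Definition vstate : Type := six stream_tape.

Definition scanned (V : vstate) : six sym := map6 (fun v => v.2 0) V.

Definition apply_acts (a : six (sym * move)) (V : vstate) : vstate :=
  zip6 stream_write a V.

Definition stay_acts (s : six sym) : six (sym * move) := map6 (pair^~ Stay) s.

Lemma apply_stay V : apply_acts (stay_acts (scanned V)) V = V.
Proof.
case: V => [[[[[a b] c] d] e] g].
by rewrite /apply_acts /stay_acts /scanned /=; do !f_equal; apply: stay_scanned.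
Qed.

Inductive prog :=
  | Act of six sym -> six (sym * move)
  | Seq of prog & prog
  | While of six sym -> bool & prog
  | If of six sym -> bool & prog & prog.

Inductive exec : prog -> vstate -> vstate -> nat -> Prop :=
  | ExecAct f V : exec (Act f) V (apply_acts (f (scanned V)) V) 1
  | ExecSeq p q V1 V2 V3 m n :
      exec p V1 V2 m -> exec q V2 V3 n -> exec (Seq p q) V1 V3 (m + n)
  | ExecWhileF (b : six sym -> bool) p V : ~~ b (scanned V) -> exec (While b p) V V 1
  | ExecWhileT (b : six sym -> bool) p V1 V2 V3 m n : b (scanned V1) ->
      exec p V1 V2 m -> exec (While b p) V2 V3 n -> exec (While b p) V1 V3 (m + n).+1
  | ExecIfT (b : six sym -> bool) p q V W n : b (scanned V) -> exec p V W n -> exec (If b p q) V W n.+1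
  | ExecIfF (b : six sym -> bool) p q V W n : ~~ b (scanned V) -> exec q V W n -> exec (If b p q) V W n.+1.

Fixpoint prog_state (p : prog) : finType :=
  match p with
  | Act _ => unit
  | Seq p q => (prog_state p + prog_state q)%type
  | While _ p => option (prog_state p)
  | If _ p q => option (prog_state p + prog_state q)%type
  end.

Fixpoint entry (p : prog) : prog_state p :=
  match p with
  | Act _ => tt
  | Seq p _ => inl (entry p)
  | While _ _ => None
  | If _ _ _ => None
  end.

(** In the result, [None] means that the program ends. As a state of [While] or [If], [None] is the
    test, one step that leaves all tapes unchanged; the body of a loop ends by returning to it. *)
Fixpoint prog_delta (p : prog) : prog_state p -> six sym ->
    option (prog_state p) * six (sym * move) :=
  match p with
  | Act f => fun _ s => (None, f s)
  | Seq p q => fun x s =>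
      match x with
      | inl x => let: (o, a) := prog_delta x s in
                 (Some (if o is Some x' then inl x' else inr (entry q)), a)
      | inr x => let: (o, a) := prog_delta x s in (omap inr o, a)
      end
  | While b p => fun x s =>
      match x with
      | None => (if b s then Some (Some (entry p)) else None, stay_acts s)
      | Some x => let: (o, a) := prog_delta x s in (Some o, a)
      end
  | If b p q => fun x s =>
      match x with
      | None => (Some (Some (if b s then inl (entry p) else inr (entry q))), stay_acts s)
      | Some (inl x) => let: (o, a) := prog_delta x s in (omap (Some \o inl) o, a)
      | Some (inr x) => let: (o, a) := prog_delta x s in (omap (Some \o inr) o, a)
      end
  end.

Inductive path_to (p : prog) : prog_state p -> vstate -> option (prog_state p) -> vstate ->
    nat -> Prop :=
  | PathOne x V :
      path_to x V (prog_delta x (scanned V)).1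
              (apply_acts (prog_delta x (scanned V)).2 V) 1
  | PathStep x V x' o W n : (prog_delta x (scanned V)).1 = Some x' ->
      path_to x' (apply_acts (prog_delta x (scanned V)).2 V) o W n ->
      path_to x V o W n.+1.

Lemma path_lift (p q : prog) (h : prog_state p -> prog_state q)
    (k : option (prog_state p) -> option (prog_state q)) :
  (forall x s, prog_delta (h x) s =
     (k (prog_delta x s).1, (prog_delta x s).2)) ->
  (forall x, k (Some x) = Some (h x)) ->
  forall x V o W n, path_to x V o W n -> path_to (h x) V (k o) W n.
Proof.
move=> hd hk x V o W n; elim=> {x V o W n} [x V|x V x' o W n Ex _ IH].
  by have := PathOne (h x) V; rewrite hd.
by apply: PathStep; rewrite hd /= ?Ex ?hk.
Qed.

Lemma path_cat p (x : prog_state p) V x' V' o W m n :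
  path_to x V (Some x') V' m -> path_to x' V' o W n -> path_to x V o W (m + n).
Proof.
move: {-2}(Some x') (erefl (Some x')) => o' Eo h; move: h Eo.
elim=> {x V o' V' m} [x V|x V y o' V' m Ey _ IH] Eo h2.
  by apply: PathStep; [exact: Eo | exact: h2].
by rewrite addSn; apply: PathStep; [exact: Ey | exact: IH].
Qed.

Lemma exec_path p V W n : exec p V W n -> path_to (entry p) V None W n.
Proof.
elim=> {p V W n}.
- by move=> f V; exact: (@PathOne (Act f) tt V).
- move=> p q V1 V2 V3 m n _ IHp _ IHq.
  apply: (@path_cat (Seq p q) _ _ (inr (entry q)) V2).
    apply: (@path_lift p (Seq p q) inl
       (fun o => Some (if o is Some x' then inl x' else inr (entry q))) _ _ _ _ _ _ _ IHp) => //.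
    by move=> x s /=; case: (prog_delta x s).
  apply: (@path_lift q (Seq p q) inr (omap inr) _ _ _ _ _ _ _ IHq) => //.
  by move=> x s /=; case: (prog_delta x s).
- move=> b p V nb; have := @PathOne (While b p) None V.
  by rewrite /= (negbTE nb) apply_stay.
- move=> b p V1 V2 V3 m n hb _ IHp _ IHw.
  apply: (@PathStep (While b p) _ _ (Some (entry p))); first by rewrite /= hb.
  rewrite apply_stay; apply: (@path_cat (While b p) _ _ None V2) => //.
  apply: (@path_lift p (While b p) Some Some _ _ _ _ _ _ _ IHp) => //.
  by move=> x s /=; case: (prog_delta x s).
- move=> b p q V W n hb _ IH.
  apply: (@PathStep (If b p q) _ _ (Some (inl (entry p)))); first by rewrite /= hb.
  rewrite apply_stay.
  apply: (@path_lift p (If b p q) (Some \o inl) (omap (Some \o inl)) _ _ _ _ _ _ _ IH) => //.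
  by move=> x s /=; case: (prog_delta x s).
- move=> b p q V W n hb _ IH.
  apply: (@PathStep (If b p q) _ _ (Some (inr (entry q)))); first by rewrite /= (negbTE hb).
  rewrite apply_stay.
  apply: (@path_lift q (If b p q) (Some \o inr) (omap (Some \o inr)) _ _ _ _ _ _ _ IH) => //.
  by move=> x s /=; case: (prog_delta x s).
Qed.

Definition prog_machine (p : prog) : machine :=
  @Machine 5 (option (prog_state p)) A (Some (entry p))
    (fun q => if q is None then Some true else None)
    (fun q s => if q is Some x then
         let: (o, a) := prog_delta x (tup6 s) in (o, [ffun i => untup6 a i])
       else (None, [ffun i => (s i, Stay)])).

Definition config_view (p : prog) (c : config (prog_machine p)) : vstate :=
  tup6 (fun i => view (c.2 i)).

Lemma step_view p (c : config (prog_machine p)) x : c.1 = Some x ->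
  (step c).1 = (prog_delta x (scanned (config_view c))).1 /\
  config_view (step c) =
    apply_acts (prog_delta x (scanned (config_view c))).2 (config_view c).
Proof.
case: c => q tp /= ->; rewrite /step /=.
have -> : tup6 [ffun i => (tp i).1.2] = scanned (@config_view p (Some x, tp)).
  rewrite /config_view /scanned /tup6 /= !ffunE.
  by do !f_equal; case: (tp _) => [[]].
case: (prog_delta _ _) => o a; split => //=.
rewrite -{2}[a]untup6K /config_view /apply_acts /tup6 /= !ffunE.
by rewrite -!view_write.
Qed.

Lemma path_run p x V o W n : path_to x V o W n ->
  forall c : config (prog_machine p), c.1 = Some x -> config_view c = V ->
  (iter n (@step _) c).1 = o /\ config_view (iter n (@step _) c) = W.
Proof.
elim=> {x V o W n} [x V|x V x' o W n Ex _ IH] c cx cV.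
  by have [] := step_view cx; rewrite cV.
have [s1 s2] := step_view cx; rewrite iterSr; apply: IH.
  by rewrite s1 cV.
by rewrite s2 cV.
Qed.

Definition word_tape (w : seq bool) : seq sym := [seq Some (inl b) | b <- w].

Definition input_state (x : seq bool) : vstate :=
  (stack_tape [::] (word_tape x), stack_tape [::] [::], stack_tape [::] [::],
   stack_tape [::] [::], stack_tape [::] [::], stack_tape [::] [::]).

Lemma init_view p x : config_view (init (prog_machine p) x) = input_state x.
Proof.
rewrite /config_view /tup6 /init /= !ffunE /=.
rewrite -!(inj_eq val_inj) /= !inordK //= !stack_tape_blank /input_state.
by case: x => //=; rewrite stack_tape_blank.
Qed.

(** Views forget the blanks at both ends, so the two halves of the last tape are known up to blanks,
    which [has_output] tolerates. *)
Lemma prog_run p x a b c d e y n :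
  exec p (input_state x) (a, b, c, d, e, stack_tape (rev (word_tape y)) [::]) n ->
  verdict (run (prog_machine p) n x).1 <> None /\ has_output (run (prog_machine p) n x) y.
Proof.
move=> /exec_path /path_run /(_ (init _ x)) /=; rewrite init_view => /(_ erefl erefl).
rewrite -/(run (prog_machine p) n x); set r := run _ n x => -[r1 r2]; split; first by rewrite r1.
have : view (r.2 ord_max) = stack_tape (rev (word_tape y)) [::].
  have -> : ord_max = inord 5 :> 'I_6 by apply: val_inj; rewrite /= inordK.
  by case: r2.
rewrite /has_output; case: (r.2 ord_max) => [[l s] t] /= [El Es].
have [|i ->] := nth_None_eq El.
  by rewrite mem_rev; apply/mapP => -[].
have [//|j /= Ej] := @nth_None_eq (s :: t) [::] Es.
exists i, j; rewrite Ej rev_cat revK -catA; congr cat.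
apply: (@eq_from_nth _ None); rewrite ?size_rev // size_nseq => k lt_k.
by rewrite nth_rev ?nth_nseq ?if_same // size_nseq.
Qed.

End WhilePrograms.

Arguments stream_write : simpl never.
Arguments stack_tape : simpl never.

(** * Running times of programs and loops *)

Section Runs.
Local Open Scope nat_scope.
Variable A : finType.
Notation sym := (symbol A).
Notation prog := (prog A).
Notation vstate := (vstate A).
Notation stack_tape := (@stack_tape A).

Definition runs (p : prog) (V W : vstate) (n : nat) : Prop :=
  exists2 m, m <= n & exec p V W m.

Lemma runs_weaken p V W m n : m <= n -> runs p V W m -> runs p V W n.
Proof. by move=> le_mn [k le_km h]; exists k => //; apply: leq_trans le_mn. Qed.

Lemma runs_act f (V : vstate) : runs (Act f) V (apply_acts (f (scanned V)) V) 1.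
Proof. by exists 1 => //; apply: ExecAct. Qed.

Lemma runs_seq p q V1 V2 V3 m n :
  runs p V1 V2 m -> runs q V2 V3 n -> runs (Seq p q) V1 V3 (m + n).
Proof. by move=> [a am ha] [b bn hb]; exists (a + b); [rewrite leq_add | apply: ExecSeq ha hb]. Qed.

Lemma runs_whileF (b : six sym -> bool) p V : ~~ b (scanned V) -> runs (While b p) V V 1.
Proof. by move=> hb; exists 1 => //; apply: ExecWhileF. Qed.

Lemma runs_whileT (b : six sym -> bool) p V1 V2 V3 m n : b (scanned V1) ->
  runs p V1 V2 m -> runs (While b p) V2 V3 n -> runs (While b p) V1 V3 (m + n).+1.
Proof.
move=> h [a am ha] [c cn hc]; exists (a + c).+1; first by rewrite ltnS leq_add.
exact: ExecWhileT ha hc.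
Qed.

Lemma runs_if (b : six sym -> bool) p q V W n :
  runs (if b (scanned V) then p else q) V W n -> runs (If b p q) V W n.+1.
Proof.
by move=> [m mn]; case: ifP => hb h; exists m.+1 => //;
  [apply: ExecIfT | apply: ExecIfF; rewrite ?hb].
Qed.

Definition get6 (T : Type) (i : nat) (s : six T) : T :=
  let: (a, b, c, d, e, g) := s in
  match i with 0 => a | 1 => b | 2 => c | 3 => d | 4 => e | _ => g end.

Definition put6 (T : Type) (i : nat) (x : T) (s : six T) : six T :=
  let: (a, b, c, d, e, g) := s in
  match i with
  | 0 => (x, b, c, d, e, g) | 1 => (a, x, c, d, e, g) | 2 => (a, b, x, d, e, g)
  | 3 => (a, b, c, x, e, g) | 4 => (a, b, c, d, x, g) | _ => (a, b, c, d, e, x)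
  end.

Lemma get_put T i (x : T) s : get6 i (put6 i x s) = x.
Proof. by case: s i => [[[[[a b] c] d] e] g] [|[|[|[|[|i]]]]]. Qed.

Lemma put_put T i (x y : T) s : put6 i x (put6 i y s) = put6 i x s.
Proof. by case: s i => [[[[[a b] c] d] e] g] [|[|[|[|[|i]]]]]. Qed.

Lemma scanned_put i v (V : vstate) : get6 i (scanned (put6 i v V)) = v.2 0.
Proof. by case: V i => [[[[[a b] c] d] e] g] [|[|[|[|[|i]]]]]. Qed.

Lemma apply_put i am (V : vstate) :
  apply_acts (put6 i am (stay_acts (scanned V))) V = put6 i (stream_write am (get6 i V)) V.
Proof.
rewrite -{4}[V]apply_stay.
by case: V i => [[[[[a b] c] d] e] g] [|[|[|[|[|i]]]]].
Qed.

Definition write_at (i : nat) (a : sym) (m : move) : prog :=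
  Act (fun s => put6 i (a, m) (stay_acts s)).

Definition move_at (i : nat) (m : move) : prog :=
  Act (fun s => put6 i (get6 i s, m) (stay_acts s)).

Definition nop : prog := Act (@stay_acts A).

Definition nonblank (i : nat) (s : six sym) : bool := get6 i s != None.

Lemma runs_nop V : runs nop V V 1.
Proof. by have := runs_act (@stay_acts A) V; rewrite apply_stay. Qed.

Lemma runs_write i a m v V :
  runs (write_at i a m) (put6 i v V) (put6 i (stream_write (a, m) v) V) 1.
Proof.
have := runs_act (fun s => put6 i (a, m) (stay_acts s)) (put6 i v V).
by rewrite apply_put get_put put_put.
Qed.

Lemma runs_move i m v V :
  runs (move_at i m) (put6 i v V) (put6 i (stream_write (v.2 0, m) v) V) 1.
Proof.
have := runs_act (fun s => put6 i (get6 i s, m) (stay_acts s)) (put6 i v V).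
by rewrite apply_put get_put put_put scanned_put.
Qed.

Definition sweep (i : nat) : prog := While (nonblank i) (move_at i MoveRight).

Definition back (i : nat) (body : prog) : prog :=
  Seq (move_at i MoveLeft)
    (Seq (While (nonblank i) (Seq body (move_at i MoveLeft))) (move_at i MoveRight)).

Definition for_each (i : nat) (body : prog) : prog := Seq (sweep i) (back i body).

Lemma runs_sweep i l s V : None \notin s ->
  runs (sweep i) (put6 i (stack_tape l s) V) (put6 i (stack_tape (rev s ++ l) [::]) V)
       (2 * size s + 1).
Proof.
elim: s l => [|a s IH] l.
  by move=> _; apply: runs_whileF; rewrite /nonblank scanned_put.
rewrite inE negb_or => /andP[a0 /IH{}IH].
apply: (runs_weaken _ (runs_whileT (n := 2 * size s + 1) _ (runs_move _ _ _ _) _)).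
- by rewrite /=; lia.
- by rewrite /nonblank scanned_put /= eq_sym.
- by rewrite (move_right a) rev_cons cat_rcons; apply: IH.
Qed.

(** The head passes over [w] from right to left, so [size r] rounds are complete when it scans [a];
    [G] gives the contents of the other tapes after each number of rounds. *)
Lemma runs_back i w s body (G : nat -> vstate) tau : None \notin w ->
  (forall l a r, w = rev l ++ a :: r ->
     runs body (put6 i (stack_tape l (a :: r ++ s)) (G (size r)))
               (put6 i (stack_tape l (a :: r ++ s)) (G (size r).+1)) tau) ->
  runs (back i body) (put6 i (stack_tape (rev w) s) (G 0))
       (put6 i (stack_tape [::] (w ++ s)) (G (size w))) ((tau + 2) * size w + 3).
Proof.
move=> w0 hbody.
have loop l a r : w = rev l ++ a :: r ->
    runs (While (nonblank i) (Seq body (move_at i MoveLeft)))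
      (put6 i (stack_tape l (a :: r ++ s)) (G (size r)))
      (put6 i (stack_tape [::] (None :: w ++ s)) (G (size w))) ((tau + 2) * (size l).+1 + 1).
  elim: l a r => [|b l IH] a r Ew.
    apply: (runs_weaken _ (runs_whileT (n := 1) _
      (runs_seq (hbody _ _ _ Ew) (runs_move _ _ _ _)) _)); first by rewrite /=; lia.
      rewrite /nonblank scanned_put /= eq_sym; apply: contra w0 => /eqP->.
      by rewrite Ew mem_cat inE eqxx orbT.
    rewrite (move_left_empty (a :: r ++ s)) (_ : a :: r ++ s = w ++ s) ?Ew //.
    by apply: runs_whileF; rewrite /nonblank scanned_put.
  apply: (runs_weaken _ (runs_whileT (n := (tau + 2) * (size l).+1 + 1) _
    (runs_seq (hbody _ _ _ Ew) (runs_move _ _ _ _)) _)); first by rewrite /=; lia.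
    rewrite /nonblank scanned_put /= eq_sym; apply: contra w0 => /eqP->.
    by rewrite Ew mem_cat inE eqxx orbT.
  rewrite (move_left_scanned b l (a :: r ++ s)); apply: (IH b (a :: r)).
  by rewrite Ew rev_cons cat_rcons.
apply: (runs_weaken (m := 1 + ((tau + 2) * size w + 1 + 1))); first by lia.
apply: runs_seq; first exact: runs_move.
apply: (@runs_seq _ _ _ (put6 i (stack_tape [::] (None :: w ++ s)) (G (size w)))); last first.
  by have := runs_move i MoveRight (stack_tape [::] (None :: w ++ s)) (G (size w));
    rewrite (move_right None) stack_tape_blankl.
case: (lastP w) w0 hbody loop => [|w' a] w0 hbody loop.
  rewrite (move_left_empty s) muln0.
  by apply: runs_whileF; rewrite /nonblank scanned_put.
rewrite rev_rcons (move_left_scanned a _ s).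
apply: (runs_weaken _ (loop (rev w') a [::] _)); last by rewrite revK cats1.
by rewrite size_rcons size_rev.
Qed.

Lemma runs_rewind i w s V : None \notin w ->
  runs (back i nop) (put6 i (stack_tape (rev w) s) V) (put6 i (stack_tape [::] (w ++ s)) V)
    (3 * size w + 3).
Proof. by move=> w0; apply: (@runs_back i w s nop (fun=> V) 1 w0) => *; apply: runs_nop. Qed.

Lemma runs_for i w body (G : nat -> vstate) tau : None \notin w ->
  (forall l a r, w = rev l ++ a :: r ->
     runs body (put6 i (stack_tape l (a :: r)) (G (size r)))
               (put6 i (stack_tape l (a :: r)) (G (size r).+1)) tau) ->
  runs (for_each i body) (put6 i (stack_tape [::] w) (G 0))
       (put6 i (stack_tape [::] w) (G (size w))) ((tau + 4) * size w + 4).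
Proof.
move=> w0 hbody; apply: (runs_weaken (m := (2 * size w + 1) + ((tau + 2) * size w + 3))); first lia.
apply: runs_seq; first exact: runs_sweep.
rewrite cats0 -{2}[w]cats0; apply: runs_back => // l a r Ew.
by rewrite cats0; apply: hbody.
Qed.

End Runs.

(** * Binary arithmetic of a Horner step *)

Section Numbers.
Local Open Scope nat_scope.
Variable t : nat.

(* Carries of the two components of a Horner step, and pairs of binary digits of the two components
   ([None] past the leading digit). *)
Definition aux_symbol : finType :=
  (('I_t.+2 * 'I_t.+2) + (option bool * option bool))%type.

Notation sym := (symbol aux_symbol).
Notation prog := (prog aux_symbol).
Notation vstate := (vstate aux_symbol).
Notation stack_tape := (@stack_tape aux_symbol).

Definition carry_sym (c d : nat) : sym := Some (inr (inl (inord c, inord d))).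
Definition digit_sym (x y : option bool) : sym := Some (inr (inr (x, y))).
Definition bit_sym (b : bool) : sym := Some (inl b).

Definition carries (s : sym) : nat * nat :=
  if s is Some (inr (inl (c, d))) then (nat_of_ord c, nat_of_ord d) else (0, 0).
Definition digits (s : sym) : option bool * option bool :=
  if s is Some (inr (inr p)) then p else (None, None).

Definition top_digit (n : nat) : option bool := if n == 0 then None else Some (odd n).

(** Least significant digits first, both numbers in the same cells. The end marks of [top_digit]
    distinguish missing digits from zeros, since [encode_nat] prints no leading zeros even when the
    other number is longer. The fuel [D + Q] suffices because halving decreases a nonzero sum. *)
Fixpoint num_cells_rec (f D Q : nat) : seq sym :=
  if f is f'.+1 then
    if (D == 0) && (Q == 0) then [::]
    else digit_sym (top_digit D) (top_digit Q) :: num_cells_rec f' D./2 Q./2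
  else [::].

Definition num_cells (D Q : nat) : seq sym := num_cells_rec (D + Q) D Q.

Lemma num_cells_recE f D Q : D + Q <= f -> num_cells_rec f D Q = num_cells D Q.
Proof.
suff H n : D + Q <= n -> D + Q <= f -> num_cells_rec f D Q = num_cells_rec n D Q.
  by move=> h; apply: H.
elim: n D Q f => [|n IH] D Q [|f].
- by [].
- by move=> h _; have [-> ->] : D = 0 /\ Q = 0 by lia.
- by move=> _ h; have [-> ->] : D = 0 /\ Q = 0 by lia.
- move=> h1 h2 /=; case: ifP => // DQ; congr cons.
  by apply: IH; have := odd_double_half D; have := odd_double_half Q; move: DQ; lia.
Qed.

Lemma num_cellsE D Q : num_cells D Q =
  if (D == 0) && (Q == 0) then [::]
  else digit_sym (top_digit D) (top_digit Q) :: num_cells D./2 Q./2.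
Proof.
rewrite {1}/num_cells; case En: (D + Q) => [|n] /=.
  by have -> : (D == 0) && (Q == 0) by rewrite -addn_eq0 En.
case: ifP => // DQ; congr cons; apply: num_cells_recE.
by have := odd_double_half D; have := odd_double_half Q; move: DQ; lia.
Qed.

Lemma num_cells_nonblank D Q : None \notin num_cells D Q.
Proof.
rewrite /num_cells; move: (D + Q) => f; elim: f D Q => //= n IH D Q.
by case: ifP => // _; rewrite inE negb_or IH.
Qed.

Lemma size_num_cells e D Q : D < 2 ^ e -> Q < 2 ^ e -> size (num_cells D Q) <= e.
Proof.
elim: e D Q => [|e IH] D Q; rewrite num_cellsE; first by rewrite !ltnS !leqn0 => -> ->.
by rewrite expnS => hD hQ; case: ifP => // _ /=; apply: IH; lia.
Qed.

Definition busy (s : six sym) : bool :=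
  nonblank 3 s || (carries (get6 4 s) != (0, 0)).

Definition out_digit (c v : nat) (x y : option bool) : option bool :=
  if [&& c == 0, x == None & y == None] then None else Some (odd v).

(** One cell of the simultaneous sums [c + D + t Q] and [d + D + (t + 1) Q]. Carries never exceed
    [t + 1], because [(t + 1) + 1 + (t + 1)] halves to less than [t + 2]. *)
Definition pass_acts (s : six sym) : six (sym * move) :=
  let: (x, y) := digits (get6 3 s) in
  let: (c, d) := carries (get6 4 s) in
  let v := c + (x == Some true) + t * (y == Some true) in
  let w := d + (x == Some true) + t.+1 * (y == Some true) in
  put6 3 (digit_sym (out_digit c v x y) (out_digit d w x y), MoveRight)
    (put6 4 (carry_sym v./2 w./2, Stay) (stay_acts s)).

Definition hop (b : bool) : prog :=
  Seq (write_at 4 (carry_sym b 0) Stay)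
    (Seq (While busy (Act pass_acts)) (back 3 (nop _))).

(** The coordinates of [b + B p]. The machine obtains the summand [b] by taking it as the initial
    carry of the first sum. *)
Definition hstep (b : bool) (p : nat * nat) : nat * nat :=
  (b + p.1 + t * p.2, p.1 + t.+1 * p.2).

Lemma top_digit_half v x y c n m k : 0 < k -> v = c + n + k * m ->
  x = top_digit n -> y = top_digit m ->
  out_digit c (c + (x == Some true) + k * (y == Some true)) x y = top_digit v.
Proof.
move=> k0 -> -> ->; rewrite /out_digit /top_digit !addn_eq0 muln_eq0 (gtn_eqF k0) /=.
have E p : ((if p == 0 then None else Some (odd p)) == Some true) = odd p.
  by case: p => //= p; case: odd.
have E0 p : ((if p == 0 then None else Some (odd p)) == None) = (p == 0).
  by case: ifP.
rewrite !E !E0 -andbA; case: ifP => // _; congr Some.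
by rewrite !oddD !oddM !oddb.
Qed.

Lemma carry_half v c n m k : v = c + n + k * m ->
  v./2 = (c + odd n + k * odd m)./2 + n./2 + k * m./2.
Proof.
move=> ->; have := odd_double_half n; have := odd_double_half m.
set a := odd n; set b := odd m => Em En; rewrite -{1}En -{1}Em mulnDr.
have -> : c + (a + n./2.*2) + (k * b + k * m./2.*2) =
  c + a + k * b + (n./2 + k * m./2).*2 by lia.
by rewrite halfD odd_double andbF add0n doubleK; lia.
Qed.

Lemma runs_pass x y z o l D Q c d : 0 < t -> c <= t.+1 -> d <= t.+1 ->
  let W := num_cells (c + D + t * Q) (d + D + t.+1 * Q) in
  runs (While busy (Act pass_acts))
    (x, y, z, stack_tape l (num_cells D Q), stack_tape [::] [:: carry_sym c d], o)
    (x, y, z, stack_tape (rev W ++ l) [::], stack_tape [::] [:: carry_sym 0 0], o)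
    (2 * size W + 1).
Proof.
move=> t0 /=; move: {2}_.+1 (ltnSn ((c + D + t * Q) + (d + D + t.+1 * Q))) => n.
elim: n c d D Q l => // n IH c d D Q l lt_n hc hd.
have [z0|nz] := boolP [&& c == 0, d == 0, D == 0 & Q == 0].
  case/and4P: z0 => /eqP-> /eqP-> /eqP-> /eqP->; rewrite !muln0 /=.
  by apply: runs_whileF; rewrite /busy /nonblank /= !inordK.
have hb : busy (scanned (x, y, z, stack_tape l (num_cells D Q),
    stack_tape [::] [:: carry_sym c d], o)).
  rewrite /busy /nonblank /= num_cellsE; case: ifP => //= /andP[D0 Q0].
  rewrite !inordK // xpair_eqE; apply: contra nz; rewrite /= => /andP[-> ->].
  by rewrite D0.
have nz2 : ((c + D + t * Q == 0) && (d + D + t.+1 * Q == 0)) = false.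
  apply: contraNF nz => /andP[/eqP h1 /eqP h2]; rewrite mulSn in h2.
  by apply/and4P; split; apply/eqP; lia.
set v := c + D + t * Q in lt_n nz2 *; set w := d + D + t.+1 * Q in lt_n nz2 *.
pose c' := (c + odd D + t * odd Q)./2; pose d' := (d + odd D + t.+1 * odd Q)./2.
have Ev : v./2 = c' + D./2 + t * Q./2 by exact: carry_half.
have Ew : w./2 = d' + D./2 + t.+1 * Q./2 by exact: carry_half.
rewrite (num_cellsE v w) nz2 rev_cons cat_rcons.
apply: (runs_weaken _ (runs_whileT (n := 2 * size (num_cells v./2 w./2) + 1) hb (runs_act _ _) _)).
  by rewrite /=; lia.
set s := scanned _.
have -> : apply_acts (pass_acts s) (x, y, z, stack_tape l (num_cells D Q),
      stack_tape [::] [:: carry_sym c d], o) =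
    (x, y, z, stack_tape (digit_sym (top_digit v) (top_digit w) :: l) (num_cells D./2 Q./2),
      stack_tape [::] [:: carry_sym c' d'], o).
  have Ed : digits (get6 3 s) = (top_digit D, top_digit Q).
    by rewrite /s /= num_cellsE; case: ifP => // /andP[/eqP-> /eqP->].
  have Ec : carries (get6 4 s) = (c, d) by rewrite /s /= !inordK.
  rewrite /pass_acts Ed Ec.
  rewrite (@top_digit_half v _ _ c D Q t) // (@top_digit_half w _ _ d D Q t.+1) //.
  have E p : (top_digit p == Some true) = odd p.
    by case: p => //= p; rewrite /top_digit /=; case: odd.
  rewrite !E -/c' -/d' /s /apply_acts /= !stay_scanned stay_cons.
  suff -> : forall u, stream_write (u, MoveRight) (stack_tape l (num_cells D Q)) =
    stack_tape (u :: l) (num_cells D./2 Q./2) by [].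
  move=> u; rewrite [in LHS]num_cellsE; case: ifP => [/andP[/eqP-> /eqP->]|_].
    exact: move_right_nil.
  exact: move_right.
rewrite Ev Ew; apply: IH.
- by rewrite -Ev -Ew; move: lt_n nz2; have := odd_double_half v; have := odd_double_half w; lia.
- rewrite /c'; lia.
- rewrite /d'; lia.
Qed.

Lemma runs_hop x y z o D Q e b (C : sym) : 0 < t ->
  let p := hstep b (D, Q) in p.1 < 2 ^ e -> p.2 < 2 ^ e ->
  runs (hop b)
    (x, y, z, stack_tape [::] (num_cells D Q), stack_tape [::] [:: C], o)
    (x, y, z, stack_tape [::] (num_cells p.1 p.2), stack_tape [::] [:: carry_sym 0 0], o)
    (5 * e + 5).
Proof.
move=> t0 p h1 h2.
set W := num_cells p.1 p.2; have sW : size W <= e by exact: size_num_cells.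
apply: (runs_weaken (m := 1 + ((2 * size W + 1) + (3 * size W + 3)))); first lia.
apply: runs_seq.
  have := runs_write 4 (carry_sym b 0) Stay (stack_tape [::] [:: C])
    (x, y, z, stack_tape [::] (num_cells D Q), stack_tape [::] [::], o).
  by rewrite /= stay_cons; apply.
apply: runs_seq.
  have := @runs_pass x y z o [::] D Q b 0 t0 _ isT; rewrite /= cats0 => h; apply: h.
  by case: (b).
have := @runs_rewind aux_symbol 3 W [::] (x, y, z, stack_tape [::] [::], stack_tape [::] [:: carry_sym 0 0], o) (num_cells_nonblank _ _).
by rewrite /= cats0 add0n.
Qed.

Fixpoint hops (w : seq bool) : prog :=
  if w is b :: w' then Seq (hop b) (hops w') else nop _.

Definition horner (w : seq bool) (p : nat * nat) : nat * nat :=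
  foldl (fun q b => hstep b q) p w.

(** The bound grows by the factor [t + 2] in each Horner step, so the length of the numbers is
    linear in the number of digits processed. *)
Definition bounded (h : nat) (p : nat * nat) : bool :=
  (p.1 < t.+2 ^ h) && (p.2 < t.+2 ^ h).

Lemma bounded_hstep h b p : bounded h p -> bounded h.+1 (hstep b p).
Proof.
case: p => D Q /andP[/= h1 h2]; rewrite /bounded /= expnS.
by move: (t.+2 ^ h) h1 h2 => P h1 h2; case: b; apply/andP; split; nia.
Qed.

Lemma bounded_horner w h p : bounded h p -> bounded (h + size w) (horner w p).
Proof.
elim: w h p => [|b w IH] h p hp /=; first by rewrite addn0.
by rewrite -addSnnS; apply/IH/bounded_hstep.
Qed.

Lemma bounded_exp2 H h p : h <= H -> bounded h p -> (p.1 < 2 ^ (t.+2 * H)) && (p.2 < 2 ^ (t.+2 * H)).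
Proof.
move=> hH /andP[h1 h2].
have le : t.+2 ^ h <= 2 ^ (t.+2 * H).
  apply: (@leq_trans (t.+2 ^ H)); first by rewrite leq_pexp2l.
  rewrite expnM; case: (H) => // H'.
  by rewrite leq_exp2r // ltnW // ltn_expl.
by rewrite (leq_trans h1 le) (leq_trans h2 le).
Qed.

Lemma runs_hops H x y z o w h p : 0 < t -> bounded h p -> h + size w <= H ->
  runs (hops w)
    (x, y, z, stack_tape [::] (num_cells p.1 p.2), stack_tape [::] [:: carry_sym 0 0], o)
    (x, y, z, stack_tape [::] (num_cells (horner w p).1 (horner w p).2),
      stack_tape [::] [:: carry_sym 0 0], o)
    ((5 * (t.+2 * H) + 5) * size w + 1).
Proof.
move=> t0; elim: w h p => [|b w IH] h p hp hH.
  by apply: (runs_weaken (m := 1)); [rewrite addn1 | exact: runs_nop].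
apply: (runs_weaken (m := (5 * (t.+2 * H) + 5) + ((5 * (t.+2 * H) + 5) * size w + 1))).
  by rewrite /=; lia.
have hp' := bounded_hstep b hp; rewrite /= in hH.
have hH' : h.+1 <= H by lia.
have /andP[h1 h2] := bounded_exp2 hH' hp'.
apply: runs_seq; last by apply: (IH h.+1 (hstep b p)) => //; rewrite addSnnS.
by case: p hp hp' h1 h2 => D Q *; apply: runs_hop.
Qed.

End Numbers.

(** * Polynomial bounds *)

Section PolyBounded.
Local Open Scope nat_scope.

Definition poly_bounded (f : nat -> nat) : Prop :=
  exists p : {poly nat}, forall n, f n <= (p.[n])%R.

Lemma poly_bounded_const c : poly_bounded (fun=> c).
Proof. by exists (c%:P)%R => n; rewrite hornerC. Qed.

Lemma poly_bounded_id : poly_bounded id.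
Proof. by exists 'X%R => n; rewrite hornerX. Qed.

Lemma poly_bounded_add f g : poly_bounded f -> poly_bounded g ->
  poly_bounded (fun n => f n + g n).
Proof. by move=> [p hp] [q hq]; exists (p + q)%R => n; rewrite hornerD leq_add. Qed.

Lemma poly_bounded_mul f g : poly_bounded f -> poly_bounded g ->
  poly_bounded (fun n => f n * g n).
Proof. by move=> [p hp] [q hq]; exists (p * q)%R => n; rewrite hornerM leq_mul. Qed.

Lemma poly_bounded_exp f k : poly_bounded f -> poly_bounded (fun n => f n ^ k).
Proof.
move=> hf; elim: k => [|k IH]; first exact: (poly_bounded_const 1).
have [p hp] := poly_bounded_mul hf IH.
by exists p => n; rewrite expnS.
Qed.

Lemma poly_bounded_le f g : (forall n, f n <= g n) -> poly_bounded g -> poly_bounded f.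
Proof. by move=> fg [p hp]; exists p => n; apply: leq_trans (hp n). Qed.

(** The reduction has to write the space bound in unary, which is easy for a constant times a power
    of [n + 1]. *)
Lemma poly_le_monomial (p : {poly nat}) : exists c k, forall n, (p.[n])%R <= c * n.+1 ^ k.
Proof.
elim/poly_ind: p => [|p a [c [k h]]]; first by exists 0, 0 => n; rewrite horner0.
exists (c + a), k.+1 => n; rewrite hornerD hornerM hornerX hornerC.
rewrite mulnDl; apply: leq_add.
  by rewrite expnSr mulnA; apply: leq_mul.
by rewrite -{1}[a]muln1 leq_mul // expn_gt0.
Qed.

End PolyBounded.

Section Bits.
Local Open Scope nat_scope.

Lemma bitsE n : bits n = if n == 0 then [::] else odd n :: bits n./2.
Proof.
rewrite /bits; case: n => [|n]; first by rewrite up_log1.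
rewrite up_log2S // /mkseq /=; congr cons; first by rewrite expn0 divn1.
rewrite (iotaDl 1 0) -map_comp.
by apply: eq_map => i /=; rewrite expnS divnMA divn2.
Qed.

End Bits.

(** * Printing the output and computing the unary space bound *)

Section MainProgram.
Local Open Scope nat_scope.
Variable t : nat.

Notation sym := (symbol (aux_symbol t)).
Notation prog := (prog (aux_symbol t)).
Notation vstate := (vstate (aux_symbol t)).
Notation stack_tape := (@stack_tape (aux_symbol t)).
Notation bit := (@bit_sym t).
Notation nop := (nop (aux_symbol t)).
Notation num_cells := (@num_cells t).
Notation word_tape := (@word_tape (aux_symbol t)).

Definition push (i : nat) (b : bool) : prog := write_at i (bit b) MoveRight.

Lemma runs_push i b w V :
  runs (push i b) (put6 i (stack_tape (rev (word_tape w)) [::]) V)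
    (put6 i (stack_tape (rev (word_tape (rcons w b))) [::]) V) 1.
Proof.
have := runs_write i (bit b) MoveRight (stack_tape (rev (word_tape w)) [::]) V.
by rewrite move_right_nil /word_tape map_rcons rev_rcons.
Qed.

Fixpoint push_word (i : nat) (w : seq bool) : prog :=
  if w is b :: w' then Seq (push i b) (push_word i w') else nop.

Lemma runs_push_word i w' w V :
  runs (push_word i w') (put6 i (stack_tape (rev (word_tape w)) [::]) V)
    (put6 i (stack_tape (rev (word_tape (w ++ w'))) [::]) V) (size w' + 1).
Proof.
elim: w' w => [|b w' IH] w; first by rewrite cats0; apply: runs_nop.
rewrite -cat_rcons; apply: (runs_weaken (m := 1 + (size w' + 1))); first by rewrite /=; lia.
by apply: runs_seq; [apply: runs_push | apply: IH].
Qed.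

Definition digit_of (j : bool) (s : sym) : option bool :=
  if j then (digits s).2 else (digits s).1.

Lemma digit_of_cells j D Q :
  digit_of j (nth None (num_cells D Q) 0) = top_digit (if j then Q else D).
Proof. by rewrite num_cellsE; case: ifP => [/andP[/eqP-> /eqP->]|_]; case: j. Qed.

Definition out_digit_acts (j : bool) (s : six sym) : six (sym * move) :=
  put6 3 (get6 3 s, MoveRight)
    (put6 5 (bit (digit_of j (get6 3 s) == Some true), MoveRight) (stay_acts s)).

Definition out_number (j : bool) : prog :=
  Seq (While (fun s => digit_of j (get6 3 s) != None)
         (Seq (push 5 true) (Act (out_digit_acts j))))
    (Seq (push 5 false) (back 3 nop)).

(** The printed number may be the shorter of the two, so the loop stops after a prefix [w] of the
    cells. *)
Lemma runs_out_digits j x y z c o l D Q :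
  let n := if j then Q else D in
  exists w s, num_cells D Q = w ++ s /\
  runs (While (fun s => digit_of j (get6 3 s) != None)
         (Seq (push 5 true) (Act (out_digit_acts j))))
    (x, y, z, stack_tape l (num_cells D Q), c, stack_tape (rev (word_tape o)) [::])
    (x, y, z, stack_tape (rev w ++ l) s, c,
     stack_tape (rev (word_tape (o ++ flatten [seq [:: true; b] | b <- bits n]))) [::])
    (3 * size w + 1).
Proof.
move=> n; move: {2}n.+1 (ltnSn n) => f; rewrite {}/n.
elim: f D Q o l => // f IH D Q o l lt_f.
set n := if j then Q else D in lt_f *.
have [n0|n0] := posnP n.
  exists [::], (num_cells D Q); split => //; rewrite n0 bitsE /= cats0.
  by apply: runs_whileF; rewrite /= digit_of_cells -/n n0.
have DQ : ((D == 0) && (Q == 0)) = false.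
  by apply: contraTF n0; rewrite /n; case: (j) => /andP[/eqP d0 /eqP q0]; rewrite ?d0 ?q0.
pose n' := if j then Q./2 else D./2.
have En : n./2 = n' by rewrite /n /n'; case: (j).
have [|w [s [Ew hr]]] := IH D./2 Q./2 (o ++ [:: true; odd n])
    (digit_sym t (top_digit D) (top_digit Q) :: l).
  by rewrite -/n' -En; have := odd_double_half n; lia.
exists (digit_sym t (top_digit D) (top_digit Q) :: w), s; split.
  by rewrite num_cellsE DQ Ew.
rewrite bitsE (gtn_eqF n0) En -/n' /= rev_cons cat_rcons.
rewrite -/n' -catA in hr.
apply: (runs_weaken (m := (2 + (3 * size w + 1)).+1)); first by rewrite /= mulnS; lia.
apply: (runs_whileT _ _ hr).
  by rewrite /= digit_of_cells -/n /top_digit (gtn_eqF n0).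
apply: (@runs_seq _ _ _ _ (x, y, z, stack_tape l (num_cells D Q), c,
    stack_tape (rev (word_tape (rcons o true))) [::]) _ 1 1).
  exact: (runs_push 5 true o (x, y, z, stack_tape l (num_cells D Q), c, stack_tape [::] [::])).
have := runs_act (out_digit_acts j) (x, y, z, stack_tape l (num_cells D Q), c,
    stack_tape (rev (word_tape (rcons o true))) [::]).
rewrite /apply_acts /out_digit_acts /= !stay_scanned digit_of_cells -/n num_cellsE DQ.
rewrite (move_right (digit_sym t (top_digit D) (top_digit Q))).
have -> : (top_digit n == Some true) = odd n.
  by rewrite /top_digit (gtn_eqF n0); case: odd.
by rewrite move_right_nil -rev_rcons -map_rcons -!cats1 -catA.
Qed.

Lemma runs_out_number j x y z c o D Q e : D < 2 ^ e -> Q < 2 ^ e ->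
  runs (out_number j)
    (x, y, z, stack_tape [::] (num_cells D Q), c, stack_tape (rev (word_tape o)) [::])
    (x, y, z, stack_tape [::] (num_cells D Q), c,
     stack_tape (rev (word_tape (o ++ encode_nat (if j then Q else D)))) [::])
    (6 * e + 5).
Proof.
move=> hD hQ.
have [w [s [Ew hr]]] := runs_out_digits j x y z c o [::] D Q.
have w0 : None \notin w.
  by have := num_cells_nonblank t D Q; rewrite Ew mem_cat negb_or => /andP[].
have sw : size w <= e.
  by apply: leq_trans (size_num_cells t hD hQ); rewrite Ew size_cat leq_addr.
apply: (runs_weaken (m := (3 * size w + 1) + (1 + (3 * size w + 3)))); first lia.
apply: runs_seq hr _; rewrite cats0 /encode_nat catA cats1; apply: runs_seq.
  exact: (runs_push 5 false _ (x, y, z, stack_tape (rev w) s, c, stack_tape [::] [::])).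
have := runs_rewind 3 s (x, y, z, stack_tape [::] [::], c, stack_tape
   (rev (word_tape (rcons (o ++ flatten [seq [:: true; b] | b <- bits (if j then Q else D)]) false))) [::]) w0.
by rewrite /= Ew.
Qed.

(** The sentences produced for a given machine differ only in the numbers [D] and [Q]. The output is
    a fixed list of words and of places for the code of [D] ([inr false]) or [Q] ([inr true]). *)
Definition piece : Type := (seq bool + bool)%type.

Definition fill (D Q : nat) (p : piece) : seq bool :=
  match p with inl w => w | inr j => encode_nat (if j then Q else D) end.

Definition piece_prog (p : piece) : prog :=
  match p with inl w => push_word 5 w | inr j => out_number j end.

Definition piece_size (p : piece) : nat := if p is inl w then size w else 0.

Fixpoint pieces_prog (ps : seq piece) : prog :=
  if ps is p :: ps' then Seq (piece_prog p) (pieces_prog ps') else nop.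

Lemma runs_pieces ps x y z c o D Q e : D < 2 ^ e -> Q < 2 ^ e ->
  runs (pieces_prog ps)
    (x, y, z, stack_tape [::] (num_cells D Q), c, stack_tape (rev (word_tape o)) [::])
    (x, y, z, stack_tape [::] (num_cells D Q), c,
     stack_tape (rev (word_tape (o ++ flatten [seq fill D Q p | p <- ps]))) [::])
    (sumn [seq piece_size p | p <- ps] + (6 * e + 5) * size ps + 1).
Proof.
move=> hD hQ; elim: ps o => [|p ps IH] o.
  by rewrite /= cats0 muln0; apply: runs_nop.
rewrite [flatten _]/= catA.
apply: (runs_weaken (m := (piece_size p + (6 * e + 5)) +
  (sumn [seq piece_size p | p <- ps] + (6 * e + 5) * size ps + 1))); first by rewrite /=; lia.
apply: runs_seq (IH _).
case: p => [w|j] /=.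
  apply: (runs_weaken (m := size w + 1)); first lia.
  exact: (runs_push_word 5 w o (x, y, z, stack_tape [::] (num_cells D Q), c, stack_tape [::] [::])).
by rewrite add0n; apply: runs_out_number.
Qed.

Notation ones m := (nseq m (bit true)).

Lemma ones_nonblank m : None \notin ones m.
Proof. by rewrite mem_nseq andbF. Qed.

Lemma rev_ones m : rev (ones m) = ones m.
Proof.
by rewrite rev_nseq.
Qed.

Definition push_one (i : nat) : prog := push i true.

Lemma runs_push_one i m V :
  runs (push_one i) (put6 i (stack_tape (ones m) [::]) V) (put6 i (stack_tape (ones m.+1) [::]) V) 1.
Proof. by have := runs_write i (bit true) MoveRight (stack_tape (ones m) [::]) V; rewrite move_right_nil. Qed.

Definition drain : prog :=
  Seq (move_at _ 2 MoveLeft)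
    (Seq (While (@nonblank _ 2) (Seq (push_one 1) (write_at 2 None MoveLeft)))
       (move_at _ 2 MoveRight)).

Lemma runs_drain x m k n c o :
  runs drain (x, stack_tape (ones m) [::], stack_tape (ones k) [::], n, c, o)
    (x, stack_tape (ones (m + k)) [::], stack_tape [::] [::], n, c, o) (3 * k + 3).
Proof.
pose st i v : vstate := (x, stack_tape (ones i) [::], v, n, c, o).
apply: (runs_weaken (m := 1 + ((3 * k + 1) + 1))); first lia.
apply: (@runs_seq _ _ _ _ (st m (stack_tape (behead (ones k)) [:: head None (ones k)]))).
  have := runs_move 2 MoveLeft (stack_tape (ones k) [::]) (st m (stack_tape [::] [::])).
  case: k => [|k]; first by rewrite (move_left_empty [::]).
  by rewrite (move_left_scanned _ _ [::]).
apply: (@runs_seq _ _ _ _ (st (m + k) (stack_tape [::] [::]))); last first.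
  have := runs_move 2 MoveRight (stack_tape [::] [::]) (st (m + k) (stack_tape [::] [::])).
  by rewrite (move_right_nil None) stack_tape_blankl.
elim: k m => [|k IH] m.
  by rewrite addn0 stack_tape_blank; apply: runs_whileF.
apply: (runs_weaken _ (runs_whileT (n := 3 * k + 1) _ (runs_seq
   (runs_push_one 1 m (st m (stack_tape (ones k) [:: bit true])))
   (runs_write 2 None MoveLeft (stack_tape (ones k) [:: bit true]) (st m.+1 (stack_tape [::] [::])))) _)).
- lia.
- by [].
have E : stream_write (None, MoveLeft) (stack_tape (ones k) [:: bit true]) =
    stack_tape (behead (ones k)) [:: head None (ones k)].
  case: (k) => [|k'] /=; first by rewrite -stack_tape_blankl move_left (stack_tape_catr _ 1 [:: None]).
  by rewrite move_left (stack_tape_catr _ 1 [:: bit true]).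
by rewrite E addnS -addSn; apply: IH.
Qed.

(** Tape 2 collects [m] ones per input letter, and [drain] appends them to the [m] ones of tape 1,
    which multiplies [m] by the input length plus one. *)
Definition mulstep : prog :=
  Seq (for_each 0 (for_each 1 (push_one 2))) (Seq (sweep _ 1) (Seq drain (back 1 nop))).

Lemma runs_mulstep w m n c o :
  runs mulstep (stack_tape [::] (word_tape w), stack_tape [::] (ones m), stack_tape [::] [::], n, c, o)
    (stack_tape [::] (word_tape w), stack_tape [::] (ones (m * (size w).+1)), stack_tape [::] [::], n, c, o)
    (11 * (m.+1 * (size w).+1)).
Proof.
set k := size w.
apply: (runs_weaken (m := ((5 * m + 4 + 4) * k + 4) + ((2 * m + 1) + ((3 * (k * m) + 3) + (3 * (m * k.+1) + 3))))); first lia.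
pose Y := stack_tape [::] (ones m).
apply: (@runs_seq _ _ _ _ (stack_tape [::] (word_tape w), Y, stack_tape (ones (k * m)) [::], n, c, o)).
  have w0 : None \notin word_tape w by apply/mapP => -[].
  have := @runs_for _ 0 (word_tape w) (for_each 1 (push_one 2))
    (fun i => (stack_tape [::] [::], Y, stack_tape (ones (i * m)) [::], n, c, o)) (5 * m + 4) w0.
  rewrite size_map; apply => l a r _ /=; rewrite mulSn addnC.
  have := @runs_for _ 1 (ones m) (push_one 2)
    (fun i => (stack_tape l (a :: r), Y, stack_tape (ones (size r * m + i)) [::], n, c, o)) 1 (ones_nonblank m).
  rewrite addn0 size_nseq; apply => l' a' r' _ /=; rewrite addnS.
  exact: (runs_push_one 2 _ (stack_tape l (a :: r), stack_tape l' (a' :: r'), stack_tape [::] [::], n, c, o)).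
apply: (@runs_seq _ _ _ _ (stack_tape [::] (word_tape w), stack_tape (ones m) [::], stack_tape (ones (k * m)) [::], n, c, o)).
  have := runs_sweep 1 [::] (stack_tape [::] (word_tape w), Y, stack_tape (ones (k * m)) [::], n, c, o) (ones_nonblank m).
  by rewrite cats0 rev_ones size_nseq.
apply: runs_seq; first exact: runs_drain.
have -> : m + k * m = m * k.+1 by lia.
have := runs_rewind 1 [::] (stack_tape [::] (word_tape w), Y, stack_tape [::] [::], n, c, o) (ones_nonblank (m * k.+1)).
by rewrite rev_ones cats0 size_nseq.
Qed.

Fixpoint unary_power (c k : nat) : prog :=
  if k is k'.+1 then Seq (unary_power c k') mulstep
  else Seq (push_word 1 (nseq c true)) (back 1 nop).

Lemma runs_unary_power a k w n c o :
  runs (unary_power a k) (stack_tape [::] (word_tape w), stack_tape [::] [::], stack_tape [::] [::], n, c, o)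
    (stack_tape [::] (word_tape w), stack_tape [::] (ones (a * (size w).+1 ^ k)), stack_tape [::] [::], n, c, o)
    (4 * a + 4 + 11 * k * ((a * (size w).+1 ^ k).+1 * (size w).+1)).
Proof.
elim: k => [|k IH].
  apply: (runs_weaken (m := (size (nseq a true) + 1) + (3 * size (ones a) + 3))).
    by rewrite !size_nseq; lia.
  have E : word_tape (nseq a true) = ones a by rewrite /word_tape map_nseq.
  apply: runs_seq.
    exact: (runs_push_word 1 (nseq a true) [::] (stack_tape [::] (word_tape w), stack_tape [::] [::], stack_tape [::] [::], n, c, o)).
  have := runs_rewind 1 [::] (stack_tape [::] (word_tape w), stack_tape [::] [::], stack_tape [::] [::], n, c, o) (ones_nonblank a).
  by rewrite /= E cats0 muln1.
rewrite expnSr mulnA; set P := a * (size w).+1 ^ k in IH *.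
apply: runs_weaken (runs_seq IH (runs_mulstep _ _ _ _ _)).
set s := (size w).+1; have h : P.+1 * s <= (P * s).+1 * s.
  by rewrite leq_mul2r ltnS leq_pmulr ?orbT.
have : k * (P.+1 * s) <= k * ((P * s).+1 * s) by rewrite leq_mul2l h orbT.
by lia.
Qed.

End MainProgram.

(** * A polynomial-time transducer based on Horner's rule *)

Section HornerTransducer.
Local Open Scope nat_scope.
Variable t : nat.
Hypothesis t_gt0 : 0 < t.
Variables (a k : nat) (top blank bottom : seq bool) (pat : bool -> seq bool).
Variable pieces : seq piece.

Notation stack_tape := (@stack_tape (aux_symbol t)).
Notation num_cells := (@num_cells t).
Notation word_tape := (@word_tape (aux_symbol t)).
Notation ones m := (nseq m (@bit_sym t true)).

(** Digits come from the highest exponent down, as Horner's rule consumes them. The input occurs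
    reversed, since distances grow along it, and this is also the order in which [for_each] visits
    its cells. *)
Definition digit_word (x : seq bool) : seq bool :=
  top ++ flatten (nseq (a * (size x).+1 ^ k) blank) ++ flatten [seq pat b | b <- rev x] ++ bottom.

Definition transducer_output (x : seq bool) : seq bool :=
  let p := horner t (digit_word x) (0, 0) in flatten [seq fill p.1 p.2 q | q <- pieces].

Definition input_body : prog (aux_symbol t) :=
  If (fun s => get6 0 s == @bit_sym t true) (hops t (pat true)) (hops t (pat false)).

Definition transducer_prog : prog (aux_symbol t) :=
  Seq (unary_power t a k)
    (Seq (write_at 4 (carry_sym t 0 0) Stay)
      (Seq (hops t top)
        (Seq (for_each 1 (hops t blank))
          (Seq (for_each 0 input_body)
            (Seq (hops t bottom) (pieces_prog t pieces)))))).

Lemma horner_cat w w' p : horner t (w ++ w') p = horner t w' (horner t w p).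
Proof. exact: foldl_cat. Qed.

Definition hop_cost (H : nat) : nat := 5 * (t.+2 * H) + 5.

Definition max_word (n : nat) : nat :=
  size top + (a * n.+1 ^ k) * size blank + n * (size (pat true) + size (pat false)) + size bottom.

Lemma size_flatten_nseq (w : seq bool) m : size (flatten (nseq m w)) = m * size w.
Proof. by elim: m => //= m IH; rewrite size_cat IH mulSn. Qed.

Lemma size_flatten_pat (u : seq bool) :
  size (flatten [seq pat b | b <- u]) <= size u * (size (pat true) + size (pat false)).
Proof.
elim: u => //= b u IH; rewrite size_cat mulSn; apply: leq_add => //.
by case: b; rewrite ?leq_addr ?leq_addl.
Qed.

Definition time_bound (n : nat) : nat :=
  (4 * a + 4 + 11 * k * ((a * n.+1 ^ k).+1 * n.+1)) +
  (1 + ((hop_cost (max_word n) * size top + 1) +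
    ((hop_cost (max_word n) * size blank + 1 + 4) * (a * n.+1 ^ k) + 4 +
     (((hop_cost (max_word n) * (size (pat true) + size (pat false)) + 1).+1 + 4) * n + 4 +
      ((hop_cost (max_word n) * size bottom + 1) +
       (sumn [seq piece_size q | q <- pieces] +
         (6 * (t.+2 * max_word n) + 5) * size pieces + 1)))))).

Lemma runs_transducer x : exists V : vstate (aux_symbol t),
  runs transducer_prog (input_state _ x)
    (put6 5 (stack_tape (rev (word_tape (transducer_output x))) [::]) V) (time_bound (size x)).
Proof.
set H := max_word (size x); set n := size x.
set L := a * n.+1 ^ k.
pose st y p o := (stack_tape [::] (word_tape x), stack_tape [::] y, stack_tape [::] [::],
  stack_tape [::] (num_cells p.1 p.2), stack_tape [::] [:: carry_sym t 0 0],
  stack_tape (rev (word_tape o)) [::]).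
pose p1 := horner t top (0, 0).
pose p2 := horner t (flatten (nseq L blank)) p1.
pose p3 := horner t (flatten [seq pat b | b <- rev x]) p2.
pose p4 := horner t bottom p3.
have Ep4 : p4 = horner t (digit_word x) (0, 0) by rewrite /digit_word !horner_cat.
have b0 : bounded t 0 (0, 0) by [].
have b1 : bounded t (size top) p1 by have := bounded_horner top b0.
have b2 i : bounded t (size top + i * size blank) (horner t (flatten (nseq i blank)) p1).
  by rewrite -size_flatten_nseq; apply: bounded_horner.
have b3 u : bounded t (size top + L * size blank + size (flatten [seq pat b | b <- u]))
    (horner t (flatten [seq pat b | b <- u]) p2).
  exact/bounded_horner/b2.
have b4 : bounded t (size top + L * size blank + size (flatten [seq pat b | b <- rev x]) + size bottom) p4.
  exact/bounded_horner/b3.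
have sx := size_flatten_pat (rev x); rewrite size_rev -/n in sx.
have [h1 h2] : p4.1 < 2 ^ (t.+2 * H) /\ p4.2 < 2 ^ (t.+2 * H).
  apply/andP; apply: bounded_exp2 b4; rewrite /H /max_word -/n -/L.
  by rewrite leq_add2r leq_add2l.
exists (st (ones L) p4 [::]).
apply: runs_seq; first exact: runs_unary_power.
apply: (@runs_seq _ _ _ _ (st (ones L) (0, 0) [::])).
  have := runs_write 4 (carry_sym t 0 0) Stay (stack_tape [::] [::]) (st (ones L) (0, 0) [::]).
  by rewrite -{2}stack_tape_blank stay_cons; apply.
apply: (@runs_seq _ _ _ _ (st (ones L) p1 [::])).
  apply: runs_hops b0 _ => //.
  by rewrite add0n /H /max_word; lia.
apply: (@runs_seq _ _ _ _ (st (ones L) p2 [::])).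
  have := @runs_for _ 1 (ones L) (hops t blank)
    (fun i => st [::] (horner t (flatten (nseq i blank)) p1) [::])
    (hop_cost H * size blank + 1) (ones_nonblank t L).
  rewrite size_nseq => hfor; apply: hfor => l b r Er.
  have hr : size r < L.
    by have := congr1 size Er; rewrite size_nseq size_cat size_rev /=; lia.
  have -> : flatten (nseq (size r).+1 blank) = flatten (nseq (size r) blank) ++ blank.
    by rewrite -addn1 nseqD flatten_cat /= cats0.
  rewrite horner_cat; apply: runs_hops (b2 _) _ => //.
  rewrite /H /max_word -/n -/L -addnA -mulSnr.
  by have : (size r).+1 * size blank <= L * size blank by [rewrite leq_mul2r hr orbT]; lia.
apply: (@runs_seq _ _ _ _ (st (ones L) p3 [::])).
  have x0 : None \notin word_tape x by apply/mapP => -[].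
  have := @runs_for _ 0 (word_tape x) input_body
    (fun i => st (ones L) (horner t (flatten [seq pat b | b <- take i (rev x)]) p2) [::])
    (hop_cost H * (size (pat true) + size (pat false)) + 1).+1 x0.
  have Etk : take n (rev x) = rev x by rewrite /n -(size_rev x) take_size.
  rewrite size_map -/n Etk take0 => hfor; apply: hfor => l s r Er; cbv beta.
  have hr : size r < size (rev x).
    by have := congr1 size Er; rewrite size_map size_cat !size_rev /=; lia.
  have [b [-> ->]] : exists b, s = bit_sym t b /\ take (size r).+1 (rev x) = rcons (take (size r) (rev x)) b.
    exists (nth false (rev x) (size r)); split; last by rewrite (take_nth false).
    have := congr1 (fun w => nth None w (size l)) Er.
    rewrite nth_cat size_rev ltnn subnn /= => <-.
    have Esz : size x = size l + (size r).+1.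
      by have := congr1 size Er; rewrite size_map size_cat size_rev.
    have hl : size l < size x by rewrite Esz addnS ltnS leq_addr.
    have hs : size r < size x by rewrite Esz addnS ltnS leq_addl.
    by rewrite (nth_map false) ?nth_rev // Esz addnK.
  rewrite map_rcons -cats1 flatten_cat /= cats0 horner_cat.
  apply: runs_if => /=.
  have -> : (if Some (inl b) == bit_sym t true then hops t (pat true) else hops t (pat false))
      = hops t (pat b) by case: (b).
  apply: (runs_weaken (m := hop_cost H * size (pat b) + 1)).
    by rewrite leq_add2r leq_mul2l; case: (b); rewrite ?leq_addr ?leq_addl orbT.
  apply: runs_hops (b3 _) _ => //.
  rewrite /H /max_word -/n -/L.
  have := size_flatten_pat (rcons (take (size r) (rev x)) b).
  rewrite map_rcons -cats1 flatten_cat size_cat /= cats0 size_rcons size_take hr.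
  have : (size r).+1 * (size (pat true) + size (pat false)) <= n * (size (pat true) + size (pat false)).
    by rewrite leq_mul2r -[n](size_rev x) hr orbT.
  move=> u1 u2; have u3 := leq_trans u2 u1.
  by rewrite -!addnA leq_add2l leq_add2l (leq_trans u3) // leq_addr.
apply: (@runs_seq _ _ _ _ (st (ones L) p4 [::])).
  apply: runs_hops (b3 _) _ => //.
  by rewrite /H /max_word -/n -/L; lia.
have := runs_pieces pieces (stack_tape [::] (word_tape x)) (stack_tape [::] (ones L)) (stack_tape [::] [::])
  (stack_tape [::] [:: carry_sym t 0 0]) [::] h1 h2.
by rewrite /transducer_output -Ep4.
Qed.

Lemma poly_bounded_time : poly_bounded time_bound.
Proof.
have S : poly_bounded S by apply: (poly_bounded_le (g := fun n => n + 1)) => [n|]; rewrite ?addn1 //;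
  exact: poly_bounded_add poly_bounded_id (poly_bounded_const 1).
have P : poly_bounded (fun n => a * n.+1 ^ k).
  by apply: poly_bounded_mul; [exact: poly_bounded_const | apply: (@poly_bounded_exp succn)].
have PM : poly_bounded max_word.
  rewrite /max_word.
  by do ![exact: poly_bounded_const | exact: poly_bounded_id | exact: P | apply: poly_bounded_add | apply: poly_bounded_mul].
have PH : poly_bounded (fun n => hop_cost (max_word n)).
  rewrite /hop_cost.
  by do ![exact: poly_bounded_const | exact: PM | apply: poly_bounded_add | apply: poly_bounded_mul].
have PS : poly_bounded (fun n => (a * n.+1 ^ k).+1).
  apply: (poly_bounded_le (g := fun n => a * n.+1 ^ k + 1)) => [n|]; rewrite ?addn1 //.
  by apply: poly_bounded_add => //; exact: poly_bounded_const.
have PS' : poly_bounded (fun n => (hop_cost (max_word n) * (size (pat true) + size (pat false)) + 1).+1).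
  apply: (poly_bounded_le (g := fun n => hop_cost (max_word n) * (size (pat true) + size (pat false)) + 1 + 1)) => [n|]; rewrite ?addn1 //.
  apply: poly_bounded_add (poly_bounded_const 1); apply: poly_bounded_add (poly_bounded_const 1).
  exact: poly_bounded_mul PH (poly_bounded_const _).
rewrite /time_bound.
do ![exact: poly_bounded_const | exact: poly_bounded_id | exact: PM | exact: PH | exact: PS | exact: PS' | exact: S | exact: P
   | apply: poly_bounded_add | apply: poly_bounded_mul].
Qed.

Theorem polytime_transducer : polytime transducer_output.
Proof.
have [p hp] := poly_bounded_time.
exists (prog_machine transducer_prog), p => x.
have [V [m le_m hm]] := runs_transducer x; exists m.
move: hm; case: V => [[[[[v0 v1] v2] v3] v4] v5] /= /prog_run [h1 h2].
by split => //; apply: leq_trans le_m (hp _).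
Qed.

End HornerTransducer.

(** * Computations as tilings *)

Section Tiling.
Local Open Scope nat_scope.

Definition tileable (G : eqType) (ok : nat -> G -> G -> bool) (D : nat) (first last : G) : Prop :=
  exists (N : nat) (g : nat -> G),
    [/\ 0 < N, g 0 = first, g N.-1 = last &
        forall j d, j + d < N -> d <= D -> ok d (g j) (g (j + d))].

Variable M : machine.
Notation k := (extra_tapes M).
Notation sym := (symbol (aux M)).
Notation tapes_ix := 'I_(extra_tapes M).+1.

(* Two preliminary states, during which the head of the input tape reaches the input from two cells
   to its left: the first columns of the initial row then do not depend on the input. *)
Definition xstate : finType := (state M + bool)%type.
Definition control : finType := (xstate * {ffun tapes_ix -> sym})%type.

Definition next (kp : control) : xstate * (tapes_ix -> sym * move) :=
  let: (q, s) := kp in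
  match q with
  | inr b => (if b then inr false else inl (start M),
              fun i => (s i, if i == ord0 then MoveRight else Stay))
  | inl q => if verdict q is Some _ then (inl q, fun i => (s i, Stay))
             else let: (q', a) := delta q s in (inl q', fun i => a i)
  end.

Arguments next : simpl never.

Definition xconfig : Type := (xstate * (tapes_ix -> stream_tape (aux M)))%type.

Definition scan_all (v : tapes_ix -> stream_tape (aux M)) : {ffun tapes_ix -> sym} :=
  [ffun i => (v i).2 0].

Definition xstep (c : xconfig) : xconfig :=
  let: (q, a) := next (c.1, scan_all c.2) in
  (q, fun i => stream_write (a i) (c.2 i)).

Definition xinit (x : seq bool) : xconfig :=
  (inr true, fun i => stack_tape [::]
     (if i == ord0 then [:: None, None & @word_tape (aux M) x] else [::])).

Definition xrun (x : seq bool) (t : nat) : xconfig := iter t xstep (xinit x).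

Definition lift_config (c : config M) : xconfig := (inl c.1, fun i => view (c.2 i)).

Lemma view_scan (t : tape sym) : (view t).2 0 = t.1.2.
Proof. by case: t => [[]]. Qed.

Lemma xstep_lift (c : config M) : xstep (lift_config c) = lift_config (step c).
Proof.
case: c => q v; rewrite /xstep /next /step /=.
have -> : scan_all (fun i => view (v i)) = [ffun i => (v i).1.2].
  by apply/ffunP => i; rewrite !ffunE view_scan.
case: (verdict q) => [b|].
  rewrite /lift_config /=; congr pair; apply/funext => i.
  by rewrite ffunE -view_scan stay_scanned.
case: (delta _ _) => q' a; rewrite /lift_config /=; congr pair; apply/funext => i.
by rewrite ffunE view_write.
Qed.

Lemma xrun_lift x t : xrun x t.+2 = lift_config (run M t x).
Proof.
elim: t => [|t IH]; last by rewrite /xrun iterS -/(xrun x t.+2) IH xstep_lift.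
rewrite /xrun /= /lift_config /init /=; congr pair; apply/funext => i; rewrite !ffunE /=.
rewrite /xstep /= /next /= !ffunE; case: (i == ord0).
  rewrite (move_right None [::] None) (move_right None [:: None] None) -[[:: None; None]]/([::] ++ nseq 2 None) stack_tape_catl.
  by case: x => [|b x] //=; rewrite stack_tape_blank.
by rewrite !stay_scanned stack_tape_blank.
Qed.

Definition content : finType := {ffun tapes_ix -> sym * sym}.

(* [None] ends an accepting tiling, [Some (c, None)] is the head of every row, and [Some (c, Some w)]
   is one column of cells: on every tape, one cell on each side of the head. *)
Definition letter : finType := option (control * option content).

Definition tile (c : xconfig) (j : nat) : letter :=
  Some ((c.1, scan_all c.2),
        if j is j'.+1 then Some [ffun i => ((c.2 i).1 j', (c.2 i).2 j'.+1)] else None).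

Variables (x : seq bool) (lam : nat).
Hypothesis lam3 : 2 < lam.
(** Column [j] of a row holds the left cells [j - 1] and the right cells [j], so this says that the
    last column, [lam.-1], stays blank: nothing ever moves in across the end of a row. *)
Hypothesis blank_end : forall t i,
  ((xrun x t).2 i).1 lam.-2 = None /\ ((xrun x t).2 i).2 lam.-1 = None.

(** For neighbours. Every column repeats the control of its row, so that the moves of all tapes are
    known in every cell; the end letter may follow only a letter with accepting state. *)
Definition same_row (a b : letter) : bool :=
  match a, b with
  | Some ((q, _), _), None => if q is inl q' then verdict q' == Some true else false
  | Some (kp, _), Some (kp', Some _) => kp == kp'
  | _, _ => true
  end.

Definition stays (m : move) := if m is Stay then true else false.
Definition to_left (m : move) := if m is MoveLeft then true else false.
Definition to_right (m : move) := if m is MoveRight then true else false.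

(** In the next row a cell keeps its column, or goes one column inwards or outwards, according to
    its side and the move of its tape. These cases have the distances [lam], [lam.-1] and [lam.+1],
    and each of the three relations constrains only the cells that travel its distance; [below] also
    fixes the next state. They hold trivially with the end letter, so a tiling may break off inside
    a row. *)
Definition below (a b : letter) : bool :=
  match a, b with
  | Some (kp, None), Some ((q, s), None) =>
      (q == (next kp).1) && [forall i, stays ((next kp).2 i).2 ==> (s i == ((next kp).2 i).1)]
  | Some (kp, Some c), Some (_, Some c') =>
      [forall i, stays ((next kp).2 i).2 ==> (c' i == c i)]
  | Some _, Some _ => false
  | _, _ => true
  end.

Definition below_left (a b : letter) : bool :=
  match a, b with
  | Some (kp, Some c), Some ((_, s), None) =>
      [forall i, (to_right ((next kp).2 i).2 ==> (s i == (c i).2)) &&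
                 (to_left ((next kp).2 i).2 ==> (s i == (c i).1))]
  | Some (kp, Some c), Some (_, Some c') =>
      [forall i, (to_right ((next kp).2 i).2 ==> ((c' i).2 == (c i).2)) &&
                 (to_left ((next kp).2 i).2 ==> ((c' i).1 == (c i).1))]
  (* At distance [lam.-1] from the head of a row lies the last column of the same row, which must be
     blank. *)
  | Some (_, None), Some (_, Some c') => [forall i, c' i == (None, None)]
  | _, _ => true
  end.

Definition below_right (a b : letter) : bool :=
  match a, b with
  | Some (kp, None), Some (_, Some c') =>
      [forall i, (to_right ((next kp).2 i).2 ==> ((c' i).1 == ((next kp).2 i).1)) &&
                 (to_left ((next kp).2 i).2 ==> ((c' i).2 == ((next kp).2 i).1))]
  | Some (kp, Some c), Some (_, Some c') =>
      [forall i, (to_right ((next kp).2 i).2 ==> ((c' i).1 == (c i).1)) &&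
                 (to_left ((next kp).2 i).2 ==> ((c' i).2 == (c i).2))]
  | _, _ => true
  end.

Definition corner : letter := Some ((inr true, [ffun=> None]), None).

Definition init_cell (s : sym) : letter :=
  Some ((inr true, [ffun=> None]), Some [ffun i => (None, if i == ord0 then s else None)]).

(** The state [inr true] is never entered again, so in a run the corner letter occurs only at the
    origin, and its relation at distance [d] prescribes the initial content of column [d]. *)
Definition in_row0 (d : nat) (a b : letter) : bool :=
  (a == corner) ==> ((b == None) || (b == init_cell (nth None [:: None, None & @word_tape (aux M) x] d))).

Definition compatible (d : nat) (a b : letter) : bool :=
  [&& (d == 0) ==> (a == b), (d == 1) ==> same_row a b, (d == lam.-1) ==> below_left a b,
      (d == lam) ==> below a b, (d == lam.+1) ==> below_right a b &
      (0 < d < lam) ==> in_row0 d a b].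

Lemma xstepE t : xrun x t.+1 = xstep (xrun x t).
Proof. by []. Qed.

Lemma tile_corner : tile (xrun x 0) 0 = corner.
Proof.
by congr (Some ((_, _), _)); apply/ffunP => i; rewrite !ffunE /=; case: ifP.
Qed.

Lemma tile_init j : tile (xrun x 0) j.+1 =
  init_cell (nth None [:: None, None & @word_tape (aux M) x] j.+1).
Proof.
congr (Some ((_, _), Some _)); apply/ffunP => i; rewrite !ffunE /=.
  by case: ifP.
by rewrite /stack_tape /= nth_nil; case: ifP => // _; rewrite nth_nil.
Qed.

Lemma next_not_pre kp : (next kp).1 != inr true.
Proof. by case: kp => [[q|b] s]; rewrite /next //=; [case: verdict => // ; case: delta | case: b]. Qed.

Lemma tile_not_corner t j : (0 < t) || (0 < j) -> tile (xrun x t) j != corner.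
Proof.
case: j => [|j]; last by move=> _; apply/eqP; rewrite /tile /corner => -[].
case: t => // t _; apply/eqP => -[E _ ].
move: E; rewrite /xstep.
by case: (next _) (next_not_pre ((xrun x t).1, scan_all (xrun x t).2)) => q a /= /eqP.
Qed.

Section Step.
Variable c : xconfig.
Let kp : control := (c.1, scan_all c.2).
Let c' := xstep c.

Lemma xstep1 : c'.1 = (next kp).1.
Proof. by rewrite /c' /xstep -/kp; case: (next kp). Qed.

Lemma xstep2 i : c'.2 i = stream_write ((next kp).2 i) (c.2 i).
Proof. by rewrite /c' /xstep -/kp; case: (next kp). Qed.

Ltac by_move i := rewrite ?ffunE ?xstep2 /stream_write; case: ((next kp).2 i) => ? [] //=.

Lemma below_tile j : below (tile c j) (tile c' j).
Proof.
case: j => [|j] /=; rewrite -/kp.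
  rewrite xstep1 eqxx /=; apply/forallP => i; by_move i.
by apply/forallP => i; by_move i.
Qed.

Lemma below_left_tile j : below_left (tile c j.+1) (tile c' j).
Proof. by case: j => [|j] /=; rewrite -/kp; apply/forallP => i; by_move i; rewrite ?eqxx. Qed.

Lemma below_right_tile j : below_right (tile c j) (tile c' j.+1).
Proof. by case: j => [|j] /=; rewrite -/kp; apply/forallP => i; by_move i; rewrite ?eqxx. Qed.

Lemma head_determined b : b != None -> below (tile c 0) b -> below_left (tile c 1) b -> b = tile c' 0.
Proof.
case: b => [[[q s] [w|]]|] // _; rewrite /= -/kp.
move=> /andP[/eqP-> /forallP h1] /forallP h2.
rewrite /tile -/c' xstep1; congr (Some ((_, _), _)); apply/ffunP => i.
move: (h1 i) (h2 i); by_move i.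
- by move=> _ /eqP ->.
- by move=> /eqP-> _.
- by rewrite andbT => _ /eqP ->.
Qed.

(** Stationary cells come from the same column, outgoing ones from the column before and incoming
    ones from the column after. The last column has none after it; there the blankness imposed by
    the head of its own row takes over. *)
Lemma cell_determined j b : b != None -> same_row (tile c' j) b ->
  below (tile c j.+1) b -> below_right (tile c j) b ->
  (below_left (tile c j.+2) b \/
   exists w, [/\ below_left (Some (w, None)) b,
     forall i, (c'.2 i).1 j = None & forall i, (c'.2 i).2 j.+1 = None]) ->
  b = tile c' j.+1.
Proof.
case: b => [[kb [w|]]|] // _; rewrite /= -/kp.
move=> /eqP<- /forallP h1 h2 h3; congr (Some (_, Some _)); apply/ffunP => i; rewrite !ffunE.
have {}h2 : (to_right ((next kp).2 i).2 -> (w i).1 = (c'.2 i).1 j) /\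
            (to_left ((next kp).2 i).2 -> (w i).2 = (c'.2 i).2 j.+1).
  case: j h1 h2 h3 => [|j] h1 /forallP /(_ i) + _; rewrite /c' xstep2 ?ffunE /stream_write;
  by case: ((next kp).2 i) => ? [] //=; rewrite ?andbT => /eqP.
have {}h1 : stays ((next kp).2 i).2 -> w i = ((c'.2 i).1 j, (c'.2 i).2 j.+1).
  move: (h1 i); rewrite /c' xstep2 ffunE.
  by case: ((next kp).2 i) => ? [] //= /eqP -> _.
have {}h3 : (to_right ((next kp).2 i).2 -> (w i).2 = (c'.2 i).2 j.+1) /\
            (to_left ((next kp).2 i).2 -> (w i).1 = (c'.2 i).1 j).
  case: h3 => [/forallP /(_ i)|[w' [/forallP /(_ i) /eqP -> -> ->]]] //.
  rewrite /c' xstep2 ffunE /stream_write.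
  by case: ((next kp).2 i) => ? [] //=; rewrite ?andbT => /eqP.
move: h1 h2 h3; case: (w i) => u v /=.
case: ((next kp).2 i).2 => /= h1 [h2 h2'] [h3 h3'].
- by rewrite h2' // h3'.
- exact: h1.
- by rewrite h2 // h3.
Qed.

End Step.

Definition index_tile (i : nat) : letter := tile (xrun x (i %/ lam)) (i %% lam).

Lemma index_tileE t j : j < lam -> index_tile (t * lam + j) = tile (xrun x t) j.
Proof. by move=> h; rewrite /index_tile divnMDl ?divn_small ?addn0 ?modnMDl ?modn_small //; lia. Qed.

Lemma index_compatible i d : d <= lam.+1 -> compatible d (index_tile i) (index_tile (i + d)).
Proof.
move=> hd; have lam0 : 0 < lam by lia.
have Ei : i = i %/ lam * lam + i %% lam by exact: divn_eq.
have lt_j : i %% lam < lam by rewrite ltn_mod.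
move: (i %/ lam) (i %% lam) Ei lt_j => t j -> {i} lt_j.
rewrite (index_tileE _ lt_j).
have at_col t' j' : j' < lam -> t * lam + j + d = t' * lam + j' ->
    index_tile (t * lam + j + d) = tile (xrun x t') j'.
  by move=> h ->; rewrite index_tileE.
apply/and5P; split; [| | | |apply/andP; split]; apply/implyP.
- by move=> /eqP E; rewrite E addn0 index_tileE.
- move=> /eqP E; have [lt|le] := ltnP j.+1 lam.
    by rewrite (at_col t j.+1) //; [rewrite /= | lia].
  by rewrite (at_col t.+1 0) //; lia.
- move=> /eqP E; case: j lt_j at_col => [|j] lt_j at_col; last first.
    by rewrite (at_col t.+1 j); [exact: below_left_tile | lia | lia].
  rewrite (at_col t lam.-1); [|lia|lia].
  have -> : lam.-1 = lam.-2.+1 by lia.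
  rewrite /tile /=; apply/forallP => i; rewrite ffunE.
  have [-> E2] := blank_end t i; rewrite -[X in (None, _.2 X)](_ : lam.-1 = _) ?E2 //; lia.
- by move=> /eqP E; rewrite (at_col t.+1 j); [exact: below_tile | | lia].
- move=> /eqP E; have [lt|le] := ltnP j.+1 lam.
    by rewrite (at_col t.+1 j.+1); [exact: below_right_tile | | lia].
  (* From the last column, the distance [lam.+1] leads to the head of a row, where [below_right]
     demands nothing. *)
  by rewrite (at_col t.+2 0); [case: j {lt_j le at_col} | lia | lia].
- move=> /andP[d0 d_lt]; apply/implyP => corner_src.
  have [t0 j0] : t = 0 /\ j = 0.
    have : ~~ ((0 < t) || (0 < j)) by apply/negP => /tile_not_corner; rewrite corner_src.
    by rewrite negb_or -!eqn0Ngt => /andP[/eqP-> /eqP->].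
  rewrite (at_col 0 d) //; last by rewrite t0 j0.
  by case: d d0 {hd at_col d_lt} => // d _; rewrite tile_init eqxx orbT.
Qed.

Definition accepts (q : xstate) : bool := if q is inl q' then verdict q' == Some true else false.

Definition accepting (b : letter) : bool := same_row b None && (b != None).

Lemma tile_accepting t j : accepting (tile (xrun x t) j) =
  accepts (xrun x t).1.
Proof. by rewrite /accepting andbT. Qed.

(** Up to its first end letter a tiling is forced, letter by letter, to follow the run, and the
    letter before the end must be accepting. Conversely, the rows of an accepting run can be cut off
    right after the head of row [t], which leaves [t * lam + 1] letters and the end letter. *)
Theorem tileable_accepting :
  tileable compatible lam.+1 corner None <->
  exists t, accepts (xrun x t).1.
Proof.
have lam0 : 0 < lam by lia.
split=> [[N [g [N0 g0 gN hg]]]|[t ht]]; last first.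
  exists (t * lam).+2, (fun i => if i == (t * lam).+1 then None else index_tile i).
  split=> //.
  - by rewrite /= -[0]/(0 * lam + 0) index_tileE // tile_corner.
  - by rewrite /= eqxx.
  move=> j d hjd hd; have [E|ne] := eqVneq (j + d) (t * lam).+1; last first.
    rewrite ifF; last by apply/eqP; lia.
    exact: index_compatible.
  have [Ej|nej] := eqVneq j (t * lam).+1.
    have d0 : d = 0 by lia.
    rewrite d0 /compatible /in_row0 /=; case: (lam) lam3 => [|[|[|l]]] // _.
  have d0 : 0 < d by move: nej; lia.
  have hs : d = 1 -> same_row (index_tile j) None.
    move=> d1; have -> : j = t * lam + 0 by lia.
    by rewrite index_tileE //; have := tile_accepting t 0; rewrite ht /accepting => /andP[].
  move: (index_tile j) hs => a hs.
  have bl : below_left a None by case: (a) => [[? [?|]]|].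
  have br : below_right a None by case: (a) => [[? [?|]]|].
  have be : below a None by case: (a) => [[? [?|]]|].
  rewrite /compatible /in_row0 eqxx bl br be (gtn_eqF d0) !implybT andbT /=.
  by case: (d =P 1) hs => [_ ->|_ _] //=.
have exm : exists m, (m < N) && (g m == None) by exists N.-1; rewrite gN eqxx andbT; lia.
case: (ex_minnP exm) => m /andP[lt_mN /eqP gm] min_m.
have nz i : i < m -> g i != None.
  move=> lt_i; apply/negP => gi; have := min_m i; rewrite gi (ltn_trans lt_i lt_mN) /=.
  by move=> /(_ isT); lia.
have real i : i < m -> g i = index_tile i.
  elim/ltn_ind: i => i IH lt_i.
  have Ei : i = i %/ lam * lam + i %% lam by exact: divn_eq.
  have lt_j : i %% lam < lam by rewrite ltn_mod.
  move: (i %/ lam) (i %% lam) Ei lt_j => t j Ei lt_j.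
  have IHt t' j' : j' < lam -> t' * lam + j' < i -> g (t' * lam + j') = tile (xrun x t') j'.
    by move=> h1 h2; rewrite IH ?index_tileE //; exact: ltn_trans h2 lt_i.
  have gi0 := nz _ lt_i.
  have rel d t' j' : 0 < d -> d <= lam.+1 -> j' < lam -> t' * lam + j' + d = i ->
      compatible d (tile (xrun x t') j') (g i).
    move=> d0 hd h1 h2; rewrite -(IHt t' j') //; last by lia.
    by rewrite -h2; apply: hg => //; rewrite h2; apply: ltn_trans lt_i lt_mN.
  rewrite Ei index_tileE // -Ei.
  case: t Ei => [|t] Ei.
    case: j lt_j Ei => [|j] lt_j Ei; first by rewrite Ei g0 tile_corner.
    have /and5P[_ _ _ _ /andP[_ /implyP h]] := rel j.+1 0 0 isT (leqW (ltnW lt_j)) lam0 (esym Ei).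
    have := h lt_j; rewrite /in_row0 tile_corner eqxx /= (negbTE gi0) /= => /eqP ->.
    by rewrite tile_init.
  rewrite xstepE.
  have hV : below (tile (xrun x t) j) (g i).
    have /and5P[_ _ _ /implyP h _] : compatible lam (tile (xrun x t) j) (g i) by apply: rel => //; lia.
    by apply: h.
  have hL j' : j' < lam -> t * lam + j' + lam.-1 = i -> below_left (tile (xrun x t) j') (g i).
    move=> h1 h2; have /and5P[_ _ /implyP h _ _] : compatible lam.-1 (tile (xrun x t) j') (g i) by apply: rel => //; lia.
    by apply: h.
  case: j lt_j Ei hV => [|j] lt_j Ei hV.
    by apply: head_determined => //; apply: hL; lia.
  apply: cell_determined => //.
  - have /and5P[_ /implyP h _ _ _] : compatible 1 (tile (xrun x t.+1) j) (g i) by apply: rel => //; lia.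
    by apply: h.
  - have /and5P[_ _ _ _ /andP[/implyP h _]] : compatible lam.+1 (tile (xrun x t) j) (g i) by apply: rel => //; lia.
    by apply: h.
  have [lt|le] := ltnP j.+2 lam; first by left; apply: hL => //; lia.
  right; exists ((xrun x t.+1).1, scan_all (xrun x t.+1).2); split.
  - have /and5P[_ _ /implyP h _ _] : compatible lam.-1 (tile (xrun x t.+1) 0) (g i) by apply: rel => //; lia.
    by apply: h.
  - move=> i'; rewrite -xstepE; have [+ _] := blank_end t.+1 i'.
    by rewrite (_ : lam.-2 = j) //; lia.
  - move=> i'; rewrite -xstepE; have [_ +] := blank_end t.+1 i'.
    by rewrite (_ : lam.-1 = j.+1) //; lia.
have m0 : 0 < m by case: (m) gm => //; rewrite g0.
have := hg m.-1 1; rewrite addn1 prednK // => /(_ lt_mN isT) /and5P[_ /implyP /(_ isT) + _ _ _].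
rewrite gm real ?prednK // => h; exists (m.-1 %/ lam).
by rewrite -(tile_accepting _ (m.-1 %% lam)) /accepting h.
Qed.

End Tiling.

(** * Tilings as difference conditions on sets of exponents *)

Section DifferenceSets.
Local Open Scope nat_scope.
Variables (G : finType) (ok : nat -> G -> G -> bool) (D : nat) (first last : G).

Definition num_letters : nat := #|G|.
Notation s := num_letters.
Definition block_size : nat := (s * s).+1.
Notation S := block_size.

Definition rank_of (a : G) : nat := enum_rank a.
Definition letter_of (i : nat) : G := nth first (enum G) i.

(* A block has the positions [0, ..., s - 1] for the first copy of its letter and the positions
   [s, 2 s, ..., s * s] for the second one; [r] is the difference of a position of the second kind
   and one of the first kind, from which both can be read off. *)
Definition clash (rel : G -> G -> bool) (r : nat) : bool :=
  (0 < r) && ~~ rel (letter_of (s * ((r.-1 %/ s).+1) - r)) (letter_of (r.-1 %/ s)).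

(** [n = S d + r] compares a first copy with a second copy [d] blocks further on. As the offsets [r]
    are positive and below [S], division by [S] recovers [d] and [r]. *)
Definition clashes (n : nat) : bool := (n %/ S <= D) && clash (ok (n %/ S)) (n %% S).

(** From the start of a block to a second copy inside it, the difference must be a positive multiple
    of [s]; the other differences below [S] would lead to exponents that code no letter. *)
Definition junk (n : nat) : bool := (n < S) && ~~ ((0 < n) && (s %| n)).

(** [U] and [V] hold the first and second copies of the letters, [W] the starts of the blocks.
    Further exponents in [U] or [V] are harmless, being subject to the same constraints. The fourth
    clause lets the chain of blocks stop only at the letter [last]. *)
Definition digit_sets (U V W : nat -> Prop) : Prop :=
  [/\ forall i j, i <= j -> U i -> V j -> ~~ clashes (j - i),
      forall i j, i <= j -> W i -> V j -> ~~ junk (j - i),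
      (forall i, W i -> exists k, i <= k < i + s /\ U k) /\
      (forall i, W i -> exists k, i <= k < i + S /\ V k),
      forall i, W i -> W (i + S) \/ U (i + rank_of last) &
      U (rank_of first) /\ W 0].

Lemma s_gt0 : 0 < s.
Proof. by apply/card_gt0P; exists first. Qed.

Lemma rank_lt a : rank_of a < s.
Proof. exact: ltn_ord. Qed.

Lemma letter_rank a : letter_of (rank_of a) = a.
Proof. by rewrite /letter_of nth_enum_rank. Qed.

Lemma rank_letter i : i < s -> rank_of (letter_of i) = i.
Proof.
move=> lt_i; rewrite /rank_of /letter_of.
by have -> : nth first (enum G) i = enum_val (Ordinal lt_i); [rewrite (enum_val_nth first) | rewrite enum_valK].
Qed.

(** [s (b + 1) - a - 1 = s b + (s - 1 - a)] is a division by [s] with remainder, so the offset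
    determines [b] and then [a]. *)
Lemma clash_offset rel a b : a < s -> b < s ->
  clash rel (s * b.+1 - a) = ~~ rel (letter_of a) (letter_of b).
Proof.
move=> la lb; rewrite /clash.
have lt : a < s * b.+1 by rewrite mulnS; lia.
have Eb : (s * b.+1 - a).-1 %/ s = b.
  have -> : (s * b.+1 - a).-1 = b * s + (s - a).-1 by rewrite mulnS mulnC; lia.
  by rewrite divnMDl ?s_gt0 // divn_small ?addn0 //; lia.
by rewrite Eb subn_gt0 lt (_ : s * b.+1 - (s * b.+1 - a) = a) //; lia.
Qed.

Lemma clashes_offset d a b : a < s -> b < s ->
  clashes (S * d + (s * b.+1 - a)) = (d <= D) && ~~ ok d (letter_of a) (letter_of b).
Proof.
move=> la lb; have lt : s * b.+1 - a < S.
  by rewrite /block_size ltnS (leq_trans (leq_subr _ _)) // leq_mul2l lb orbT.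
by rewrite /clashes mulnC divnMDl // divn_small // addn0 modnMDl modn_small // clash_offset.
Qed.

Hypothesis ok0 : forall a b, ok 0 a b = (a == b).

Lemma digit_sets_tileable (U V W : nat -> Prop) (n : nat) :
  digit_sets U V W -> (forall i, W i -> i < n) -> tileable ok D first last.
Proof.
move=> [clU clW [wU wV] chain [Ufirst W0]] Wn.
have choice_letter j : W (S * j) -> exists a b : nat, [/\ a < s, b < s, U (S * j + a) & V (S * j + s * b.+1)].
  move=> Wj; have [k [/andP[k1 k2] Uk]] := wU _ Wj; have [l [/andP[l1 l2] Vl]] := wV _ Wj.
  have nj := clW _ _ l1 Wj Vl.
  exists (k - S * j), ((l - S * j) %/ s).-1.
  have lt : l - S * j < S by lia.
  move: nj; rewrite /junk lt /= negbK => /andP[l0 /dvdnP[m Em]].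
  have s0 := s_gt0; rewrite Em mulnK //.
  have m0 : 0 < m by move: l0; rewrite Em; case: (m).
  have ms : m <= s.
    by move: lt; rewrite Em /block_size ltnS leq_pmul2r.
  rewrite prednK // [s * m]mulnC -Em !subnKC //; split=> //; lia.
(* At distance 0 the relation is equality, so both copies in a block carry the same letter. *)
have same j a b : W (S * j) -> a < s -> b < s -> U (S * j + a) -> V (S * j + s * b.+1) -> a = b.
  move=> Wj la lb Ua Vb; have le : S * j + a <= S * j + s * b.+1.
    by rewrite leq_add2l mulnS; lia.
  have := clU _ _ le Ua Vb; rewrite subnDl -[X in clashes X](add0n _) -(muln0 S) clashes_offset // leq0n /= negbK ok0.
  by move=> /eqP /(congr1 rank_of); rewrite !rank_letter.
have [N [N0 WN Ulast]] : exists N, [/\ 0 < N, forall j, j < N -> W (S * j) & U (S * N.-1 + rank_of last)].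
  have step m : (forall j, j <= m -> W (S * j)) ->
      W (S * m.+1) \/ U (S * m + rank_of last).
    by move=> h; rewrite mulnS addnC; apply/chain/h.
  pose P m := forall j, j <= m -> W (S * j).
  have P0 : P 0 by move=> j; rewrite leqn0 => /eqP->; rewrite muln0.
  (* Without the last letter the chain would never stop, and [W] would contain [S n >= n], beyond
     its bound. *)
  have [[m [Pm h]]|no] := pselect (exists m, P m /\ U (S * m + rank_of last)).
    by exists m.+1; split => // j; rewrite ltnS; apply: Pm.
  have Pall m : P m.
    elim: m => // m Pm j; rewrite leq_eqVlt => /orP[/eqP->|]; last exact: Pm.
    by case: (step m Pm) => // h; case: no; exists m.
  have := Wn _ (Pall n n (leqnn n)); rewrite ltnNge => /negP[].
  by rewrite leq_pmull.
have hG j : exists a : nat, j < N -> [/\ a < s, U (S * j + a) & V (S * j + s * a.+1)].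
  have [lt|] := ltnP j N; last by exists 0.
  have [a [b [la lb Ua Vb]]] := choice_letter j (WN j lt).
  by exists a => _; have E := same _ _ _ (WN j lt) la lb Ua Vb; split => //; rewrite E.
have [f hf] := boolp.choice hG.
exists N, (fun j => letter_of (f j)); split => //.
- have [la Ua Va] := hf 0 N0.
  rewrite -(same 0 _ _ (WN 0 N0) (rank_lt first) la _ Va); first exact: letter_rank.
  by rewrite muln0.
- have lt : N.-1 < N by rewrite prednK.
  have [la Ua Va] := hf _ lt.
  by rewrite -(same _ _ _ (WN _ lt) (rank_lt last) la Ulast Va) letter_rank.
move=> j d lt hd; have [la Ua Va] := hf j (leq_ltn_trans (leq_addr _ _) lt).
have [lb Ub Vb] := hf _ lt.
have le : f j <= s * (f (j + d)).+1 by rewrite mulnS; lia.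
have le' : S * j + f j <= S * (j + d) + s * (f (j + d)).+1.
  by rewrite mulnDr -addnA leq_add2l (leq_trans le) // leq_addl.
have := clU _ _ le' Ua Vb.
have -> : S * (j + d) + s * (f (j + d)).+1 - (S * j + f j) = S * d + (s * (f (j + d)).+1 - f j).
  by rewrite mulnDr; move: le; lia.
by rewrite clashes_offset // hd negbK.
Qed.

Definition first_copy (N : nat) (g : nat -> G) (n : nat) : bool :=
  (n %/ S < N) && (n %% S == rank_of (g (n %/ S))).
Definition second_copy (N : nat) (g : nat -> G) (n : nat) : bool :=
  (n %/ S < N) && (n %% S == s * (rank_of (g (n %/ S))).+1).
Definition block_starts (N n : nat) : bool := (n %/ S < N) && (n %% S == 0).

Lemma tileable_digit_sets : tileable ok D first last ->
  exists (U V W : pred nat) (n : nat),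
    [/\ forall i, U i -> i < n, forall i, V i -> i < n, forall i, W i -> i < n & digit_sets U V W].
Proof.
move=> [N [g [N0 g0 gN hg]]].
have s0 := s_gt0.
have ra a : rank_of a < S.
  by apply: (leq_trans (rank_lt a)); rewrite /block_size leqW // leq_pmulr.
have rb a : s * (rank_of a).+1 < S by rewrite /block_size ltnS leq_mul2l rank_lt orbT.
have lt_bound (P : nat -> bool) n : (n %/ S < N) && P n -> n < S * N.
  by move=> /andP[h _]; rewrite mulnC -ltn_divLR.
have inU j : j < N -> first_copy N g (S * j + rank_of (g j)).
  by move=> lt; rewrite /first_copy mulnC divnMDl // divn_small // addn0 modnMDl modn_small // lt eqxx.
have inV j : j < N -> second_copy N g (S * j + s * (rank_of (g j)).+1).
  by move=> lt; rewrite /second_copy mulnC divnMDl // divn_small // addn0 modnMDl modn_small // lt eqxx.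
have ofU i : first_copy N g i -> exists2 j, j < N & i = S * j + rank_of (g j).
  by move=> /andP[lt /eqP E]; exists (i %/ S) => //; rewrite -E {1}(divn_eq i S) mulnC.
have ofV i : second_copy N g i -> exists2 j, j < N & i = S * j + s * (rank_of (g j)).+1.
  by move=> /andP[lt /eqP E]; exists (i %/ S) => //; rewrite -E {1}(divn_eq i S) mulnC.
have ofW i : block_starts N i -> exists2 j, j < N & i = S * j.
  by move=> /andP[lt /eqP E]; exists (i %/ S) => //; rewrite {1}(divn_eq i S) E mulnC addn0.
have inW j : j < N -> block_starts N (S * j).
  by move=> lt; rewrite /block_starts mulKn // modnMr lt eqxx.
exists (first_copy N g), (second_copy N g), (block_starts N), (S * N).
split; [exact: lt_bound | exact: lt_bound | exact: lt_bound |].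
split.
- move=> i j le /ofU[p lt_p Ei] /ofV[q lt_q Ej]; rewrite {}Ei {}Ej in le *.
  have le_pq : p <= q.
    rewrite leqNgt; apply/negP => lt_qp; have := rb (g q).
    have : S * q.+1 <= S * p by rewrite leq_mul2l lt_qp orbT.
    by rewrite mulnS; lia.
  have le2 : rank_of (g p) <= s * (rank_of (g q)).+1.
    by have := rank_lt (g p); rewrite mulnS; lia.
  have -> : S * q + s * (rank_of (g q)).+1 - (S * p + rank_of (g p)) =
      S * (q - p) + (s * (rank_of (g q)).+1 - rank_of (g p)).
    have : S * q = S * p + S * (q - p) by rewrite -mulnDr subnKC.
    by move: le2; lia.
  rewrite clashes_offset ?rank_lt // !letter_rank negb_and negbK -implybE.
  by apply/implyP => hd; have := hg p (q - p); rewrite subnKC // => /(_ lt_q hd).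
- move=> i j le /ofW[p lt_p Ei] /ofV[q lt_q Ej]; rewrite {}Ei {}Ej in le *.
  have le_pq : p <= q.
    rewrite leqNgt; apply/negP => lt_qp; have := rb (g q).
    have : S * q.+1 <= S * p by rewrite leq_mul2l lt_qp orbT.
    by rewrite mulnS; lia.
  rewrite /junk negb_and negbK; have [E|ne] := eqVneq p q.
    by rewrite E addKn dvdn_mulr // muln_gt0 s0 orbT.
  rewrite -leqNgt; have : S * p.+1 <= S * q by rewrite leq_mul2l; apply/orP; right; lia.
  by rewrite mulnS; have := rb (g q); lia.
- split=> i /ofW[j lt ->].
    exists (S * j + rank_of (g j)); split; last exact: inU.
    by rewrite leq_addr ltn_add2l rank_lt.
  exists (S * j + s * (rank_of (g j)).+1); split; last exact: inV.
  by rewrite leq_addr ltn_add2l rb.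
- move=> i /ofW[j lt ->]; have [E|ne] := eqVneq j N.-1.
    by right; rewrite -gN -E; apply: inU.
  by left; rewrite addnC -mulnS; apply: inW; lia.
- split; last by have := inW 0 N0; rewrite muln0.
  by have := inU 0 N0; rewrite muln0 g0.
Qed.

End DifferenceSets.

(** * The sentence *)

Section Atoms.
Variables (R : realType) (alpha B C : R) (t : nat) (c d : int).
Hypothesis unitB : unit_data alpha B C t c d.

Notation val := (pair_val B).
Notation cval := (pair_val C).

Definition unitB_BC : B * C = 1 := let: And5 _ h _ _ _ := unitB in h.
Definition unitB_sum : B + C = (t + 2)%:R := let: And5 _ _ h _ _ := unitB in h.
Definition unitB_gt1 : 1 < B := let: And5 _ _ _ h _ := unitB in h.
Definition unitB_t : (2 <= t)%N := let: And5 _ _ _ _ h := unitB in h.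

Definition form : Type := nat -> coef.

Definition form_eval (L : form) (x : seq int) : R :=
  \sum_(i < 21) coef_val alpha (L i) * (x`_i)%:~R.

Definition atom (L : form) (b : coef) : formula 21 := Ineq [tuple L i | i < 21] b.

Lemma sat_And (F G : formula 21) x : sat alpha (And F G) x = sat alpha F x && sat alpha G x.
Proof. by []. Qed.
Lemma sat_Or (F G : formula 21) x : sat alpha (Or F G) x = sat alpha F x || sat alpha G x.
Proof. by []. Qed.
Lemma sat_Not (F : formula 21) x : sat alpha (Not F) x = ~~ sat alpha F x.
Proof. by []. Qed.

Lemma sat_atom L b x : sat alpha (atom L b) x = (form_eval L x <= coef_val alpha b).
Proof. by rewrite /=; congr (_ <= _); apply: eq_bigr => i _; rewrite tnth_mktuple. Qed.

Lemma coef_valD a b : coef_val alpha (a + b) = coef_val alpha a + coef_val alpha b.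
Proof. by rewrite /coef_val /= !rmorphD /=; ring. Qed.

Lemma coef_valN a : coef_val alpha (- a) = - coef_val alpha a.
Proof. by rewrite /coef_val /= !rmorphN /=; ring. Qed.

Lemma coef_val0 : coef_val alpha 0 = 0.
Proof. by rewrite /coef_val /= mul0r addr0. Qed.

Definition pair_coef (w : int * int) : coef := (w.1 + w.2 * (c - 1), w.2 * d).

Lemma pair_coefE w : coef_val alpha (pair_coef w) = val w.
Proof.
have [EB _ _ _ _] := unitB.
rewrite /coef_val /pair_coef /pair_val EB /= rmorphD !rmorphM rmorphB /=; ring.
Qed.

(** The conjugate of a lattice element lies in the lattice again, because [C = t + 2 - B]; this
    makes conditions on [cval] expressible with coefficients in Z[alpha]. *)
Definition pair_conj (w : int * int) : int * int := (w.1 + t%:Z * w.2, - w.2).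

Lemma pair_conjE w : val (pair_conj w) = cval w.
Proof.
have := unitB_sum; rewrite natrD => E.
have -> : C = t%:R + 2 - B by rewrite -E; ring.
by rewrite /pair_val /= rmorphD rmorphM rmorphN /= -[t%:~R]/(t%:R); ring.
Qed.

Definition at_pair (x : seq int) (p : nat) : int * int := (x`_p, x`_p.+1).

Definition two_coefs (p : nat) (a b : coef) : form :=
  fun i => if i == p then a else if i == p.+1 then b else 0.

Lemma two_coefs_eval p a b x : (p.+1 < 21)%N ->
  form_eval (two_coefs p a b) x = coef_val alpha a * (x`_p)%:~R + coef_val alpha b * (x`_p.+1)%:~R.
Proof.
move=> hp; rewrite /form_eval (bigD1 (Ordinal (ltnW hp))) //= (bigD1 (Ordinal hp)) /=; last first.
  by rewrite -(inj_eq val_inj) /= gtn_eqF.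
rewrite big1 ?addr0 => [|i /andP[i1 i2]]; last first.
  rewrite -!(inj_eq val_inj) /= in i1 i2.
  by rewrite /two_coefs (negbTE i1) (negbTE i2) coef_val0 mul0r.
by rewrite /two_coefs !eqxx gtn_eqF.
Qed.

Definition form_add (L K : form) : form := fun i => L i + K i.
Definition form_opp (L : form) : form := fun i => - L i.

Lemma form_addE L K x : form_eval (form_add L K) x = form_eval L x + form_eval K x.
Proof. by rewrite /form_eval -big_split; apply: eq_bigr => i _; rewrite coef_valD mulrDl. Qed.

Lemma form_oppE L x : form_eval (form_opp L) x = - form_eval L x.
Proof. by rewrite /form_eval -sumrN; apply: eq_bigr => i _; rewrite coef_valN mulNr. Qed.

(** The pair [(0, 1)] is [B - 1], so the second coefficient is that of [w (B - 1)]. *)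
Definition val_form (w : int * int) (p : nat) : form :=
  two_coefs p (pair_coef w) (pair_coef (pair_mul t w (0, 1))).

Definition cval_form (w : int * int) (p : nat) : form :=
  two_coefs p (pair_coef (pair_conj w)) (pair_coef (pair_conj (pair_mul t w (0, 1)))).

Lemma val_formE w p x : (p.+1 < 21)%N ->
  form_eval (val_form w p) x = val w * val (at_pair x p).
Proof.
move=> hp; rewrite two_coefs_eval // !pair_coefE (valM unitB_BC unitB_sum) -mulrA -mulrDr.
by congr (_ * _); rewrite /pair_val /=; ring.
Qed.

Lemma cval_formE w p x : (p.+1 < 21)%N ->
  form_eval (cval_form w p) x = cval w * cval (at_pair x p).
Proof.
move=> hp; rewrite two_coefs_eval // !pair_coefE !pair_conjE (cvalM unitB_BC unitB_sum) -mulrA -mulrDr.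
by congr (_ * _); rewrite /pair_val /=; ring.
Qed.

Definition le_form (L : form) (m : int) (K : form) (n : int) : formula 21 :=
  atom (form_add L (form_opp K)) (n - m, 0).
Definition lt_form (L : form) (m : int) (K : form) (n : int) : formula 21 :=
  Not (le_form K n L m).
Definition zero_form : form := fun=> 0.

Lemma zero_formE x : form_eval zero_form x = 0.
Proof. by rewrite /form_eval big1 // => i _; rewrite coef_val0 mul0r. Qed.

Lemma sat_le L m K n x : sat alpha (le_form L m K n) x =
  (form_eval L x + m%:~R <= form_eval K x + n%:~R).
Proof.
rewrite sat_atom form_addE form_oppE /coef_val /= mul0r addr0 rmorphB /=.
by apply/idP/idP => ?; lra.
Qed.

Lemma sat_lt L m K n x : sat alpha (lt_form L m K n) x =
  (form_eval L x + m%:~R < form_eval K x + n%:~R).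
Proof. by rewrite sat_Not sat_le ltNge. Qed.

Notation pw i := (pair_pow t i).
Notation "F '&&&' G" := (And F G) (at level 40, left associativity).
Notation "F '|||' G" := (Or F G) (at level 50, left associativity).

(** The cut is taken at the exponent of [e] plus [r]: a fixed shift of a quantified exponent only
    changes coefficients. *)
Definition cut_formula (u e v r : nat) : formula 21 :=
  le_form zero_form 0 (val_form (pw 0) v) 0 &&&
  lt_form (val_form (2, 0) v) 0 (val_form (pw r) e) 0 &&&
  le_form (cval_form (pw 0) v) 0 (cval_form (pw 0) u) 0 &&&
  lt_form (form_add (cval_form (pw 0) u) (form_opp (cval_form (pw 0) v))) 0
          (cval_form (pair_mul t (2, 0) (pw r)) e) 0.

Lemma val2 : val (2, 0) = 2.
Proof. by rewrite /pair_val /= mul0r addr0. Qed.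
Lemma cval2 : cval (2, 0) = 2.
Proof. by rewrite /pair_val /= mul0r addr0. Qed.

Let vpw i : val (pw i) = B ^+ i := val_pow unitB_BC unitB_sum i.
Let cpw i : cval (pw i) = C ^+ i := cval_pow unitB_BC unitB_sum i.

Lemma sat_cut u e v x r : (u.+1 < 21)%N -> (e.+1 < 21)%N -> (v.+1 < 21)%N ->
  sat alpha (cut_formula u e v r) x <->
  cut B C (B ^+ r * val (at_pair x e)) (C ^+ r * cval (at_pair x e)) (at_pair x u) (at_pair x v).
Proof.
move=> hu he hv; rewrite /cut_formula.
rewrite !sat_And !sat_le !sat_lt form_addE form_oppE zero_formE !val_formE // !cval_formE // !vpw !cpw.
rewrite (cvalM unitB_BC unitB_sum) cpw val2 cval2 !addr0 ?expr0 !mul1r ?expr0 ?mul1r.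
rewrite /cut pair_valB subr_ge0 mulrA; split; last by move=> [-> -> -> ->].
by move=> /andP[/andP[/andP[-> ->] ->] ->].
Qed.

Definition no_digit_formula (u e v : nat) : formula 21 :=
  cut_formula u e v 0 &&& cut_formula u e v 1.

Lemma sat_no_digit u e v x : (u.+1 < 21)%N -> (e.+1 < 21)%N -> (v.+1 < 21)%N ->
  sat alpha (no_digit_formula u e v) x <->
  cut B C (val (at_pair x e)) (cval (at_pair x e)) (at_pair x u) (at_pair x v) /\
  cut B C (B * val (at_pair x e)) (C * cval (at_pair x e)) (at_pair x u) (at_pair x v).
Proof.
move=> hu he hv; rewrite sat_And.
have h0 := sat_cut x 0 hu he hv; have h1 := sat_cut x 1 hu he hv.
rewrite !expr0 !mul1r in h0; rewrite !expr1 in h1.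
by rewrite -h0 -h1; split => [/andP//|[-> ->]].
Qed.

Definition window_formula (u e r r' v v' : nat) : formula 21 :=
  cut_formula u e v r &&& cut_formula u e v' r' &&&
  lt_form (val_form (pw 0) v) 0 (val_form (pw 0) v') 0.

Lemma sat_window u e r r' v v' x : (u.+1 < 21)%N -> (e.+1 < 21)%N -> (v.+1 < 21)%N -> (v'.+1 < 21)%N ->
  sat alpha (window_formula u e r r' v v') x <->
  [/\ cut B C (B ^+ r * val (at_pair x e)) (C ^+ r * cval (at_pair x e)) (at_pair x u) (at_pair x v),
      cut B C (B ^+ r' * val (at_pair x e)) (C ^+ r' * cval (at_pair x e)) (at_pair x u) (at_pair x v') &
      val (at_pair x v) < val (at_pair x v')].
Proof.
move=> hu he hv hv'; rewrite /window_formula.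
rewrite sat_And (sat_And (cut_formula u e v r)) sat_lt !val_formE // !vpw !expr0 !mul1r !addr0.
have h1 := sat_cut x r hu he hv; have h2 := sat_cut x r' hu he hv'.
split; first by move=> /andP[/andP[/h1 ? /h2 ?] ?].
by move=> [/h1 -> /h2 -> ->].
Qed.

(** The pair [v] is the existential witness that [power_char] provides when [e] is not a power of
    [B]. *)
Definition not_power_formula (e v : nat) : formula 21 :=
  lt_form (val_form (pw 0) e) 0 zero_form 1 |||
  le_form (cval_form (pw 0) e) 0 zero_form 0 |||
  (lt_form zero_form 0 (val_form (pw 0) v) 0 &&& lt_form (val_form (pw 0) v) 0 (val_form (pw 0) e) 0 &&&
   (lt_form zero_form 0 (cval_form (pw 0) v) 0 &&& lt_form (cval_form (pw 0) v) 0 (cval_form (pw 0) e) 0)).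

Definition not_power (e v : int * int) : Prop :=
  [\/ val e < 1, cval e <= 0 | 0 < val v < val e /\ 0 < cval v < cval e].

Lemma sat_not_power e v x : (e.+1 < 21)%N -> (v.+1 < 21)%N ->
  sat alpha (not_power_formula e v) x <-> not_power (at_pair x e) (at_pair x v).
Proof.
move=> he hv; rewrite /not_power_formula.
rewrite !sat_Or !sat_And.
rewrite !sat_lt !sat_le !zero_formE !val_formE // !cval_formE // !vpw !cpw !expr0 !mul1r !addr0 add0r.
rewrite /not_power; split.
  move=> /orP[/orP[h|h]|/andP[h1 h2]]; [exact: Or31|exact: Or32|exact: Or33].
by case=> [->|->|[-> ->]]; rewrite ?orbT.
Qed.

Definition val_eq_formula (L K : form) : formula 21 := le_form L 0 K 0 &&& le_form K 0 L 0.

Lemma sat_val_eq L K x : sat alpha (val_eq_formula L K) x <-> form_eval L x = form_eval K x.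
Proof.
rewrite sat_And !sat_le !addr0 -eq_le; split => [/eqP|->] //; exact: eqxx.
Qed.

(* The coefficients [D] and [Q] are never negated, so that the encoding of their sign does not
   depend on whether they vanish. *)
Definition int_eq_formula (D Q : nat) (i j k : nat) : formula 21 :=
  let L : form := fun m => if m == i then (D%:Z, 0) else if m == j then (Q%:Z, 0)
    else if m == k then (-1, 0) else 0 in
  atom L 0 &&& Not (atom L (-1, 0)).

Lemma int_form_eval D Q i j k x : (i < 21)%N -> (j < 21)%N -> (k < 21)%N -> uniq [:: i; j; k] ->
  form_eval (fun m => if m == i then (D%:Z, 0) else if m == j then (Q%:Z, 0)
    else if m == k then (-1, 0) else 0) x = (D%:Z * x`_i + Q%:Z * x`_j - x`_k)%:~R.
Proof.
move=> hi hj hk /=; rewrite !inE negb_or !andbT => /andP[/andP[ij ik] jk].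
rewrite /form_eval (bigD1 (Ordinal hi)) //= (bigD1 (Ordinal hj)) /=; last first.
  by rewrite -(inj_eq val_inj) /= eq_sym.
rewrite (bigD1 (Ordinal hk)) /=; last first.
  by rewrite -!(inj_eq val_inj) /= eq_sym ik eq_sym jk.
rewrite big1 ?addr0 => [|m /andP[/andP[m1 m2] m3]]; last first.
  rewrite -!(inj_eq val_inj) /= in m1 m2 m3.
  by rewrite (negbTE m1) (negbTE m2) (negbTE m3) coef_val0 mul0r.
rewrite !eqxx ![_ == i]eq_sym (negbTE ij) (negbTE ik) [_ == j]eq_sym (negbTE jk) /coef_val /= !mul0r !addr0.
by rewrite rmorphB rmorphD !rmorphM /=; ring.
Qed.

(** The form takes integer values, so being at most 0 but not at most -1 means vanishing. *)
Lemma sat_int_eq D Q i j k x : (i < 21)%N -> (j < 21)%N -> (k < 21)%N -> uniq [:: i; j; k] ->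
  sat alpha (int_eq_formula D Q i j k) x <-> x`_k = D%:Z * x`_i + Q%:Z * x`_j.
Proof.
move=> hi hj hk u; rewrite sat_And sat_Not !sat_atom !int_form_eval //.
rewrite /coef_val /= !mul0r !addr0 -ltNge (ltr_int R) (ler_int R _ 0).
by split=> [/andP[h1 h2]|->]; [lia | apply/andP; split; lia].
Qed.

End Atoms.

(** * The quantifier-free formula *)

Section Body.
Variables (R : realType) (alpha B C : R) (t : nat) (c d : int).
Hypothesis unitB : unit_data alpha B C t c d.
Variables (s S acc r0 : nat) (J : int * int).

Notation val := (pair_val B).
Notation cval := (pair_val C).
Notation pw i := (pair_pow t i).
Notation "F '&&&' G" := (And F G) (at level 40, left associativity).
Notation "F '|||' G" := (Or F G) (at level 50, left associativity).
Notation val_form := (val_form t c d).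
Notation not_power_formula := (not_power_formula t c d).
Notation no_digit_formula := (no_digit_formula t c d).
Notation window_formula := (window_formula t c d).

(* The pairs of variables 0, 2, 4 are the sets of exponents, the pairs 6, 8 the universally
   quantified powers, and the later variables are witnesses. The value of the pair 8 also selects one
   of the last conjuncts, which can therefore share their witnesses. *)
Definition product_formula (D Q : nat) : formula 21 :=
  int_eq_formula t 0 7 20 16 &&& int_eq_formula 1 t 6 7 17 &&&
  int_eq_formula D Q 6 16 14 &&& int_eq_formula D Q 7 17 15.

(** An implication written as a disjunction: if the pairs 6 and 8 are powers that occur in [u] and
    [u'], then the second does not occur in the product of the first with a fixed set, so the
    difference of their exponents is not in that set. One true disjunct is enough, so all of them
    share the witness [v]. *)
Definition difference_formula (product : formula 21) (u u' v z : nat) : formula 21 :=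
  not_power_formula 6 v ||| not_power_formula 8 v ||| no_digit_formula u 6 v |||
  no_digit_formula u' 8 v ||| (product &&& no_digit_formula z 8 v).

Definition selector (k : nat) : formula 21 :=
  lt_form zero_form (- k.+1%:Z) (val_form (pw 0) 8) 0 &&& le_form (val_form (pw 0) 8) 0 zero_form (- k%:Z).

Definition member_formula (F : formula 21) : formula 21 :=
  not_power_formula 6 10 ||| no_digit_formula 4 6 10 ||| F.

Definition selected (k : nat) (F : formula 21) : formula 21 := Not (selector k) ||| F.

Definition not_one_formula : formula 21 :=
  lt_form (val_form (pw 0) 6) 0 zero_form 1 ||| lt_form zero_form 1 (val_form (pw 0) 6) 0.

(** The sign condition on the third set makes its exponents bounded. The junk set does not depend on
    the input, so its product is described by an equation between values; the clash set goes through
    [product_formula], where [D] and [Q] appear verbatim. *)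
Definition body_formula (D Q : nat) : formula 21 :=
  le_form zero_form 0 (val_form (pw 0) 4) 0 &&&
  difference_formula (product_formula D Q) 0 2 10 14 &&&
  difference_formula (val_eq_formula (val_form (pw 0) 18) (val_form J 6)) 4 2 12 18 &&&
  selected 0 (member_formula (window_formula 0 6 0 s 10 12)) &&&
  selected 1 (member_formula (window_formula 2 6 0 S 10 12)) &&&
  selected 2 (member_formula (window_formula 4 6 S S.+1 10 12 ||| window_formula 0 6 acc acc.+1 10 12)) &&&
  selected 3 (not_one_formula ||| window_formula 0 6 r0 r0.+1 10 12) &&&
  selected 4 (not_one_formula ||| window_formula 4 6 0 1 10 12).

Lemma num_ineqs_body D Q : (num_ineqs (body_formula D Q) <= 300)%N.
Proof. by []. Qed.

Definition digit_absent (e u v : int * int) : Prop :=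
  cut B C (val e) (cval e) u v /\ cut B C (B * val e) (C * cval e) u v.

Definition window (e u : int * int) (r r' : nat) (v v' : int * int) : Prop :=
  [/\ cut B C (B ^+ r * val e) (C ^+ r * cval e) u v,
      cut B C (B ^+ r' * val e) (C ^+ r' * cval e) u v' & val v < val v'].

Definition difference (Z e f u u' v : int * int) : Prop :=
  [\/ not_power B C e v, not_power B C f v, digit_absent e u v | digit_absent f u' v] \/
  digit_absent f (pair_mul t Z e) v.

Definition selects (f : int * int) (k : nat) : Prop := - k.+1%:R < val f <= - k%:R.

Definition member (e w v : int * int) (P : Prop) : Prop :=
  [\/ not_power B C e v, digit_absent e w v | P].

Definition body_holds (Z u u' w e f v v' : int * int) : Prop :=
  [/\ 0 <= val w, difference Z e f u u' v & difference J e f w u' v'] /\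
  [/\ selects f 0 -> member e w v (window e u 0 s v v'),
      selects f 1 -> member e w v (window e u' 0 S v v'),
      selects f 2 -> member e w v (window e w S S.+1 v v' \/ window e u acc acc.+1 v v'),
      selects f 3 -> val e <> 1 \/ window e u r0 r0.+1 v v' &
      selects f 4 -> val e <> 1 \/ window e w 0 1 v v'].

Lemma pw0E x p : (p.+1 < 21)%N -> form_eval alpha (val_form (pw 0) p) x = val (at_pair x p).
Proof. by move=> hp; rewrite (val_formE unitB) // (val_pow (unitB_BC unitB) (unitB_sum unitB)) mul1r. Qed.

Lemma sat_selector k x : sat alpha (selector k) x <-> selects (at_pair x 8) k.
Proof.
rewrite /selector sat_And sat_lt sat_le !pw0E // zero_formE !add0r !addr0.
by rewrite !rmorphN.
Qed.

Lemma sat_selected k F x (P : Prop) : (sat alpha F x <-> P) ->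
  sat alpha (selected k F) x <-> (selects (at_pair x 8) k -> P).
Proof.
move=> hF; have hs := sat_selector k x; rewrite /selected sat_Or sat_Not.
split; first by move=> /orP[/negP h /hs //|/hF].
move=> h; case: (boolP (sat alpha (selector k) x)) => //= /hs /h; by move=> /hF.
Qed.

Lemma sat_member x F (P : Prop) : (sat alpha F x <-> P) ->
  sat alpha (member_formula F) x <-> member (at_pair x 6) (at_pair x 4) (at_pair x 10) P.
Proof.
move=> hF; have h1 := sat_not_power unitB x (isT : (7 < 21)%N) (isT : (11 < 21)%N).
have h2 := sat_no_digit unitB x (isT : (5 < 21)%N) (isT : (7 < 21)%N) (isT : (11 < 21)%N).
rewrite /member_formula 2!sat_Or; split.
  by move=> /orP[/orP[/h1|/h2]|/hF] h; [exact: Or31|exact: Or32|exact: Or33].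
by case=> [/h1 ->|/h2 ->|/hF ->]; rewrite ?orbT.
Qed.

Lemma sat_not_one x F (P : Prop) : (sat alpha F x <-> P) ->
  sat alpha (not_one_formula ||| F) x <-> (val (at_pair x 6) <> 1 \/ P).
Proof.
move=> hF; rewrite !sat_Or !sat_lt !pw0E // zero_formE !add0r !addr0 -neq_lt; split.
  by move=> /orP[/eqP h|/hF h]; [left|right].
by case=> [/eqP ->|/hF ->]; rewrite ?orbT.
Qed.

Lemma sat_difference F u u' v z x Z :
  (u.+1 < 21)%N -> (u'.+1 < 21)%N -> (v.+1 < 21)%N -> (z.+1 < 21)%N ->
  (sat alpha F x -> at_pair x z = pair_mul t Z (at_pair x 6)) ->
  sat alpha (difference_formula F u u' v z) x ->
  difference Z (at_pair x 6) (at_pair x 8) (at_pair x u) (at_pair x u') (at_pair x v).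
Proof.
move=> hu hu' hv hz hF; rewrite /difference_formula 4!sat_Or (sat_And alpha F) /difference.
move=> /orP[/orP[/orP[/orP[]|]|]|/andP[/hF <-]].
- by move=> /(sat_not_power unitB x (isT : (7 < 21)%N) hv) h; left; exact: Or41.
- by move=> /(sat_not_power unitB x (isT : (9 < 21)%N) hv) h; left; exact: Or42.
- by move=> /(sat_no_digit unitB x hu (isT : (7 < 21)%N) hv) h; left; exact: Or43.
- by move=> /(sat_no_digit unitB x hu' (isT : (9 < 21)%N) hv) h; left; exact: Or44.
- by move=> /(sat_no_digit unitB x hz (isT : (9 < 21)%N) hv) h; right.
Qed.

Lemma difference_sat F u u' v z x Z :
  (u.+1 < 21)%N -> (u'.+1 < 21)%N -> (v.+1 < 21)%N -> (z.+1 < 21)%N ->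
  sat alpha F x -> at_pair x z = pair_mul t Z (at_pair x 6) ->
  difference Z (at_pair x 6) (at_pair x 8) (at_pair x u) (at_pair x u') (at_pair x v) ->
  sat alpha (difference_formula F u u' v z) x.
Proof.
move=> hu hu' hv hz hF hZ; rewrite /difference_formula 4!sat_Or (sat_And alpha F) hF /difference -hZ.
case=> [[h|h|h|h]|h].
- by rewrite (sat_not_power unitB x _ hv).2.
- by rewrite (sat_not_power unitB x (isT : (9 < 21)%N) hv).2 // orbT.
- by rewrite (sat_no_digit unitB x hu _ hv).2 // !orbT.
- by rewrite (sat_no_digit unitB x hu' (isT : (9 < 21)%N) hv).2 // !orbT.
- by rewrite (sat_no_digit unitB x hz (isT : (9 < 21)%N) hv).2 // !orbT.
Qed.

Lemma sat_body_rest (x : seq int) :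
  let e := at_pair x 6 in let f := at_pair x 8 in let v := at_pair x 10 in let v' := at_pair x 12 in
  [/\ sat alpha (selected 0 (member_formula (window_formula 0 6 0 s 10 12))) x,
      sat alpha (selected 1 (member_formula (window_formula 2 6 0 S 10 12))) x,
      sat alpha (selected 2 (member_formula (window_formula 4 6 S S.+1 10 12 ||| window_formula 0 6 acc acc.+1 10 12))) x,
      sat alpha (selected 3 (not_one_formula ||| window_formula 0 6 r0 r0.+1 10 12)) x &
      sat alpha (selected 4 (not_one_formula ||| window_formula 4 6 0 1 10 12)) x] <->
  [/\ selects f 0 -> member e (at_pair x 4) v (window e (at_pair x 0) 0 s v v'),
      selects f 1 -> member e (at_pair x 4) v (window e (at_pair x 2) 0 S v v'),
      selects f 2 -> member e (at_pair x 4) v (window e (at_pair x 4) S S.+1 v v' \/ window e (at_pair x 0) acc acc.+1 v v'),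
      selects f 3 -> val e <> 1 \/ window e (at_pair x 0) r0 r0.+1 v v' &
      selects f 4 -> val e <> 1 \/ window e (at_pair x 4) 0 1 v v'].
Proof.
have W u r r' : (u.+1 < 21)%N -> sat alpha (window_formula u 6 r r' 10 12) x <->
    window (at_pair x 6) (at_pair x u) r r' (at_pair x 10) (at_pair x 12).
  by move=> hu; exact: sat_window.
have W2 (F G : formula 21) P Q : (sat alpha F x <-> P) -> (sat alpha G x <-> Q) ->
    (sat alpha (F ||| G) x <-> (P \/ Q)).
  move=> hF hG; rewrite sat_Or; split; first by move=> /orP[/hF|/hG]; [left|right].
  by case=> [/hF ->|/hG ->]; rewrite ?orbT.
move=> e f v v'.
have h0 := sat_selected 0 (sat_member (W 0 0 s isT)%N).
have h1 := sat_selected 1 (sat_member (W 2 0 S isT)%N).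
have h2 := sat_selected 2 (sat_member (W2 _ _ _ _ (W 4 S S.+1 isT)%N (W 0 acc acc.+1 isT)%N)).
have h3 := sat_selected 3 (sat_not_one (W 0 r0 r0.+1 isT)%N).
have h4 := sat_selected 4 (sat_not_one (W 4 0 1 isT)%N).
split=> -[a0 a1 a2 a3 a4].
  by split; [apply/h0|apply/h1|apply/h2|apply/h3|apply/h4].
by split; [apply/h0|apply/h1|apply/h2|apply/h3|apply/h4].
Qed.

Lemma sat_body D Q x : sat alpha (body_formula D Q) x ->
  body_holds (D%:Z, Q%:Z) (at_pair x 0) (at_pair x 2) (at_pair x 4) (at_pair x 6) (at_pair x 8)
    (at_pair x 10) (at_pair x 12).
Proof.
rewrite /body_formula 7!sat_And.
move=> /andP[/andP[/andP[/andP[/andP[/andP[/andP[a1 a2] a3] b0] b1] b2] b3] b4].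
split; last by apply/sat_body_rest.
split.
- by move: a1; rewrite sat_le pw0E // zero_formE !addr0.
- apply: sat_difference a2 => //; rewrite /product_formula 3!sat_And.
  move=> /andP[/andP[/andP[h1 h2] h3] h4].
  have e1 := (sat_int_eq alpha t 0 x (isT : (7 < 21)%N) (isT : (20 < 21)%N) (isT : (16 < 21)%N) isT).1 h1.
  have e2 := (sat_int_eq alpha 1 t x (isT : (6 < 21)%N) (isT : (7 < 21)%N) (isT : (17 < 21)%N) isT).1 h2.
  have e3 := (sat_int_eq alpha D Q x (isT : (6 < 21)%N) (isT : (16 < 21)%N) (isT : (14 < 21)%N) isT).1 h3.
  have e4 := (sat_int_eq alpha D Q x (isT : (7 < 21)%N) (isT : (17 < 21)%N) (isT : (15 < 21)%N) isT).1 h4.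
  by rewrite /at_pair /pair_mul /= e3 e4 e1 e2; congr pair; ring.
apply: sat_difference a3 => //; move=> /sat_val_eq.
rewrite pw0E // (val_formE unitB) // -(valM (unitB_BC unitB) (unitB_sum unitB)).
exact: (pair_val_inj (unitB_BC unitB) (unitB_sum unitB) (unitB_gt1 unitB) (unitB_t unitB)).
Qed.

(** The product with [(D, Q)] is [(D e1 + Q (t e2), D e2 + Q (e1 + t e2))]. With witnesses for
    [t e2] and [e1 + t e2], the sentence contains no number computed from [D] and [Q]. The final 0
    fills a place that has coefficient 0. *)
Lemma body_sat D Q (u u' w e f v v' : int * int) :
  body_holds (D%:Z, Q%:Z) u u' w e f v v' ->
  sat alpha (body_formula D Q) [:: u.1; u.2; u'.1; u'.2; w.1; w.2; e.1; e.2; f.1; f.2;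
    v.1; v.2; v'.1; v'.2; (pair_mul t (D%:Z, Q%:Z) e).1; (pair_mul t (D%:Z, Q%:Z) e).2;
    t%:Z * e.2; e.1 + t%:Z * e.2; (pair_mul t J e).1; (pair_mul t J e).2; 0].
Proof.
set z := pair_mul t (D%:Z, Q%:Z) e; set z' := pair_mul t J e.
move=> hb; set x := (X in sat _ _ X); case: hb => [[a1 a2 a3] a4].
have [E0 E2 E4 E6 E8] : [/\ at_pair x 0 = u, at_pair x 2 = u', at_pair x 4 = w, at_pair x 6 = e & at_pair x 8 = f].
  by rewrite /at_pair /x /= -!surjective_pairing.
have [E10 E12 E14 E18] : [/\ at_pair x 10 = v, at_pair x 12 = v', at_pair x 14 = z & at_pair x 18 = z'].
  by rewrite /at_pair /x /= -!surjective_pairing.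
rewrite /body_formula 7!sat_And.
have [|b0 b1 b2 b3 b4] := (sat_body_rest x).2; first by rewrite E0 E2 E4 E6 E8 E10 E12.
rewrite b0 b1 b2 b3 b4 !andbT; apply/andP; split; first apply/andP; first split.
- by rewrite sat_le pw0E // zero_formE !addr0 E4.
- apply: (@difference_sat _ _ _ _ _ x (D%:Z, Q%:Z)) => //; rewrite ?E14 ?E0 ?E2 ?E6 ?E8 ?E10 //.
  rewrite /product_formula 3!sat_And; apply/andP; split; first apply/andP; first split; first apply/andP; first split.
  - apply: (sat_int_eq alpha t 0 x (isT : (7 < 21)%N) (isT : (20 < 21)%N) (isT : (16 < 21)%N) isT).2.
    by rewrite /= mul0r addr0.
  - apply: (sat_int_eq alpha 1 t x (isT : (6 < 21)%N) (isT : (7 < 21)%N) (isT : (17 < 21)%N) isT).2.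
    by rewrite /= mul1r.
  - apply: (sat_int_eq alpha D Q x (isT : (6 < 21)%N) (isT : (16 < 21)%N) (isT : (14 < 21)%N) isT).2.
    by rewrite /= mulrCA.
  - apply: (sat_int_eq alpha D Q x (isT : (7 < 21)%N) (isT : (17 < 21)%N) (isT : (15 < 21)%N) isT).2.
    by rewrite /=; ring.
- apply: (@difference_sat _ _ _ _ _ x J) => //; rewrite ?E18 ?E4 ?E2 ?E6 ?E8 ?E12 //.
  apply/sat_val_eq; rewrite pw0E // (val_formE unitB) // E18 E6.
  by rewrite (valM (unitB_BC unitB) (unitB_sum unitB)).
Qed.

End Body.

(** * Truth of the sentence and tileability *)

Section Truth.
Variables (R : realType) (alpha B C : R) (t : nat) (c d : int).
Hypothesis unitB : unit_data alpha B C t c d.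
Let BC := unitB_BC unitB.
Let BDC := unitB_sum unitB.
Let B1 := unitB_gt1 unitB.
Let t2 := unitB_t unitB.

Notation val := (pair_val B).
Notation cval := (pair_val C).
Notation pw i := (pair_pow t i).

Let vpw i : val (pw i) = B ^+ i := val_pow BC BDC i.
Let cpw i : cval (pw i) = C ^+ i := cval_pow BC BDC i.

Lemma power_not_not_power i v : ~ not_power B C (pw i) v.
Proof.
case; rewrite ?vpw ?cpw.
- by rewrite ltNge exprn_ege1 // ltW.
- by rewrite leNgt (CX_gt0 BC B1).
- by move=> h; apply: (pair_pow_min BC BDC B1 t2 (i := i) (z := v)); rewrite vpw cpw.
Qed.

Lemma power_cases e : (exists i, e = pw i) \/ exists v, not_power B C e v.
Proof.
have [h|h] := pselect (exists v, not_power B C e v); [by right | left].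
apply: (power_char BC BDC B1 t2).
- by rewrite leNgt; apply/negP => lt; apply: h; exists 0; exact: Or31.
- by rewrite ltNge; apply/negP => le; apply: h; exists 0; exact: Or32.
- by move=> z hz; apply: h; exists z; exact: Or33.
Qed.

Lemma absent_no_digit i u v : digit_absent B C (pw i) u v -> no_digit B C (B ^+ i) (C ^+ i) u.
Proof. by rewrite /digit_absent vpw cpw => h; exists v. Qed.

Lemma no_digit_absent i u : no_digit B C (B ^+ i) (C ^+ i) u -> exists v, digit_absent B C (pw i) u v.
Proof. by move=> [v h]; exists v; rewrite /digit_absent vpw cpw. Qed.

Lemma shift_no_digit (X : pred nat) n i j : (forall k, X k -> (k < n)%N) ->
  no_digit B C (B ^+ j) (C ^+ j) (pair_mul t (digit_sum t X n) (pw i)) <->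
  ~~ ((i <= j)%N && X (j - i)%N).
Proof.
move=> Xn; rewrite (digit_sum_pow_mul BC BDC B1 t2).
apply: (no_digitP BC BDC B1 t2) => k /andP[ik /Xn]; lia.
Qed.

Lemma window_exists i u r r' v v' : (r <= r')%N -> window B C (pw i) u r r' v v' ->
  exists k, (i + r <= k < i + r')%N /\ ~ no_digit B C (B ^+ k) (C ^+ k) u.
Proof.
move=> le_r; rewrite /window vpw cpw -!exprD ![(_ + i)%N]addnC => -[s1 s2 lt_v].
have E : (i + r' = i + r + (r' - r))%N by lia.
rewrite E in s2 *; apply: (window_digit BC BDC B1 t2 s1 s2).
by move=> Ev; rewrite Ev ltxx in lt_v.
Qed.

Lemma digit_sum_window (X : pred nat) n i r r' k : (forall k, X k -> (k < n)%N) ->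
  (i + r <= k < i + r')%N -> X k ->
  window B C (pw i) (digit_sum t X n) r r' (digit_sum t X (i + r)) (digit_sum t X (i + r')).
Proof.
move=> Xn /andP[h1 h2] Xk; rewrite /window vpw cpw -!exprD ![(_ + i)%N]addnC.
rewrite -(digit_sum_bound t (leq_maxl n (i + r')) Xn); set m := maxn _ _.
have hm : (i + r' <= m)%N by rewrite leq_maxr.
split.
- by apply: (digit_sum_cut BC BDC B1 t2) => //; lia.
- exact: (digit_sum_cut BC BDC B1 t2).
have mono a b : (a <= b)%N -> val (digit_sum t X a) <= val (digit_sum t X b).
  elim: b => [|b IH]; first by rewrite leqn0 => /eqP->.
  rewrite leq_eqVlt => /orP[/eqP->//|]; rewrite ltnS => /IH h.
  rewrite /= pair_valD; have := BX_gt0 B1 b.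
  by case: (X b); rewrite ?vpw ?pair_val0 => ?; lra.
apply: le_lt_trans (mono _ _ h1) _; apply: lt_le_trans (mono _ _ h2).
by rewrite /= Xk pair_valD vpw ltrDr (BX_gt0 B1).
Qed.

Lemma difference_exists (X Y Z : pred nat) n m :
  (forall k, X k -> (k < n)%N) -> (forall k, Y k -> (k < n)%N) -> (forall k, Z k -> (k < m)%N) ->
  (forall i j, (i <= j)%N -> X i -> Y j -> ~~ Z (j - i)%N) ->
  forall e f, exists v, difference B C t (digit_sum t Z m) e f (digit_sum t X n) (digit_sum t Y n) v.
Proof.
move=> Xn Yn Zm XYZ e f.
have [[i ->]|[v h]] := power_cases e; last by exists v; left; exact: Or41.
have [[j ->]|[v h]] := power_cases f; last by exists v; left; exact: Or42.
have [Xi|nXi] := boolP (X i); last first.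
  have [v h] := no_digit_absent ((no_digitP BC BDC B1 t2 i Xn).2 nXi).
  by exists v; left; exact: Or43.
have [Yj|nYj] := boolP (Y j); last first.
  have [v h] := no_digit_absent ((no_digitP BC BDC B1 t2 j Yn).2 nYj).
  by exists v; left; exact: Or44.
have [|v h] := @no_digit_absent j (pair_mul t (digit_sum t Z m) (pw i)).
  by apply/shift_no_digit => //; rewrite negb_and; case: leqP => //= le; exact: XYZ.
by exists v; right.
Qed.

Lemma member_exists (X : pred nat) n e (P : int * int -> int * int -> Prop) :
  (forall k, X k -> (k < n)%N) -> (forall i, X i -> e = pw i -> exists v v', P v v') ->
  exists v v', member B C e (digit_sum t X n) v (P v v').
Proof.
move=> Xn h.
have [[i Ee]|[v hv]] := power_cases e; last by exists v, v; exact: Or31.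
have [Xi|nXi] := boolP (X i).
  by have [v [v' hP]] := h i Xi Ee; exists v, v'; exact: Or33.
have [v hv] := no_digit_absent ((no_digitP BC BDC B1 t2 i Xn).2 nXi).
by exists v, v; rewrite Ee; exact: Or32.
Qed.

Variables (G : finType) (ok : nat -> G -> G -> bool) (D : nat) (first last : G).
Hypothesis ok0 : forall a b, ok 0 a b = (a == b).

Definition clash_pair : int * int := digit_sum t (clashes ok D first) (block_size G * D.+1).
Definition junk_pair : int * int := digit_sum t (junk G) (block_size G).

Notation sentence_body := (body_holds B C t (num_letters G) (block_size G) (rank_of last) (rank_of first)
  junk_pair clash_pair).

Lemma clashes_bound k : clashes ok D first k -> (k < block_size G * D.+1)%N.
Proof. by move=> /andP[h _]; rewrite mulnC -ltn_divLR. Qed.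

Lemma junk_bound k : junk G k -> (k < block_size G)%N.
Proof. by case/andP. Qed.

(** The exponents of the three elements are those where [no_digit] fails, whatever the elements are.
    Taking powers for [e] and [f] gives the conditions on differences; taking [-k] for [f] gives the
    selected conjuncts one by one. *)
Lemma body_tileable :
  (exists u u' w, forall e f, exists v v', sentence_body u u' w e f v v') ->
  tileable ok D first last.
Proof.
move=> [u [u' [w h]]].
pose X z i := ~ no_digit B C (B ^+ i) (C ^+ i) z.
have [v0 [v0' [[w0 _ _] _]]] := h 0 0.
have [n hn] := no_digit_large BC BDC B1 t2 w.
have sel k : selects B (- k%:Z, 0) k.
  have E : val (- k%:Z, 0) = - k%:R by rewrite /pair_val /= mul0r addr0 rmorphN.
  by rewrite /selects E lexx andbT ltrN2 ltr_nat.
have mem i k v (P : Prop) : X w i -> (selects B (- k%:Z, 0) k -> member B C (pw i) w v P) -> P.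
  move=> Wi /(_ (sel k)) [/power_not_not_power //|/absent_no_digit //|//].
have one i r r' z v v' : window B C (pw i) z r r' v v' -> (r <= r')%N -> exists k, (i + r <= k < i + r')%N /\ X z k.
  by move=> hw le; apply: window_exists le hw.
apply: (@digit_sets_tileable G ok D first last ok0 (X u) (X u') (X w) n); last first.
  by move=> i Wi; rewrite ltnNge; apply/negP => le; apply: Wi; exact: hn.
have diff (Z : pred nat) m z z' i j v : (forall k, Z k -> (k < m)%N) -> (i <= j)%N -> X z i -> X z' j ->
    difference B C t (digit_sum t Z m) (pw i) (pw j) z z' v -> ~~ Z (j - i)%N.
  move=> Zm le Xi Xj [[/power_not_not_power //|/power_not_not_power //|/absent_no_digit //|/absent_no_digit //]|].
  by move=> /absent_no_digit /(shift_no_digit _ _ Zm); rewrite le.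
split.
- move=> i j le Ui Vj; have [v [v' [[_ h1 _] _]]] := h (pw i) (pw j).
  exact: diff clashes_bound le Ui Vj h1.
- move=> i j le Wi Vj; have [v [v' [[_ _ h1] _]]] := h (pw i) (pw j).
  exact: diff junk_bound le Wi Vj h1.
- split=> i Wi.
    have [v [v' [_ [/(mem _ 0%N _ _ Wi) /one + _ _ _ _]]]] := h (pw i) (- 0%:Z, 0).
    by rewrite addn0 => hk; apply: hk.
  have [v [v' [_ [_ /(mem _ 1%N _ _ Wi) /one + _ _ _]]]] := h (pw i) (- 1%:Z, 0).
  by rewrite addn0 => hk; apply: hk.
- move=> i Wi; have [v [v' [_ [_ _ /(mem _ 2%N _ _ Wi) h1 _ _]]]] := h (pw i) (- 2%:Z, 0).
  case: h1 => /one /(_ (leqnSn _)) [k []]; rewrite addnS ltnS -eqn_leq => /eqP <- Xk; by [left|right].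
split.
  have [v [v' [_ [_ _ _ /(_ (sel 3%N)) h1 _]]]] := h (pw 0) (- 3%:Z, 0).
  case: h1; first by rewrite vpw.
  by move=> /one /(_ (leqnSn _)) [k []]; rewrite addnS ltnS -eqn_leq => /eqP <-.
have [v [v' [_ [_ _ _ _ /(_ (sel 4%N)) h1]]]] := h (pw 0) (- 4%:Z, 0).
case: h1; first by rewrite vpw.
by move=> /one /(_ isT) [k []]; rewrite addnS ltnS -eqn_leq => /eqP <-.
Qed.

Lemma tileable_body : tileable ok D first last ->
  exists u u' w, forall e f, exists v v', sentence_body u u' w e f v v'.
Proof.
move=> /tileable_digit_sets [U [V [W [n [Un Vn Wn [h1 h2 [h3 h3'] h4 [h5 h6]]]]]]].
exists (digit_sum t U n), (digit_sum t V n), (digit_sum t W n) => e f.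
have w0 : 0 <= val (digit_sum t W n) by have [] := digit_sum_val BC BDC B1 t2 W n.
(* If [val f >= 1], no conjunct is selected, and [v] and [v'] serve the two difference conditions.
   Otherwise [f] is not a power, both difference conditions are trivial, and [v] and [v'] are free
   for the at most one selected conjunct. *)
have [f1|f1] := lerP 1 (val f).
  have [v hv] := difference_exists Un Vn clashes_bound h1 e f.
  have [v' hv'] := difference_exists Wn Vn junk_bound h2 e f.
  exists v, v'; split; first by [].
  have ns k : ~ selects B f k.
    by move=> /andP[_ hk]; have : 0 <= k%:R :> R by []; move=> ?; lra.
  by split=> /ns.
have D0 Z z z' v : difference B C t Z e f z z' v by left; apply/Or42/Or31.
have uniq_sel k l : selects B f k -> selects B f l -> k = l.
  have H a b : selects B f a -> selects B f b -> (a <= b)%N.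
    move=> /andP[_ ha] /andP[hb _].
    have : - b.+1%:R < - a%:R :> R by apply: lt_le_trans ha.
    by rewrite ltrN2 ltr_nat ltnS.
  by move=> hk hl; apply/anti_leq; rewrite !H.
have build (k : nat) (P : nat -> int * int -> int * int -> Prop) :
    (forall l, (selects B f l -> exists v v', P l v v')) ->
    exists v v', forall l, selects B f l -> P l v v'.
  move=> hP; have [[l hl]|no] := pselect (exists l, selects B f l).
    by have [v [v' hv]] := hP l hl; exists v, v' => l' /(uniq_sel _ _ hl) <-.
  by exists 0, 0 => l hl; case: no; exists l.
pose P (l : nat) v v' := match l with
  | 0 => member B C e (digit_sum t W n) v (window B C e (digit_sum t U n) 0 (num_letters G) v v')
  | 1 => member B C e (digit_sum t W n) v (window B C e (digit_sum t V n) 0 (block_size G) v v')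
  | 2 => member B C e (digit_sum t W n) v (window B C e (digit_sum t W n) (block_size G) (block_size G).+1 v v' \/
           window B C e (digit_sum t U n) (rank_of last) (rank_of last).+1 v v')
  | 3 => val e <> 1 \/ window B C e (digit_sum t U n) (rank_of first) (rank_of first).+1 v v'
  | 4 => val e <> 1 \/ window B C e (digit_sum t W n) 0 1 v v'
  | _ => True end.
have e1 : val e <> 1 \/ e = pw 0.
  have [E|/eqP] := eqVneq (val e) 1; last by left.
  by right; apply: (pair_val_inj BC BDC B1 t2); rewrite vpw E.
have [v [v' hv]] : exists v v', forall l, selects B f l -> P l v v'.
  apply: (build 0%N) => -[|[|[|[|[|l]]]]] _; rewrite /P.
  - apply: member_exists => // i Wi ->; have [k [hk Uk]] := h3 i Wi.
    by do 2 eexists; apply: (digit_sum_window Un _ Uk); rewrite addn0.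
  - apply: member_exists => // i Wi ->; have [k [hk Vk]] := h3' i Wi.
    by do 2 eexists; apply: (digit_sum_window Vn _ Vk); rewrite addn0.
  - apply: member_exists => // i Wi ->; case: (h4 i Wi) => hk.
      by do 2 eexists; left; apply: (digit_sum_window Wn _ hk); lia.
    by do 2 eexists; right; apply: (digit_sum_window Un _ hk); lia.
  - case: e1 => [h|->]; first by exists 0, 0; left.
    by do 2 eexists; right; apply: (digit_sum_window Un _ h5); lia.
  - case: e1 => [h|->]; first by exists 0, 0; left.
    by do 2 eexists; right; apply: (digit_sum_window Wn _ h6); lia.
  - by exists 0, 0.
exists v, v'; split; first by [].
by split; [exact: (hv 0%N)|exact: (hv 1%N)|exact: (hv 2%N)|exact: (hv 3%N)|exact: (hv 4%N)].
Qed.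

Definition prefix3 : Defs.prefix := [:: (Ex, 6%N); (All, 4%N); (Ex, 11%N)].

Lemma holds_prefix3 (F : formula 21) : holds alpha (@Sentence prefix3 F) <->
  exists y : 6.-tuple int, forall z : 4.-tuple int, exists v : 11.-tuple int,
    sat alpha F ((y ++ z) ++ v).
Proof. by []. Qed.

Definition tiling_sentence (Dl Q : nat) : sentence :=
  @Sentence prefix3
    (body_formula t c d (num_letters G) (block_size G) (rank_of last) (rank_of first) junk_pair Dl Q).

Lemma nth_prefix3 (y : 6.-tuple int) (z : 4.-tuple int) (v : 11.-tuple int) :
  let x := ((y ++ z) ++ v) in
  [/\ at_pair x 0 = at_pair y 0, at_pair x 2 = at_pair y 2, at_pair x 4 = at_pair y 4,
      at_pair x 6 = at_pair z 0 & at_pair x 8 = at_pair z 2].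
Proof. by rewrite /at_pair !nth_cat !size_cat !size_tuple. Qed.

Theorem holds_tiling_sentence (Dl Q : nat) : (Dl%:Z, Q%:Z) = clash_pair ->
  holds alpha (tiling_sentence Dl Q) <-> tileable ok D first last.
Proof.
move=> EZ; apply: (iff_trans (holds_prefix3 _)); split.
  move=> [y h]; apply: body_tileable; rewrite -EZ.
  exists (at_pair y 0), (at_pair y 2), (at_pair y 4) => e f.
  have [v hv] := h [tuple e.1; e.2; f.1; f.2].
  have := sat_body unitB hv.
  have [-> -> -> -> ->] := nth_prefix3 y [tuple e.1; e.2; f.1; f.2] v.
  have -> : at_pair [tuple e.1; e.2; f.1; f.2] 0 = e by rewrite /at_pair /= -surjective_pairing.
  have -> : at_pair [tuple e.1; e.2; f.1; f.2] 2 = f by rewrite /at_pair /= -surjective_pairing.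
  by move=> hb; do 2 eexists; exact: hb.
move=> /tileable_body; rewrite -EZ => -[u [u' [w h]]].
exists [tuple u.1; u.2; u'.1; u'.2; w.1; w.2] => z.
have [v [v' hv]] := h (at_pair z 0) (at_pair z 2).
pose ee := at_pair z 0; pose z1 := pair_mul t (Dl%:Z, Q%:Z) ee; pose z2 := pair_mul t junk_pair ee.
exists [tuple v.1; v.2; v'.1; v'.2; z1.1; z1.2; t%:Z * ee.2; ee.1 + t%:Z * ee.2; z2.1; z2.2; 0].
have := body_sat unitB hv.
by case: z @ee @z1 @z2 hv => -[|a0 [|a1 [|a2 [|a3 [|a4 z]]]]].
Qed.

End Truth.

(** * The reduction *)

Section Templates.

(** The code of the sentence depends on [D] and [Q] only through inserted codes of these numbers,
    which is the kind of output that the transducer prints. *)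
Definition template (g : nat -> nat -> seq bool) : Prop :=
  exists ps : seq piece, forall D Q, g D Q = flatten [seq fill D Q p | p <- ps].

Lemma template_const w : template (fun _ _ => w).
Proof. by exists [:: inl w] => D Q; rewrite /= cats0. Qed.

Lemma template_cat g h : template g -> template h -> template (fun D Q => g D Q ++ h D Q).
Proof. by move=> [ps hp] [qs hq]; exists (ps ++ qs) => D Q; rewrite map_cat flatten_cat hp hq. Qed.

Lemma template_num (j : bool) : template (fun D Q => encode_nat (if j then Q else D)).
Proof. by exists [:: inr j] => D Q; rewrite /= cats0. Qed.

Lemma template_flatten (I : Type) (s : seq I) (g : I -> nat -> nat -> seq bool) :
  (forall i, template (g i)) -> template (fun D Q => flatten [seq g i D Q | i <- s]).
Proof.
move=> hg; elim: s => [|i s IH]; first exact: (template_const [::]).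
exact: template_cat (hg i) IH.
Qed.

Lemma template_coef (j : bool) : template (fun D Q => encode_coef ((if j then Q else D)%:Z, 0)).
Proof.
apply: (template_cat (g := fun D Q => encode_int (if j then Q else D)%:Z) (h := fun _ _ => encode_int 0)); last exact: template_const.
exact: (template_cat (template_const [:: false]) (template_num j)).
Qed.

Definition template_formula (F : nat -> nat -> formula 21) : Prop :=
  template (fun D Q => encode_formula (F D Q)).

Lemma template_formula_const F : template_formula (fun _ _ => F).
Proof. exact: template_const. Qed.

Lemma template_And F G : template_formula F -> template_formula G ->
  template_formula (fun D Q => And (F D Q) (G D Q)).
Proof.
move=> hF hG; apply: (template_cat (template_const [:: true; false])).
exact: template_cat hF hG.
Qed.

Lemma template_Or F G : template_formula F -> template_formula G ->
  template_formula (fun D Q => Or (F D Q) (G D Q)).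
Proof.
move=> hF hG; apply: (template_cat (template_const [:: true; true])).
exact: template_cat hF hG.
Qed.

Lemma template_Not F : template_formula F -> template_formula (fun D Q => Not (F D Q)).
Proof. by move=> hF; apply: (template_cat (template_const [:: false; true])). Qed.

Lemma template_atom (L : nat -> nat -> form) b :
  (forall i, template (fun D Q => encode_coef (L D Q i))) -> template_formula (fun D Q => atom (L D Q) b).
Proof.
move=> hL; have [ps hps] := template_flatten (enum 'I_21) (fun i => hL (val i)).
have [qs hqs] := template_const (encode_coef b).
exists ([:: inl [:: false; false]] ++ ps ++ qs) => D Q.
rewrite !map_cat !flatten_cat -hps -(hqs D Q) /atom [LHS]/= -map_comp.
by [].
Qed.

Lemma template_product t : template_formula (fun D Q => product_formula t D Q).
Proof.
have h i j k : template_formula (fun D Q => int_eq_formula D Q i j k).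
  have hc (m : nat) : template (fun D Q => encode_coef (if m == i then (D%:Z, 0)
      else if m == j then (Q%:Z, 0) else if m == k then (-1, 0) else 0)).
    case: (m == i); first exact: (template_coef false).
    by case: (m == j); [exact: (template_coef true) | exact: template_const].
  by apply: template_And; [|apply: template_Not]; apply: template_atom.
by do ![exact: template_formula_const | exact: h | apply: template_And].
Qed.

Lemma template_body t c d s S acc r0 J :
  template_formula (fun D Q => body_formula t c d s S acc r0 J D Q).
Proof.
rewrite /body_formula /difference_formula.
by do ![exact: template_formula_const | exact: template_product | apply: template_And | apply: template_Or].
Qed.

End Templates.

(** * The clash coefficient as a word of digits *)

Section DigitWords.
Local Open Scope nat_scope.

Lemma horner_digit_sum (R : realType) (B C : R) (t : nat) (w : seq bool) :
  (B * C = 1)%R -> (B + C = (t + 2)%:R)%R -> (1 < B)%R -> 2 <= t ->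
  (Posz (horner t w (0, 0)).1, Posz (horner t w (0, 0)).2) = digit_sum t (nth false (rev w)) (size w).
Proof.
move=> BC BDC B1 t2; apply: (pair_val_inj BC BDC B1 t2).
have vpw i : pair_val B (pair_pow t i) = (B ^+ i)%R := val_pow BC BDC i.
elim/last_ind: w => [|w b IH]; first by rewrite /pair_val /= mul0r addr0.
rewrite /horner foldl_rcons -/(horner t w (0, 0)); case: (horner t w (0, 0)) IH => D Q /= IH.
have -> : pair_val B (Posz (b + D + t * Q), Posz (D + t.+1 * Q)) = (b%:R + B * pair_val B (Posz D, Posz Q))%R.
  have -> : (b%:R + B * pair_val B (Posz D, Posz Q) = pair_val B (Posz b, 0%R) + pair_val B (pair_mul t (1%R, 1%R) (Posz D, Posz Q)))%R.
    by rewrite (valM BC BDC) /pair_val /=; ring.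
  rewrite -pair_valD; congr pair_val; rewrite /pair_mul; congr pair; rewrite /= ?mul1r; lia.
rewrite IH rev_rcons size_rcons; elim: (size w) => [|n IHn] /=.
  rewrite pair_valD pair_val0 mulr0 !addr0; case: (b); rewrite ?pair_val0 //.
  by rewrite /pair_val /= mul0r addr0.
rewrite !pair_valD mulrDr addrCA IHn /=; congr (_ + _)%R; last exact: pair_valD.
by case: (nth _ _ _); [rewrite vpw -exprS -(vpw n.+1) | rewrite !pair_val0 mulr0].
Qed.

Variables (G : finType) (first : G).
Notation S := (block_size G).

(** The [S] digits of the clash set that belong to one distance, highest exponent first. *)
Definition block_word (rel : G -> G -> bool) : seq bool := rev (mkseq (clash first rel) S).

Lemma eq_block_word rel rel' : rel =2 rel' -> block_word rel = block_word rel'.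
Proof. by move=> E; congr rev; apply: eq_map => r; rewrite /clash E. Qed.

Lemma rev_clashes_word (ok : nat -> G -> G -> bool) D :
  rev (mkseq (clashes ok D first) (S * D.+1)) = flatten [seq block_word (ok d) | d <- rev (iota 0 D.+1)].
Proof.
have H m : m <= D.+1 -> rev (mkseq (clashes ok D first) (S * m)) = flatten [seq block_word (ok d) | d <- rev (iota 0 m)].
  elim: m => [|m IH] lt_m; first by rewrite muln0.
  rewrite -addn1 iotaD rev_cat map_cat flatten_cat /= cats0 -IH; last exact: ltnW.
  rewrite addn1 mulnS addnC /mkseq iotaD map_cat rev_cat; congr (_ ++ _).
  congr rev; rewrite -[X in iota X _]addn0 iotaDl -map_comp; apply/eq_in_map => r.
  rewrite mem_iota /= add0n => lt_r; rewrite /clashes mulnC divnMDl // divn_small // addn0 modnMDl modn_small //.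
  by rewrite -ltnS lt_m.
exact: H.
Qed.

End DigitWords.

(** * The polynomial-time reduction *)

Section Reduction.
Local Open Scope nat_scope.
Variables (R : realType) (alpha B C : R) (t : nat) (c d : int).
Hypothesis unitB : unit_data alpha B C t c d.
Variables (M : machine) (A : language) (a k : nat).
Hypothesis decides : forall x : seq bool,
  (exists (n : nat) (b : bool), verdict (run M n x).1 = Some b /\ (A x <-> b)) /\
  (forall n : nat, Defs.space (run M n x) <= a * (size x).+1 ^ k).

Lemma run_halted x m n b : verdict (run M m x).1 = Some b -> m <= n -> run M n x = run M m x.
Proof.
move=> hm; elim: n => [|n IH]; first by rewrite leqn0 => /eqP->.
rewrite leq_eqVlt => /orP[/eqP->//|]; rewrite ltnS => /IH E.
by rewrite /run iterS -/(run M n x) E /step hm.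
Qed.

Lemma verdict_uniq x m n b b' :
  verdict (run M m x).1 = Some b -> verdict (run M n x).1 = Some b' -> b = b'.
Proof.
move=> hm hn; case: (leqP m n) => [le|/ltnW le].
  by move: hn; rewrite (run_halted hm le) hm => -[].
by move: hm; rewrite (run_halted hn le) hn => -[].
Qed.

Lemma accepts_language x : A x <-> exists n, accepts (xrun M x n).1.
Proof.
have [[n [b [hn Ab]]] _] := decides x; split=> [/Ab Eb|[[|[|m]] //]].
  by exists n.+2; rewrite xrun_lift /accepts /= hn Eb.
by rewrite xrun_lift /accepts /= => /eqP hm; apply/Ab; rewrite (verdict_uniq hn hm).
Qed.

Definition extra_columns (x : seq bool) : nat := a * (size x).+1 ^ k.
(** The input behind its two blanks initially takes [n + 2] cells, and the proper configurations
    stay within [extra_columns] cells; the sum leaves the last column blank at all times. *)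
Definition width (x : seq bool) : nat := size x + 3 + extra_columns x.

Lemma tape_size (n : nat) (x : seq bool) i l b r : (run M n x).2 i = (l, b, r) ->
  size l + (size r).+1 <= extra_columns x.
Proof.
move=> E; have [_ /(_ n)] := decides x; apply: leq_trans.
rewrite /Defs.space (bigD1 i) //= E /= size_cat size_rev /=; exact: leq_addr.
Qed.

Lemma width_blank x n i :
  ((xrun M x n).2 i).1 (width x).-2 = None /\ ((xrun M x n).2 i).2 (width x).-1 = None.
Proof.
have [E1 E2] : (width x).-2 = (size x + extra_columns x).+1 /\ (width x).-1 = (size x + extra_columns x).+2.
  by rewrite /width; lia.
rewrite E1 E2; have nthx m : size x <= m -> nth None (@word_tape (aux M) x) m = None.
  by move=> h; rewrite nth_default // size_map.
case: n => [|[|n]]; last first.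
  rewrite xrun_lift /lift_config /=; case E: ((run M n x).2 i) => [[l b] r] /=.
  have h := tape_size E; have hl := leq_trans (leq_addr _ _) h; have hr := leq_trans (leq_addl _ _) h.
  rewrite /stack_tape /=; split; apply: nth_default.
    by rewrite leqW // (leq_trans hl) // leq_addl.
  by rewrite leqW // (leq_trans (ltnW hr)) // leq_addl.
- rewrite /xrun /= /xstep /= /next /=; case: (i == ord0); rewrite /stream_write /stack_tape /=.
    by rewrite nth_nil nthx // leqW // leq_addr.
  by rewrite ?nth_nil.
rewrite /xrun /= /stack_tape /= ?nth_nil; case: (i == ord0); rewrite ?nth_nil //=.
by rewrite nthx // leq_addr.
Qed.

Notation letters := (letter M).

Definition row0_relation (s : symbol (aux M)) (u v : letters) : bool :=
  (u == corner M) ==> ((v == None) || (v == init_cell s)).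

Notation block := (block_word (corner M)).

(** Blocks are listed by decreasing distance: [width + 1], [width] and [width - 1] here, then one
    per extra column, the input bits from the last one on, and the distances 1 and 0 in
    [bottom_word]. From 2 to [width - 2] only the first row is constrained, so each of these blocks
    depends on a single symbol. *)
Definition top_word : seq bool :=
  block (@below_right M) ++ block (@below M) ++
  block (fun u v => below_left u v && row0_relation None u v).
Definition blank_word : seq bool := block (row0_relation None).
Definition bit_word (b : bool) : seq bool := block (row0_relation (Some (inl b))).
Definition bottom_word : seq bool :=
  block (fun u v => same_row u v && row0_relation None u v) ++ block (fun u v : letters => u == v).

Lemma digit_word_clashes x :
  digit_word a k top_word blank_word bottom_word bit_word x =
  rev (mkseq (clashes (@compatible M x (width x)) (width x).+1 (corner M))
             (block_size letters * (width x).+2)).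
Proof.
rewrite rev_clashes_word.
set ok := @compatible M x (width x); set n := size x; set L := extra_columns x.
have Ew : width x = n + 3 + L by [].
have lam3 : 3 <= width x by rewrite Ew addnAC addnC leq_addr.
have E0 : ok 0 =2 (fun u v : letters => u == v).
  move=> u v; rewrite /ok /compatible /=.
  have -> : (0 == (width x).-1) = false by lia.
  have -> : (0 == width x) = false by lia.
  by rewrite /= andbT.
have E1 : ok 1 =2 (fun u v => same_row u v && row0_relation None u v).
  move=> u v; rewrite /ok /compatible /=.
  have -> : (1 == (width x).-1) = false by lia.
  have -> : (1 == width x) = false by lia.
  have -> : (1 == (width x).+1) = false by lia.
  by rewrite (_ : 1 < width x) //; lia.
have Emid j : 2 <= j -> j <= n + 1 + L -> ok j =2 row0_relation (nth None [:: None, None & @word_tape (aux M) x] j).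
  move=> j2 jl u v; rewrite /ok /compatible.
  have -> : (j == 0) = false by lia.
  have -> : (j == 1) = false by lia.
  have -> : (j == (width x).-1) = false by lia.
  have -> : (j == width x) = false by lia.
  have -> : (j == (width x).+1) = false by lia.
  by rewrite (_ : 0 < j < width x) //; apply/andP; split; lia.
have El : ok (width x).-1 =2 (fun u v => below_left u v && row0_relation None u v).
  move=> u v; rewrite /ok /compatible eqxx.
  have -> : ((width x).-1 == 0) = false by lia.
  have -> : ((width x).-1 == 1) = false by lia.
  have -> : ((width x).-1 == width x) = false by lia.
  have -> : ((width x).-1 == (width x).+1) = false by lia.
  rewrite (_ : 0 < (width x).-1 < width x) /=; last by apply/andP; split; lia.
  rewrite /in_row0 nth_default //= size_map; lia.
have Ev : ok (width x) =2 @below M.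
  move=> u v; rewrite /ok /compatible eqxx ltnn andbF /= andbT.
  have -> : (width x == 0) = false by lia.
  have -> : (width x == 1) = false by lia.
  have -> : (width x == (width x).-1) = false by lia.
  have -> : (width x == (width x).+1) = false by lia.
  by rewrite /= andbT.
have Er : ok (width x).+1 =2 @below_right M.
  move=> u v; rewrite /ok /compatible eqxx (ltnNge (width x).+1) leqnSn andbF /= andbT.
  have -> : ((width x).+1 == 1) = false by lia.
  have -> : ((width x).+1 == (width x).-1) = false by lia.
  by have -> : ((width x).+1 == width x) = false by lia.
move: (ok) (width x) Ew lam3 E0 E1 Emid El Ev Er => {}ok w Ew lam3 E0 E1 Emid El Ev Er.
have -> : w.+2 = 2 + (n + (L + 3)) by rewrite Ew; lia.
rewrite !iotaD !rev_cat !map_cat !flatten_cat /digit_word -/(extra_columns x) -/L /top_word /bottom_word.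
have blockE rel j : ok j =2 rel -> block (ok j) = block rel by exact: eq_block_word.
have Ebot : flatten [seq block (ok j) | j <- rev (iota 0 2)] =
    block (fun u v => same_row u v && row0_relation None u v) ++ block (fun u v : letters => u == v).
  by rewrite /= cats0 (blockE _ _ E0) (blockE _ _ E1).
have Etop : flatten [seq block (ok j) | j <- rev (iota (0 + 2 + n + L) 3)] =
    block (@below_right M) ++ block (@below M) ++ block (fun u v => below_left u v && row0_relation None u v).
  have -> : iota (0 + 2 + n + L) 3 = [:: w.-1; w; w.+1].
    have -> : 0 + 2 + n + L = w.-1 by rewrite Ew; lia.
    by case: (w) lam3.
  by rewrite /rev /= cats0 (blockE _ _ El) (blockE _ _ Ev) (blockE _ _ Er).
have Ein : flatten [seq block (ok j) | j <- rev (iota (0 + 2) n)] = flatten [seq bit_word b | b <- rev x].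
  rewrite !map_rev; congr flatten; congr rev; apply: (@eq_from_nth _ [::]); rewrite !size_map size_iota // => i hi.
  rewrite (nth_map 0) ?size_iota // nth_iota // (nth_map false) //.
  have j2 : 2 <= 0 + 2 + i by lia.
  have jL : 0 + 2 + i <= n + 1 + L by move: hi; rewrite -/n; lia.
  rewrite (blockE _ _ (Emid _ j2 jL)) /=.
  by rewrite /bit_word /word_tape (nth_map false).
have Ebl : flatten [seq block (ok j) | j <- rev (iota (0 + 2 + n) L)] = flatten (nseq L blank_word).
  rewrite map_rev; congr flatten; apply: (@eq_from_nth _ [::]); rewrite size_rev ?size_nseq size_map size_iota // => i hi.
  rewrite nth_rev size_map size_iota // (nth_map 0) ?size_iota ?nth_nseq ?hi; last by lia.
  rewrite nth_iota; last by lia.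
  have j2 : 2 <= 0 + 2 + n + (L - i.+1) by lia.
  have jL : 0 + 2 + n + (L - i.+1) <= n + 1 + L by lia.
  rewrite (blockE _ _ (Emid _ j2 jL)) nth_default //= size_map -/n; lia.
by rewrite Ebot Etop Ein Ebl -!catA.
Qed.

Lemma reduction K : 300 <= K -> poly_reducible A (true_sentences alpha prefix3 K).
Proof.
move=> K300.
have [_ BC BDC B1 t2] := unitB.
pose sent D Q := tiling_sentence t c d (corner M) (None : letters) D Q.
have [ps hps] : template (fun D Q => encode (sent D Q)).
  apply: (template_cat (template_const _)); exact: template_body.
exists (transducer_output t a k top_word blank_word bottom_word bit_word ps).
split; first by apply: polytime_transducer; apply: ltnW.
move=> x; set p := horner t (digit_word a k top_word blank_word bottom_word bit_word x) (0, 0).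
have -> : transducer_output t a k top_word blank_word bottom_word bit_word ps x = encode (sent p.1 p.2).
  by rewrite hps.
have lam3 : 2 < width x by rewrite /width addnAC addnC leq_addr.
have Ep : (Posz p.1, Posz p.2) = clash_pair t (@compatible M x (width x)) (width x).+1 (corner M).
  rewrite /p (horner_digit_sum _ BC BDC B1 t2) digit_word_clashes revK size_rev size_mkseq.
  by apply: digit_sum_ext => i hi; rewrite nth_mkseq.
have ok0 (u v : letters) : @compatible M x (width x) 0 u v = (u == v).
  rewrite /compatible /=; have -> : (0 == (width x).-1) = false by lia.
  have -> : (0 == width x) = false by lia.
  by rewrite /= andbT.
have main : holds alpha (sent p.1 p.2) <-> A x.
  apply: (iff_trans (holds_tiling_sentence unitB None ok0 Ep)).
  apply: (iff_trans (tileable_accepting lam3 (@width_blank x))).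
  exact: iff_sym (accepts_language x).
(* A word of the language is the code of some true sentence; injectivity of the encoding identifies
   it with the sentence produced. *)
split=> [/main hs|[s [_ _ hs /encode_inj Es]]]; last by apply/main; rewrite -Es.
exists (sent p.1 p.2); split=> //.
by apply: leq_trans K300; exact: num_ineqs_body.
Qed.

End Reduction.

(** Only coefficients depend on [alpha] and on the machine, not the number of inequalities, so 300
    serves for all of them. *)
Lemma true_sentences_hard (R : realType) (alpha B C : R) (t : nat) (c d : int) (K : nat) :
  unit_data alpha B C t c d -> (300 <= K)%N -> PSPACE_hard (true_sentences alpha prefix3 K).
Proof.
move=> unitB K300 A [M [p hM]]; have [a [k hp]] := poly_le_monomial p.
apply: (reduction unitB (M := M) (a := a) (k := k)) => // x.
have [h1 h2] := hM x; split => // n.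
exact: leq_trans (h2 n) (hp _).
Qed.

Theorem theorem1p4 (R : realType) :
  (forall alpha : R, quadratic alpha ->
     exists K : nat,
       PSPACE_hard
         (true_sentences alpha [:: (Ex, 6%N); (All, 4%N); (Ex, 11%N)] K)) /\
  PSPACE_hard
    (true_sentences (Num.sqrt (2 : R)) 
       [:: (Ex, 6%N); (All, 4%N); (Ex, 11%N)] (10 ^ 6)%N).
Proof.
split=> [alpha quad|].
  have [B [C [t [c [d unitB]]]]] := quadratic_unit quad.
  by exists 300%N; apply: (true_sentences_hard unitB).
apply: (true_sentences_hard (sqrt2_unit R)).
apply: (@leq_trans (10 ^ 3)); first by [].
by rewrite leq_pexp2l.
Qed.
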